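(* Let $\varepsilon>0$, let $A\subseteq\mathbb{R}^2$ be a nonempty bounded $2\varepsilon$-chained set, and let $D$ be a connected component of the subspace $\mathbb{R}^2\setminus \mathsf{B}_\varepsilon(A)$. Then the boundary $\partial D$ of $D$ in $\mathbb{R}^2$ is a simple closed curve, $\partial D\subseteq \mathsf{S}_\varepsilon(A)$, and moreover: if $D$ is bounded then $D=(\partial D)^-$, and if $D$ is unbounded then $D=(\partial D)^+$.
   Context: $\rho$ denotes Euclidean distance; for sets $X,Y\subseteq\mathbb{R}^2$, $\rho(X,Y)=\inf\{\rho(x,y):x\in X,y\in Y\}$ and $\rho(p,X)=\rho(\{p\},X)$. For $\varepsilon>0$ and $A\subseteq\mathbb{R}^2$: $\mathsf{B}_\varepsilon(A)=\{p\in\mathbb{R}^2:\rho(p,A)\le\varepsilon\}$ (closed $\varepsilon$-neighbourhood) and $\mathsf{S}_\varepsilon(A)=\{p\in\mathbb{R}^2:\rho(p,A)=\varepsilon\}$ (the $\varepsilon$-boundary). A set $A$ is $\delta$-chained ($\delta>0$) if for any $p,q\in A$ there are points $r_0=p,r_1,\dots,r_n=q$ in $A$ with $\rho(r_i,r_{i+1})<\delta$ for all $i<n$. A simple closed curve is a subset homeomorphic to a circle; for a simple closed curve $C\subseteq\mathbb{R}^2$, $C^-$ and $C^+$ denote the bounded and the unbounded component of $\mathbb{R}^2\setminus C$, respectively. *)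

(* Defs.v *)
(* the plane is R * R (R : realType) with its
   product topology (= Euclidean topology). *)
From HB Require Import structures.
From mathcomp Require Import all_boot all_order all_algebra.
From mathcomp Require Import all_classical all_reals all_analysis.
Set Implicit Arguments. Unset Strict Implicit. Unset Printing Implicit Defensive.
Import Order.TTheory GRing.Theory Num.Theory numFieldTopology.Exports numFieldNormedType.Exports.
Local Open Scope classical_set_scope.
Local Open Scope ring_scope.

Section Plane.
Variable R : realType.
Local Notation pt := (R * R)%type.

Definition rho (p q : pt) : R :=
  Num.sqrt ((p.1 - q.1) ^+ 2 + (p.2 - q.2) ^+ 2).

Definition rho_set (p : pt) (X : set pt) : R := inf [set rho p x | x in X].

Definition Bnbhd (eps : R) (A : set pt) : set pt := [set p | rho_set p A <= eps].
Definition Sbdry (eps : R) (A : set pt) : set pt := [set p | rho_set p A = eps].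

Definition chained (delta : R) (A : set pt) : Prop :=
  forall p q, A p -> A q ->
    exists (n : nat) (r : nat -> pt),
      r 0%N = p /\ r n = q /\ (forall i, (i <= n)%N -> A (r i)) /\
      (forall i, (i < n)%N -> rho (r i) (r i.+1) < delta).

Definition bounded_pt (X : set pt) : Prop :=
  exists M : R, forall p, X p -> rho p (0, 0) <= M.

Definition boundary (X : set pt) : set pt := closure X `\` interior X.

Definition circle : set pt := [set p | p.1 ^+ 2 + p.2 ^+ 2 = 1].

Definition simple_closed_curve (C : set pt) : Prop :=
  exists (f g : pt -> pt),
    {within circle, continuous f} /\ f @` circle = C /\
    {within C, continuous g} /\ g @` C `<=` circle /\
    (forall x, circle x -> g (f x) = x) /\ (forall y, C y -> f (g y) = y).

(* C^- : the bounded component of R^2 \ C (union of the bounded components),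
   C^+ : the unbounded component (union of the unbounded components). *)
Definition inside (C : set pt) : set pt :=
  [set p | ~ C p /\ bounded_pt (connected_component (~` C) p)].
Definition outside (C : set pt) : set pt :=
  [set p | ~ C p /\ ~ bounded_pt (connected_component (~` C) p)].

Definition is_component (X D : set pt) : Prop :=
  exists x, X x /\ D = connected_component X x.
End Plane.

(* Main.v *)
(** Let [K] be the closure of [A] and [C] the boundary of [D]; points of [C] lie at distance
    exactly [eps] from [K]. The complement of [D] is connected, because a segment from a point
    outside [D] to a nearest point of [K] avoids [D] and the open neighbourhood of [K] is
    connected by the chain condition. Hence [C] is connected: if it split as [P] and [Q], the
    signed crossings of [C] near [Q] would be a cocycle, and the plane has no first cohomology.

    Near [p] in [C] the nearest points of [K] lie in a closed half plane. If they lie in an open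
    one, [C] is a graph near [p]. Otherwise two of them are antipodal; [D] touches [p] from one
    side only, since the angle under which a chain of [K] between the two antipodal points is
    seen depends continuously on the viewpoint in [D] and at [p], whereas the angle subtended by
    the diameter jumps across it; and there [C] consists of two graphs issued from [p]. So [C]
    is a compact connected 1-manifold, and extending an arc through finitely many charts closes
    it up to a circle.

    Finally, everything outside the closure of [D] lies in one component of the complement of
    [C]: where a segment from another component to a nearest point of [K] enters the
    neighbourhood, the outside is locally connected, so that entry point is not in [C]. *)

Require Import Defs.
From HB Require Import structures.
From mathcomp Require Import all_boot all_order all_algebra.
From mathcomp Require Import all_classical all_reals all_analysis.
From mathcomp Require Import ring lra.
Set Implicit Arguments. Unset Strict Implicit. Unset Printing Implicit Defensive.
Import Order.TTheory GRing.Theory Num.Theory numFieldTopology.Exports numFieldNormedType.Exports.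
Local Open Scope classical_set_scope.
Local Open Scope ring_scope.


(** * The plane: continuity, segments, components *)

(** [A] enters only through its closure, which supplies nearest points, and through the chain
    condition, restated as an induction principle: a transitive relation that holds between points
    of [K] closer than [2 * eps] holds on all of [K]. It serves twice, for lying in one component of
    the open neighbourhood and for having a continuous half angle. The strict bound matters both
    times: the segment between two such points stays in the open neighbourhood, so no viewpoint off
    that neighbourhood sees it under a straight angle.

    No angle is ever a real number. Two directions combine to a complex number, and a continuous
    square root of it is carried along the chain; roots multiply, and the only ambiguity is a sign,
    which the connectedness of [D] fixes. A jump by a full turn becomes a change of that sign.

    The closed half plane at [p] comes from a limit of directions in which [D] approaches [p]. Only
    two antipodal positions on its border can spoil a graph; if one of them is empty, compactness
    leaves room to tilt the half plane until all nearest points are strictly inside. *)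

Lemma exists_le2 (R : realType) (b x y : R) : b < x -> b < y ->
  exists m, [/\ b < m, m <= x & m <= y].
Proof. by move=> bx b_y; exists (Num.min x y); rewrite lt_min !ge_min !lexx orbT bx b_y. Qed.

Section ContinuityRules.
Variables (R : realType) (T : topologicalType).
Implicit Types f g : T -> R.
Implicit Types h : T -> R * R.

Lemma contC (U : topologicalType) (c : U) : continuous (fun _ : T => c).
Proof. exact: cst_continuous. Qed.

Lemma contD f g : continuous f -> continuous g -> continuous (fun x => f x + g x).
Proof. by move=> cf cg x; apply: cvgD; [exact: cf|exact: cg]. Qed.

Lemma contN f : continuous f -> continuous (fun x => - f x).
Proof. by move=> cf x; apply: cvgN; exact: cf. Qed.

Lemma contM f g : continuous f -> continuous g -> continuous (fun x => f x * g x).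
Proof. by move=> cf cg x; apply: cvgM; [exact: cf|exact: cg]. Qed.

Lemma contX f n : continuous f -> continuous (fun x => f x ^+ n).
Proof.
move=> cf; elim: n => [|n IH]; first exact: contC.
rewrite (_ : (fun x => _) = (fun x => f x * f x ^+ n)); first exact: contM.
by apply/funext => y; rewrite exprS.
Qed.

Lemma cont_comp (U : topologicalType) (g : R -> U) f :
  continuous g -> continuous f -> continuous (fun x => g (f x)).
Proof. by move=> cg cf x; apply: (@continuous_comp _ _ _ f g); [exact: cf|exact: cg]. Qed.

Lemma cont_compP (U : topologicalType) (g : R * R -> U) h :
  continuous g -> continuous h -> continuous (fun x => g (h x)).
Proof. by move=> cg cf x; apply: (@continuous_comp _ _ _ h g); [exact: cf|exact: cg]. Qed.

Lemma cont_sqrt f : continuous f -> continuous (fun x => Num.sqrt (f x)).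
Proof. by move=> cf; apply: (cont_comp _ cf); exact: sqrt_continuous. Qed.

Lemma cont_norm f : continuous f -> continuous (fun x => `|f x|).
Proof. by move=> cf x; apply: cvg_norm; exact: cf. Qed.

Lemma cont_max f g : continuous f -> continuous g ->
  continuous (fun x => Num.max (f x) (g x)).
Proof.
move=> cf cg; rewrite (_ : (fun x => _) = (fun x => 2^-1 * (f x + g x + `|f x + - g x|))).
  apply: contM; first exact: contC.
  apply: contD; first exact: contD.
  exact: (cont_norm (contD cf (contN cg))).
by apply/funext => x; have [h|h] := leP (f x) (g x);
  [rewrite ler0_norm ?subr_le0|rewrite gtr0_norm ?subr_gt0]; rewrite //; lra.
Qed.

Lemma cont_min f g : continuous f -> continuous g ->
  continuous (fun x => Num.min (f x) (g x)).
Proof.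
move=> cf cg; rewrite (_ : (fun x => _) = (fun x => - Num.max (- f x) (- g x))).
  exact: (contN (cont_max (contN cf) (contN cg))).
by apply/funext => x; rewrite oppr_max !opprK.
Qed.

Lemma cont_fst (U V : topologicalType) (h : T -> U * V) : continuous h -> continuous (fun x => (h x).1).
Proof. by move=> ch x; apply: (@continuous_comp _ _ _ h fst); [exact: ch|exact: cvg_fst]. Qed.

Lemma cont_snd (U V : topologicalType) (h : T -> U * V) : continuous h -> continuous (fun x => (h x).2).
Proof. by move=> ch x; apply: (@continuous_comp _ _ _ h snd); [exact: ch|exact: cvg_snd]. Qed.

Lemma cont_pair f g : continuous f -> continuous g -> continuous (fun x => (f x, g x)).
Proof. by move=> cf cg x; exact: (cvg_pair (cf x) (cg x)). Qed.

Lemma open_ltf f g : continuous f -> continuous g -> open [set x | f x < g x].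
Proof.
move=> cf cg; rewrite (_ : [set _ | _] = (fun x => f x + - g x) @^-1` [set y | y < 0]).
  apply: open_comp; last exact: (@open_lt R 0).
  by move=> x _; exact: (contD cf (contN cg)).
by apply/seteqP; split => x /=; rewrite subr_lt0.
Qed.

Lemma closed_lef f g : continuous f -> continuous g -> closed [set x | f x <= g x].
Proof.
move=> cf cg; rewrite (_ : [set _ | _] = ~` [set x | g x < f x]).
  by apply: open_closedC; exact: open_ltf.
by apply/seteqP; split => x /=; rewrite leNgt => /negP.
Qed.

End ContinuityRules.

Lemma cont_id (T : topologicalType) : continuous (fun x : T => x).
Proof. by move=> x; exact: cvg_id. Qed.

Ltac cont := repeat lazymatch goal with
  | H : continuous ?f |- continuous ?f => exact: H
  | |- continuous (fun x => x) => exact: cont_id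
  | |- continuous (fun _ => ?c) => exact: contC
  | |- continuous (fun x => (_ ^+ _)) => apply: contX
  | |- continuous (fun x => (_ + _)) => apply: contD
  | |- continuous (fun x => (- _)) => apply: contN
  | |- continuous (fun x => (_ * _)) => apply: contM
  | |- continuous (fun x => (_, _)) => apply: cont_pair
  | |- continuous (fun x => Num.sqrt _) => apply: cont_sqrt
  | |- continuous (fun x => `|_|) => apply: cont_norm
  | |- continuous (fun x => Num.max _ _) => apply: cont_max
  | |- continuous (fun x => Num.min _ _) => apply: cont_min
  | |- continuous (fun x => (_).1) => apply: cont_fst
  | |- continuous (fun x => (_).2) => apply: cont_snd
  | |- continuous (@GRing.opp _) => exact: (contN (@cont_id _))
  | |- continuous (@GRing.add _ ?c) => exact: (contD (@contC _ _ c) (@cont_id _))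
  | |- continuous (@GRing.mul _ ?c) => exact: (contM (@contC _ _ c) (@cont_id _))
  | |- continuous (@fst _ _) => exact: (cont_fst (@cont_id _))
  | |- continuous (@snd _ _) => exact: (cont_snd (@cont_id _))
  end.

Section PlaneBasics.
Variable R : realType.
Local Notation pt := (R * R)%type.
Implicit Types (p q x y z : pt) (X Y D V : set pt).

(** Squared distances are polynomial, which keeps comparisons within reach of [ring], [lra] and
    [nra]; [rho_le] and [rho_lt] translate. *)
Definition sqd x y : R := (x.1 - y.1) ^+ 2 + (x.2 - y.2) ^+ 2.

Definition dotp x y : R := x.1 * y.1 + x.2 * y.2.

Lemma sqd_ge0 x y : 0 <= sqd x y.
Proof. by rewrite /sqd addr_ge0 ?sqr_ge0. Qed.

Lemma sqdC x y : sqd x y = sqd y x.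
Proof. by rewrite /sqd; ring. Qed.

Lemma rhoE x y : rho x y = Num.sqrt (sqd x y).
Proof. by []. Qed.

Lemma rho_ge0 x y : 0 <= rho x y.
Proof. exact: sqrtr_ge0. Qed.

Lemma rho_sqr x y : rho x y ^+ 2 = sqd x y.
Proof. by rewrite rhoE sqr_sqrtr// sqd_ge0. Qed.

Lemma rho_le x y (e : R) : 0 <= e -> (rho x y <= e) = (sqd x y <= e ^+ 2).
Proof. by move=> e0; rewrite -rho_sqr ler_sqr// ?nnegrE ?rho_ge0. Qed.

Lemma rho_lt x y (e : R) : 0 <= e -> (rho x y < e) = (sqd x y < e ^+ 2).
Proof. by move=> e0; rewrite -rho_sqr ltr_sqr// ?nnegrE ?rho_ge0. Qed.

Lemma cont_sqd (T : topologicalType) (f g : T -> pt) :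
  continuous f -> continuous g -> continuous (fun i => sqd (f i) (g i)).
Proof. by move=> cf cg; rewrite /sqd; cont. Qed.

Lemma cont_rho (T : topologicalType) (f g : T -> pt) :
  continuous f -> continuous g -> continuous (fun i => rho (f i) (g i)).
Proof. by move=> cf cg; apply: cont_sqrt; exact: cont_sqd. Qed.

Lemma nbhs_boxP p X : nbhs p X <->
  exists2 r : R, 0 < r & forall x, `|x.1 - p.1| < r -> `|x.2 - p.2| < r -> X x.
Proof.
split=> [/nbhs_ballP[r /= r0 h]|[r r0 h]].
  exists r => // x h1 h2; apply: h; split; rewrite /ball /= distrC//.
apply/nbhs_ballP; exists r => //= x [h1 h2].
by apply: h; rewrite distrC.
Qed.

Lemma nbhs_sqdP p X : nbhs p X <-> exists2 r : R, 0 < r & forall x, sqd x p < r -> X x.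
Proof.
split=> [/nbhs_boxP[r r0 h]|[r r0 h]].
  exists (r ^+ 2); rewrite ?exprn_gt0// => x hx.
  have ab (a b : R) : a ^+ 2 + b ^+ 2 < r ^+ 2 -> `|a| < r.
    move=> H; rewrite -ltr_sqr ?nnegrE ?normr_ge0 ?(ltW r0)// real_normK ?num_real//.
    by apply: le_lt_trans H; rewrite lerDl sqr_ge0.
  by apply: h; [apply: (ab _ (x.2 - p.2))|apply: (ab _ (x.1 - p.1)); rewrite addrC].
have ho : open [set x | sqd x p < r].
  apply: open_ltf; last exact: contC.
  by apply: cont_sqd; [exact: cont_id|exact: contC].
apply: (@filterS _ (nbhs p) _ [set x | sqd x p < r]) => //.
apply: open_nbhs_nbhs; split => //=; rewrite /sqd !subrr expr0n /= addr0//.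
Qed.

Lemma closureP_sqd X p : closure X p <->
  forall r : R, 0 < r -> exists2 x, X x & sqd x p < r.
Proof.
split=> [h r r0|h W /nbhs_sqdP[r r0 hW]].
  have /h[x [Xx xr]] : nbhs p [set x | sqd x p < r] by apply/nbhs_sqdP; exists r.
  by exists x.
by have [x Xx xr] := h r r0; exists x; split => //; exact: hW.
Qed.

Definition seg x y (t : R) : pt := (x.1 + t * (y.1 - x.1), x.2 + t * (y.2 - x.2)).

Lemma cont_seg x y : continuous (seg x y).
Proof. by rewrite /seg; cont. Qed.

Lemma seg0 x y : seg x y 0 = x.
Proof. by rewrite /seg !mul0r !addr0 -surjective_pairing. Qed.

Lemma seg1 x y : seg x y 1 = y.
Proof. by rewrite /seg !mul1r ![_ + (_ - _)]addrC !subrK -surjective_pairing. Qed.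

Lemma path_component X (g : R -> pt) (a b : R) : continuous g -> a <= b ->
  (forall t, a <= t <= b -> X (g t)) -> connected_component X (g a) (g b).
Proof.
move=> cg ab h; apply: (@connected_component_max _ X (g @` `[a, b])).
- by exists a => //=; rewrite in_itv/= lexx ab.
- by move=> _ [t /= tab <-]; apply: h; rewrite in_itv/= in tab.
- apply: connected_continuous_connected; first exact: segment_connected.
  exact: continuous_subspaceT.
- by exists b => //=; rewrite in_itv/= lexx ab.
Qed.

Lemma seg_component X x y : (forall t, 0 <= t <= 1 -> X (seg x y t)) ->
  connected_component X x y.
Proof.
move=> h; rewrite -{1}(seg0 x y) -(seg1 x y).
have h' := path_component (cont_seg (x := x) (y := y)) ler01 h.
by rewrite seg0 seg1 in h'; rewrite seg0 !seg1.
Qed.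

Lemma connected_component_mono X Y x y : X `<=` Y ->
  connected_component X x y -> connected_component Y x y.
Proof. by move=> XY [B [Bx BX cB] By]; exists B => //; split => //; exact: subset_trans XY. Qed.

Lemma component_in X D x y : is_component X D -> D x -> connected_component X x y -> D y.
Proof.
move=> [z [Xz ->]] zx xy; exact: connected_component_trans xy.
Qed.

Lemma is_component_sub X D : is_component X D -> D `<=` X.
Proof. by move=> [z [Xz ->]]; exact: connected_component_sub. Qed.

Lemma is_component_connected X D : is_component X D -> connected D.
Proof. by move=> [z [Xz ->]]; exact: component_connected. Qed.

Lemma is_component_ne X D : is_component X D -> D !=set0.
Proof. by move=> [z [Xz ->]]; exists z; exact: connected_component_refl. Qed.

Lemma open_is_component X D : open X -> is_component X D -> open D.
Proof.
move=> oX cD; rewrite openE => x Dx.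
have Xx := is_component_sub cD Dx.
have /nbhs_boxP[r r0 hr] : nbhs x X by exact: open_nbhs_nbhs.
apply/nbhs_boxP; exists r => // y y1 y2.
apply: (component_in cD Dx); apply: seg_component => t /andP[t0 t1].
have tt (a : R) : `|a| < r -> `|t * a| < r.
  by move=> ar; rewrite normrM ger0_norm//; apply: le_lt_trans ar; rewrite ler_piMl.
by apply: hr; rewrite /seg /= [_ + t * _ - _]addrAC subrr add0r; exact: tt.
Qed.

(** On [D] the sets [V] and [V'] coincide, so their trace is both open and closed. Typical pairs are
    a strict and a weak inequality, or a domain and its closure. *)
Lemma connected_trap D V V' : connected D -> open V -> closed V' -> V `<=` V' ->
  D `&` V' `<=` V -> D `&` V !=set0 -> D `<=` V.
Proof.
move=> cD oV cV VV' h DV.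
have -> : D `<=` V = (D `&` V = D) by rewrite propeqE; split => /setIidPl.
apply: cD => //; first by exists V.
exists V' => //; apply/seteqP; split => x [Dx Vx]; split => //; first exact: VV'.
exact: h.
Qed.

Lemma boundary_open D : open D -> boundary D = closure D `\` D.
Proof. by move=> oD; rewrite /boundary ((interior_id D).1 oD). Qed.

Lemma bounded_closed_compact_pt X : closed X -> bounded_pt X -> compact X.
Proof.
move=> cX [M hM]; apply: (@subclosed_compact _ _ (`[-M, M] `*` `[-M, M])) => //.
  exact: (compact_setX (@segment_compact _ _ _) (@segment_compact _ _ _)).
move=> x /hM; rewrite rhoE => hx.
have M0 : 0 <= M by apply: le_trans hx; exact: sqrtr_ge0.
have ab (a b : R) : Num.sqrt (a ^+ 2 + b ^+ 2) <= M -> a \in `[-M, M].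
  move=> H; rewrite in_itv/= -ler_norml; apply: le_trans H.
  by rewrite -sqrtr_sqr ler_wsqrtr// lerDl sqr_ge0.
rewrite /sqd /= !subr0 in hx.
by split => /=; [apply: (ab _ x.2)|apply: (ab _ x.1); rewrite addrC].
Qed.

Lemma closure_bounded X : bounded_pt X -> bounded_pt (closure X).
Proof.
move=> [M hM]; exists M.
have cl : closed [set p | rho p (0, 0) <= M].
  by apply: closed_lef; [apply: cont_rho; [exact: cont_id|exact: contC]|exact: contC].
by move=> p /(closureS hM); rewrite -(closure_id _).1.
Qed.

Lemma bounded_sub X Y : X `<=` Y -> bounded_pt Y -> bounded_pt X.
Proof. by move=> XY [M hM]; exists M => p /XY/hM. Qed.

End PlaneBasics.


(** * Closed and open neighbourhoods of a compact set *)

Section Neighbourhoods.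
Variable R : realType.
Local Notation pt := (R * R)%type.
Implicit Types (p q x y z a b : pt) (A K X D : set pt) (e : R).

Lemma rhoC x y : rho x y = rho y x.
Proof. by rewrite !rhoE sqdC. Qed.

Lemma rho_triangle x y z : rho x z <= rho x y + rho y z.
Proof.
have h0 : 0 <= rho x y + rho y z by rewrite addr_ge0 ?rho_ge0.
rewrite rho_le// sqrrD !rho_sqr.
have cs : (x.1 - y.1) * (y.1 - z.1) + (x.2 - y.2) * (y.2 - z.2) <= rho x y * rho y z.
  apply: le_trans (ler_norm _) _.
  rewrite -ler_sqr ?nnegrE ?normr_ge0 ?mulr_ge0 ?rho_ge0//.
  rewrite real_normK ?num_real// exprMn !rho_sqr /sqd -subr_ge0.
  rewrite (_ : _ - _ = ((x.1 - y.1) * (y.2 - z.2) - (x.2 - y.2) * (y.1 - z.1)) ^+ 2).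
    exact: sqr_ge0.
  by ring.
rewrite (_ : sqd x z = sqd x y + sqd y z +
  ((x.1 - y.1) * (y.1 - z.1) + (x.2 - y.2) * (y.2 - z.2)) *+ 2); last first.
  by rewrite /sqd; ring.
by rewrite [leRHS]addrAC lerD2l ler_wMn2r.
Qed.

Lemma sqd_seg_l x y (t : R) : sqd (seg x y t) x = t ^+ 2 * sqd x y.
Proof. by rewrite /sqd /seg /=; ring. Qed.

Lemma sqd_seg_r x y (t : R) : sqd (seg x y t) y = (1 - t) ^+ 2 * sqd x y.
Proof. by rewrite /sqd /seg /=; ring. Qed.

Lemma rho_seg_l x y (t : R) : 0 <= t -> rho (seg x y t) x = t * rho x y.
Proof. by move=> t0; rewrite !rhoE sqd_seg_l sqrtrM ?sqr_ge0// sqrtr_sqr ger0_norm. Qed.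

Lemma rho_seg_r x y (t : R) : t <= 1 -> rho (seg x y t) y = (1 - t) * rho x y.
Proof.
by move=> t1; rewrite !rhoE sqd_seg_r sqrtrM ?sqr_ge0// sqrtr_sqr ger0_norm// subr_ge0.
Qed.

(** A witness in [K] replaces the infimum; for the closure of a nonempty bounded set the two agree
    by [Bnbhd_cnbhd]. *)
Definition cnbhd e K : set pt := [set x | exists2 a, K a & sqd x a <= e ^+ 2].
Definition onbhd e K : set pt := [set x | exists2 a, K a & sqd x a < e ^+ 2].

Lemma onbhd_sub e K : onbhd e K `<=` cnbhd e K.
Proof. by move=> x [a Ka /ltW h]; exists a. Qed.

Lemma open_onbhd e K : open (onbhd e K).
Proof.
rewrite (_ : onbhd e K = \bigcup_(a in K) [set x | sqd x a < e ^+ 2]).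
  apply: bigcup_open => a _; apply: open_ltf; last exact: contC.
  by apply: cont_sqd; [exact: cont_id|exact: contC].
by apply/seteqP; split => x [a Ka h]; exists a.
Qed.

(** The neighbourhood is the Minkowski sum of [K] and a disc, a continuous image of a compact
    product. *)
Lemma compact_cnbhd e K : 0 <= e -> compact K -> compact (cnbhd e K).
Proof.
move=> e0 cK; pose disc : set pt := [set v | sqd v (0, 0) <= e ^+ 2].
have cd : compact disc.
  apply: bounded_closed_compact_pt.
    apply: closed_lef; last exact: contC.
    by apply: cont_sqd; [exact: cont_id|exact: contC].
  by exists e => v; rewrite rho_le.
pose s (u : pt * pt) : pt := (u.1.1 + u.2.1, u.1.2 + u.2.2).
have cs : continuous s.
  apply: cont_pair; apply: contD.
  - exact: (cont_fst (cont_fst (@cont_id _))).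
  - exact: (cont_fst (cont_snd (@cont_id _))).
  - exact: (cont_snd (cont_fst (@cont_id _))).
  - exact: (cont_snd (cont_snd (@cont_id _))).
rewrite (_ : cnbhd e K = s @` (K `*` disc)).
  by apply: continuous_compact; [exact: continuous_subspaceT|exact: compact_setX].
apply/seteqP; split => [x [a Ka h]|_ [[a v] /= [Ka h] <-]].
  exists (a, (x.1 - a.1, x.2 - a.2)) => /=.
    by split => //; rewrite /disc /= /sqd /= !subr0.
  by rewrite /s /= ![_ + (_ - _)]addrC !subrK -surjective_pairing.
by exists a => //; move: h; rewrite /disc /= /sqd /s /= !subr0 ![_ + _ - _]addrAC !subrr !add0r.
Qed.

Lemma pt_hausdorff : hausdorff_space pt.
Proof. exact: norm_hausdorff. Qed.

Lemma closed_cnbhd e K : 0 <= e -> compact K -> closed (cnbhd e K).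
Proof. by move=> e0 cK; apply: compact_closed; [exact: pt_hausdorff|exact: compact_cnbhd]. Qed.

Lemma nearestP K x : compact K -> K !=set0 ->
  exists2 a, K a & forall b, K b -> rho x a <= rho x b.
Proof.
move=> cK K0.
have [|a Ka h] := @compact_EVT_min _ R (fun y => rho x y) _ K0 cK.
  by apply: continuous_subspaceT; apply: cont_rho; [exact: contC|exact: cont_id].
by exists a; [rewrite inE in Ka|move=> b Kb; apply: h; rewrite inE].
Qed.

Lemma rho_set_attained A p : A !=set0 -> bounded_pt A ->
  exists a, [/\ closure A a, rho_set p A = rho p a & forall b, closure A b -> rho p a <= rho p b].
Proof.
move=> A0 bA.
have cK : compact (closure A).
  by apply: bounded_closed_compact_pt; [exact: closed_closure|exact: closure_bounded].
have K0 : closure A !=set0 by case: A0 => a Aa; exists a; exact: subset_closure.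
have [a Ka h] := nearestP p cK K0; exists a; split => //.
have I0 : [set rho p x | x in A] !=set0 by case: A0 => b Ab; exists (rho p b), b.
apply/eqP; rewrite eq_le; apply/andP; split; last first.
  by apply: lb_le_inf => // _ [b Ab <-]; apply: h; exact: subset_closure.
apply/ler_addgt0Pr => r r0.
have /closureP_sqd /(_ (r ^+ 2))[|b Ab hb] := Ka; first by rewrite exprn_gt0.
have /(@inf_lbound R) : [set rho p x | x in A] (rho p b) by exists b.
move=> H; apply: le_trans (H _) _.
  by exists 0 => _ [c _ <-]; exact: rho_ge0.
apply: le_trans (rho_triangle p a b) _; rewrite lerD2l rhoC ltW// rho_lt//.
exact: ltW.
Qed.

Lemma Bnbhd_cnbhd A e : 0 < e -> A !=set0 -> bounded_pt A ->
  Bnbhd e A = cnbhd e (closure A).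
Proof.
move=> e0 A0 bA; apply/seteqP; split=> p.
  have [a [Ka + _]] := rho_set_attained p A0 bA; rewrite /Bnbhd /= => -> h.
  by exists a => //; rewrite -rho_le// ltW.
move=> [a Ka]; rewrite -rho_le ?(ltW e0)// => h.
have [b [Kb hb hm]] := rho_set_attained p A0 bA.
by rewrite /Bnbhd /= hb; apply: le_trans h; exact: hm.
Qed.

Lemma Sbdry_cnbhd A e : 0 < e -> A !=set0 -> bounded_pt A ->
  cnbhd e (closure A) `\` onbhd e (closure A) `<=` Sbdry e A.
Proof.
move=> e0 A0 bA p; have {1}<- := Bnbhd_cnbhd e0 A0 bA; rewrite /Bnbhd /Sbdry => -[/= h hn].
apply/eqP; rewrite eq_le h /= leNgt; apply/negP => hl; apply: hn.
have [b [Kb hb hm]] := rho_set_attained p A0 bA.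
by exists b => //; rewrite -rho_lt ?(ltW e0)// -hb.
Qed.

(** A point of the closure has points of [A] nearer than [2 * e], so a chain in [A] extends by one
    step at either end. *)
Lemma chained_closure_ind A e (T : pt -> pt -> Prop) : 0 < e -> chained (2 * e) A ->
  (forall x y z, T x y -> T y z -> T x z) ->
  (forall x y, closure A x -> closure A y -> rho x y < 2 * e -> T x y) ->
  forall x y, closure A x -> closure A y -> T x y.
Proof.
move=> e0 chA Ttr Tb x y Kx Ky.
have sA := @subset_closure _ A.
have near z : closure A z -> exists2 a, A a & rho z a < 2 * e.
  move=> /closureP_sqd /(_ ((2 * e) ^+ 2))[|a Aa ha].
    by rewrite exprn_gt0// mulr_gt0.
  by exists a => //; rewrite rhoC rho_lt// mulr_ge0// ltW.
have [a Aa xa] := near x Kx; have [b Ab yb] := near y Ky.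
have Txa : T x a by apply: Tb => //; exact: sA.
have Tby : T b y by apply: Tb => //; [exact: sA|rewrite rhoC].
suff Tab : T a b by exact: (Ttr _ _ _ (Ttr _ _ _ Txa Tab) Tby).
have [n [r [r0 [rn [rA rd]]]]] := chA a b Aa Ab.
have Taa : T a a by apply: Tb; [exact: sA|exact: sA|rewrite rhoE /sqd !subrr expr0n /= addr0 sqrtr0 mulr_gt0].
suff H i : (i <= n)%N -> T a (r i) by rewrite -rn; exact: H.
elim: i => [_|i IH ilt]; first by rewrite r0.
apply: (Ttr _ (r i)); first exact: IH (ltnW ilt).
by apply: Tb; [apply: sA; apply: rA; exact: ltnW|apply: sA; exact: rA|exact: rd].
Qed.

End Neighbourhoods.

(** * Connectedness of the open neighbourhood and of the complement of a component *)

Section ConnectedNeighbourhood.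
Variables (R : realType) (e : R) (K : set (R * R)).
Local Notation pt := (R * R)%type.
Implicit Types (p q x y z a b : pt) (X D : set pt).
Hypothesis e0 : 0 < e.

Lemma connected_of_component X : (forall x y, X x -> X y -> connected_component X x y) ->
  connected X.
Proof.
move=> h; have [X0|/set0P[x Xx]] := eqVneq X set0; first by rewrite X0; exact: connected0.
rewrite (_ : X = connected_component X x); first exact: component_connected.
apply/seteqP; split; first by move=> y Xy; exact: h.
exact: connected_component_sub.
Qed.

(** Every point of the segment is at distance less than [e] from the nearer end. *)
Lemma seg_close_onbhd x y (t : R) : K x -> K y -> rho x y < 2 * e -> 0 <= t <= 1 ->
  onbhd e K (seg x y t).
Proof.
move=> Kx Ky xy /andP[t0 t1]; have [th|th] := leP t 2^-1.
  exists x => //; rewrite -rho_lt ?(ltW e0)// rho_seg_l//.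
  have : t * rho x y <= 2^-1 * rho x y by rewrite ler_wpM2r ?rho_ge0.
  lra.
exists y => //; rewrite -rho_lt ?(ltW e0)// rho_seg_r//.
have : (1 - t) * rho x y <= 2^-1 * rho x y by rewrite ler_wpM2r ?rho_ge0//; lra.
lra.
Qed.

Lemma seg_onbhd x a (t : R) : K a -> sqd x a <= e ^+ 2 -> 0 < t <= 1 -> onbhd e K (seg x a t).
Proof.
move=> Ka xa /andP[t0 t1]; exists a => //; rewrite sqd_seg_r.
have e2 : 0 < e ^+ 2 by rewrite exprn_gt0.
have t2 : (1 - t) ^+ 2 < 1 by rewrite expr_lt1//; lra.
have [s0|s0] := eqVneq (sqd x a) 0; first by rewrite s0 mulr0.
by apply: lt_le_trans xa; rewrite gtr_pMl// lt_def s0 sqd_ge0.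
Qed.

Hypothesis Kchain : forall T : pt -> pt -> Prop,
  (forall x y z, T x y -> T y z -> T x z) ->
  (forall x y, K x -> K y -> rho x y < 2 * e -> T x y) ->
  forall x y, K x -> K y -> T x y.

Lemma onbhd_component x y : onbhd e K x -> onbhd e K y ->
  connected_component (onbhd e K) x y.
Proof.
have toK z : onbhd e K z -> exists2 a, K a & connected_component (onbhd e K) z a.
  move=> Uz; have [a Ka za] := Uz; exists a => //; apply: seg_component => t /andP[t0 t1].
  have [->|tn0] := eqVneq t 0; first by rewrite seg0.
  by apply: seg_onbhd => //; [exact: ltW|rewrite lt_def tn0 t0].
move=> /toK[a Ka xa] /toK[b Kb yb].
apply: connected_component_trans xa _; apply: (connected_component_trans (y := b)); last first.
  exact: connected_component_sym.
move: a b Ka Kb {yb}; apply: Kchain => [a b c|a b Ka Kb ab].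
  exact: connected_component_trans.
by apply: seg_component => t t01; exact: seg_close_onbhd.
Qed.

Hypothesis cK : compact K.
Hypothesis K0 : K !=set0.

(* Along a segment to a nearest point the nearest point does not change. *)
Lemma rho_seg_nearest p a b (t : R) : (forall c, K c -> rho p a <= rho p c) -> K b ->
  0 <= t <= 1 -> (1 - t) * rho p a <= rho (seg p a t) b.
Proof.
move=> h Kb /andP[t0 t1]; have := rho_triangle p (seg p a t) b.
rewrite (rhoC p (seg _ _ _)) rho_seg_l//; have := h b Kb; lra.
Qed.

Lemma open_compl_cnbhd : open (~` cnbhd e K).
Proof. by apply: closed_openC; apply: closed_cnbhd => //; exact: ltW. Qed.

Variable D : set pt.
Hypothesis cD : is_component (~` cnbhd e K) D.

Lemma cnbhd_notin x : cnbhd e K x -> ~ D x.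
Proof. by move=> Bx /(is_component_sub cD). Qed.

Lemma component_open : open D.
Proof. exact: open_is_component open_compl_cnbhd cD. Qed.

(** If the segment entered [D], the piece before that point would be even farther from [K], hence
    off the closed neighbourhood, and [p] itself would lie in [D]. *)
Lemma seg_nearest_notin p a (t : R) : ~ D p -> K a -> (forall c, K c -> rho p a <= rho p c) ->
  0 <= t <= 1 -> ~ D (seg p a t).
Proof.
move=> Dp Ka h /andP[t0 t1] Dt.
have Bt := is_component_sub cD Dt.
have Bs s : 0 <= s <= t -> (~` cnbhd e K) (seg p a s).
  move=> /andP[s0 st] [b Kb]; rewrite -rho_le ?(ltW e0)// => hb; apply: Bt; exists a => //.
  rewrite -rho_le ?(ltW e0)// rho_seg_r//; apply: le_trans hb.
  apply: le_trans (rho_seg_nearest (t := s) h Kb _).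
    by rewrite ler_wpM2r ?rho_ge0//; lra.
  by rewrite s0 (le_trans st).
apply: Dp; have := path_component (cont_seg (x := p) (y := a)) t0 Bs; rewrite seg0.
by move=> /connected_component_sym; exact: (component_in cD Dt).
Qed.

Lemma compl_component_connected : connected (~` D).
Proof.
have UD : onbhd e K `<=` ~` D by move=> x /onbhd_sub/cnbhd_notin.
have toK z : ~ D z -> exists2 a, K a & connected_component (~` D) z a.
  move=> Dz; have [a Ka h] := nearestP z cK K0; exists a => //.
  by apply: seg_component => t t01; exact: seg_nearest_notin.
have KU a : K a -> onbhd e K a.
  by move=> Ka; exists a => //; rewrite /sqd !subrr expr0n /= addr0 exprn_gt0.
apply: connected_of_component => x y /toK[a Ka xa] /toK[b Kb yb].
apply: connected_component_trans xa _; apply: (connected_component_trans (y := b)); last first.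
  exact: connected_component_sym.
by apply: (connected_component_mono UD); apply: onbhd_component; exact: KU.
Qed.

(** Off the closed neighbourhood [x] has an open component, which would meet [D] and so coincide
    with it; in the open neighbourhood [x] has a neighbourhood that misses [D]. *)
Lemma closure_component x : closure D x -> ~ D x -> cnbhd e K x /\ ~ onbhd e K x.
Proof.
move=> clx Dx; split; last first.
  move=> Ux; have [|y [Dy Uy]] := clx (onbhd e K).
    by apply: open_nbhs_nbhs; split => //; exact: open_onbhd.
  exact: cnbhd_notin (onbhd_sub Uy) Dy.
apply: contrapT => Bx.
pose E := connected_component (~` cnbhd e K) x.
have cE : is_component (~` cnbhd e K) E by exists x.
have [|y [Dy Ey]] := clx E.
  apply: open_nbhs_nbhs; split; first exact: open_is_component open_compl_cnbhd cE.
  exact: connected_component_refl.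
by apply: Dx; apply: (component_in cD Dy); exact: connected_component_sym.
Qed.

Lemma boundary_component : boundary D = closure D `\` D.
Proof. exact: boundary_open component_open. Qed.

Lemma compact_boundary : compact (boundary D).
Proof.
apply: (subclosed_compact _ (compact_cnbhd (ltW e0) cK)).
  by rewrite boundary_component; apply: closedI; [exact: closed_closure|exact: open_closedC component_open].
by rewrite boundary_component => x [clx Dx]; case: (closure_component clx Dx).
Qed.

End ConnectedNeighbourhood.


(** * The frontier of a domain with connected complement is connected *)

Section BoundaryConnected.
Variable R : realType.
Local Notation pt := (R * R)%type.
Implicit Types (p q x y z : pt) (P Q X D : set pt).

Lemma normr_le_rho1 x y : `|x.1 - y.1| <= rho x y.
Proof. by rewrite -sqrtr_sqr rhoE ler_wsqrtr// lerDl sqr_ge0. Qed.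

Lemma normr_le_rho2 x y : `|x.2 - y.2| <= rho x y.
Proof. by rewrite -sqrtr_sqr rhoE ler_wsqrtr// lerDr sqr_ge0. Qed.

Definition scale (t : R) x : pt := (t * x.1, t * x.2).

Lemma rho_scale (t : R) x y : rho (scale t x) (scale t y) = `|t| * rho x y.
Proof.
rewrite !rhoE (_ : sqd _ _ = t ^+ 2 * sqd x y); last by rewrite /sqd /=; ring.
by rewrite sqrtrM ?sqr_ge0// sqrtr_sqr.
Qed.

Lemma rho_scale2 (s t : R) x : rho (scale s x) (scale t x) = `|s - t| * rho x (0, 0).
Proof.
rewrite !rhoE (_ : sqd _ _ = (s - t) ^+ 2 * sqd x (0, 0)); last by rewrite /sqd /=; ring.
by rewrite sqrtrM ?sqr_ge0// sqrtr_sqr.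
Qed.

Definition clamp (a b r : R) : R := Num.max a (Num.min b r).

Lemma cont_clamp (a b : R) : continuous (clamp a b).
Proof. by apply: cont_max; [exact: contC|apply: cont_min; [exact: contC|exact: cont_id]]. Qed.

Lemma clamp_id (a b r : R) : a <= r <= b -> clamp a b r = r.
Proof. by move=> /andP[ar rb]; rewrite /clamp min_r// max_r. Qed.

Lemma clamp_itv (a b r : R) : a <= b -> a <= clamp a b r <= b.
Proof. by move=> ab; rewrite /clamp le_max lexx ge_max ab ge_min lexx. Qed.

Lemma clamp_lipschitz (a b r s : R) : a <= b -> `|clamp a b r - clamp a b s| <= `|r - s|.
Proof.
rewrite /clamp !maxEle !minEle => ab; rewrite ler_norml.
by case: (leP b r) => ?; case: (leP b s) => ?;
  repeat match goal with |- context [if ?x <= ?y then _ else _] => case: (leP x y) => ? end;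
  apply/andP; split; case: (ger0P (r - s)) => ?; lra.
Qed.

Lemma sqr_le_norm (a b : R) : `|a| <= `|b| -> a ^+ 2 <= b ^+ 2.
Proof.
by move=> ab; rewrite -(real_normK (num_real a)) -(real_normK (num_real b)) lerXn2r ?nnegrE.
Qed.

(* The plane has no discrete first cohomology: the primitive sums the cocycle along the ray
   from the origin cut into short steps. *)
Lemma discrete_primitive (c : pt -> pt -> R) (h M : R) : 0 < h -> 0 < M ->
  (forall x y z, rho x y < h -> rho y z < h -> rho x z < h -> c x y + c y z = c x z) ->
  (forall x y, M <= `|x.1| \/ M <= `|x.2| -> rho x y < h -> c x y = 0) ->
  exists th : pt -> R, forall x y, rho x y < h / 2 -> th y - th x = c x y.
Proof.
move=> h0 M0 cc cv.
have rho0 x : rho x x = 0 by rewrite rhoE /sqd !subrr expr0n /= addr0 sqrtr0.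
have c0 x : c x x = 0.
  by have := cc x x x; rewrite rho0 => /(_ h0 h0 h0) H; lra.
have cN x y : rho x y < h -> c y x = - c x y.
  move=> xy; have yx : rho y x < h by rewrite rhoC.
  have := cc x y x xy yx; rewrite rho0 c0 => /(_ h0); lra.
(* Clamping to the square of half side [M] does not increase distances and bounds the length of all
   rays, so that one number of steps suffices. *)
pose k x : pt := (clamp (- M) M x.1, clamp (- M) M x.2).
have MM : - M <= M by lra.
have kl x y : rho (k x) (k y) <= rho x y.
  by rewrite !rhoE ler_wsqrtr// /sqd lerD// /=; apply: sqr_le_norm; exact: clamp_lipschitz.
have k0 x : rho (k x) (0, 0) <= 2 * M.
  rewrite rho_le; last by lra.
  rewrite /sqd /= !subr0.
  have /andP[a1 a2] := clamp_itv x.1 MM; have /andP[b1 b2] := clamp_itv x.2 MM.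
  nra.
(* Rays have length at most [2 * M], so each of the [n] steps is shorter than [h / 2]; together with
   [rho x y < h / 2] all diagonals stay below [h]. *)
have [n hn] : exists n : nat, 4 * M / h < n%:R.
  exists (Num.bound (4 * M / h)); apply: archi_boundP.
  by rewrite divr_ge0 ?ltW// mulr_gt0.
have n0 : 0 < n%:R :> R by apply: le_lt_trans hn; rewrite divr_ge0 ?ltW// mulr_gt0.
pose s (i : nat) x := scale (i%:R / n%:R) (k x).
have step i x : rho (s i x) (s i.+1 x) < h / 2.
  rewrite rho_scale2 -mulrBl -[i.+1]addn1 natrD opprD addrA subrr add0r.
  rewrite mulN1r normrN ger0_norm ?invr_ge0 ?(ltW n0)//.
  rewrite mulrC ltr_pdivrMr//; apply: le_lt_trans (k0 x) _.
  by move: hn; rewrite ltr_pdivrMr//; lra.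
have side i x y : (i <= n)%N -> rho (s i x) (s i y) <= rho x y.
  move=> il; rewrite rho_scale ger0_norm; last by rewrite divr_ge0// ltW.
  apply: le_trans (kl x y); rewrite ler_piMl ?rho_ge0// ler_pdivrMr// mul1r ler_nat//.
exists (fun x => \sum_(0 <= i < n) c (s i x) (s i.+1 x)) => x y xy.
rewrite -sumrB.
(* Cutting the quadrilateral between two rays along a diagonal makes the difference telescope. *)
have E i : (i < n)%N -> c (s i y) (s i.+1 y) - c (s i x) (s i.+1 x) =
   c (s i.+1 x) (s i.+1 y) - c (s i x) (s i y).
  move=> il; have h1 := step i x; have h2 := step i y.
  have h3 := le_lt_trans (side i.+1 x y il) xy; have h4 := le_lt_trans (side i x y (ltnW il)) xy.
  have h5 := rho_triangle (s i x) (s i.+1 x) (s i.+1 y).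
  have e1 : c (s i x) (s i.+1 x) + c (s i.+1 x) (s i.+1 y) = c (s i x) (s i.+1 y).
    by apply: cc; lra.
  have e2 : c (s i x) (s i y) + c (s i y) (s i.+1 y) = c (s i x) (s i.+1 y).
    by apply: cc; lra.
  lra.
rewrite (eq_big_nat _ _ (F2 := fun i => c (s i.+1 x) (s i.+1 y) - c (s i x) (s i y))); last first.
  by move=> i /andP[_ il]; exact: E.
rewrite telescope_sumr//.
have s0 z : s 0%N z = (0, 0) by rewrite /s /scale !mul0r.
have sn z : s n z = k z.
  by rewrite /s /scale divff ?gt_eqF// !mul1r; case: (k z).
rewrite !s0 !sn c0 subr0.
have xyh : rho x y < h by lra.
(* Far points are clamped to the border of the square, where [c] still vanishes. *)
have far z : M <= `|z.1| \/ M <= `|z.2| -> M <= `|(k z).1| \/ M <= `|(k z).2|.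
  by rewrite /k /clamp /=; case => H; [left|right]; move: H;
    rewrite maxEle minEle; repeat case: ifPn => ?; rewrite ?normrN ?(gtr0_norm M0)//.
have [fx|nx] := pselect (M <= `|x.1| \/ M <= `|x.2|).
  rewrite (cv _ _ fx)// (cv _ _ (far _ fx))//; exact: le_lt_trans (kl x y) xyh.
have [fy|ny] := pselect (M <= `|y.1| \/ M <= `|y.2|).
  rewrite cN; last by rewrite rhoC; exact: le_lt_trans (kl x y) xyh.
  rewrite [RHS]cN; last by rewrite rhoC.
  rewrite (cv _ _ fy) 1?rhoC// (cv _ _ (far _ fy))// rhoC; exact: le_lt_trans (kl x y) xyh.
have kid z : ~ (M <= `|z.1| \/ M <= `|z.2|) -> k z = z.
  move=> /not_orP[/negP + /negP]; rewrite -!ltNge !ltr_norml => /andP[a1 a2] /andP[b1 b2].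
  by rewrite /k !clamp_id ?(ltW a1) ?(ltW b1) ?ltW//; case: (z).
by rewrite !kid.
Qed.

Lemma locally_constant_connected X (th : pt -> R) (r : R) : 0 < r -> connected X ->
  (forall x y, X x -> X y -> rho x y < r -> th x = th y) ->
  forall x y, X x -> X y -> th x = th y.
Proof.
move=> r0 cX h x y Xx Xy.
pose B := [set z | X z /\ th z = th x].
have toB z w : B z -> X w -> rho z w < r -> B w.
  by move=> [Xz zx] Xw zw; split => //; rewrite -zx; apply/esym; exact: h.
suff E : B = X by have [_ ->] : B y by rewrite E.
apply: cX; first by exists x.
  exists (\bigcup_(z in B) [set w | rho z w < r]).
    apply: bigcup_open => z _; apply: open_ltf; last exact: contC.
    by apply: cont_rho; [exact: contC|exact: cont_id].
  apply/seteqP; split => [z Bz|w [Xw [z Bz zw]]]; last exact: toB zw.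
  split; first by case: Bz.
  by exists z => //=; rewrite rhoE /sqd !subrr expr0n /= addr0 sqrtr0.
exists (closure B); first exact: closed_closure.
apply/seteqP; split => [z Bz|w [Xw /closureP_sqd/(_ (r ^+ 2))[]]].
- by split; [case: Bz|exact: subset_closure].
- by rewrite exprn_gt0.
- by move=> z Bz zw; apply: (toB z w) => //; rewrite rho_lt// ltW.
Qed.

Lemma compact_separation P Q : compact P -> compact Q -> P !=set0 -> Q !=set0 ->
  P `&` Q = set0 -> exists2 h : R, 0 < h & forall p q, P p -> Q q -> h <= rho p q.
Proof.
move=> cP cQ [p0 Pp0] [q0 Qq0] PQ.
have [||[p q]] := @compact_EVT_min _ R (fun u : pt * pt => rho u.1 u.2) _ _ (compact_setX cP cQ).
- by exists (p0, q0).
- by apply: continuous_subspaceT; apply: cont_rho; [exact: cont_fst (@cont_id _)|exact: cont_snd (@cont_id _)].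
rewrite inE /= => -[Pp Qq] h; exists (rho p q).
  rewrite lt_def rho_ge0 andbT; apply/eqP => E.
  suff pq : p = q by have : (P `&` Q) p by [split => //; rewrite pq]; rewrite PQ.
  have e1 := normr_le_rho1 p q; have e2 := normr_le_rho2 p q.
  rewrite E normr_le0 subr_eq0 in e1; rewrite E normr_le0 subr_eq0 in e2.
  by rewrite [p]surjective_pairing [q]surjective_pairing (eqP e1) (eqP e2).
by move=> p' q' Pp' Qq'; apply: (h (p', q')); rewrite inE.
Qed.

Lemma segment_meets_frontier D x y : open D -> D x -> ~ D y ->
  exists2 t : R, 0 <= t <= 1 & (closure D `\` D) (seg x y t).
Proof.
move=> oD Dx Dy; apply: contrapT => H; apply: Dy.
rewrite -(seg1 x y); apply: (@connected_trap R (seg x y @` `[0, 1]) D (closure D)) => //.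
- apply: connected_continuous_connected; first exact: segment_connected.
  by apply: continuous_subspaceT; exact: cont_seg.
- exact: closed_closure.
- exact: subset_closure.
- move=> _ [[t /= t01 <-] clt]; apply: contrapT => nD; apply: H; exists t.
    by rewrite in_itv/= in t01.
  by split.
- by exists x; split => //; exists 0 => /=; rewrite ?seg0// in_itv/= lexx ler01.
- by exists 1 => //=; rewrite in_itv/= lexx ler01.
Qed.

Lemma compact_bounded_pt X : compact X -> bounded_pt X.
Proof.
move=> cX; have [->|/set0P X0] := eqVneq X set0; first by exists 0.
have [|a _ h] := @compact_EVT_max _ R (fun x => rho x (0, 0)) _ X0 cX.
  by apply: continuous_subspaceT; apply: cont_rho; [exact: cont_id|exact: contC].
by exists (rho a (0, 0)) => x Xx; apply: h; rewrite inE.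
Qed.

(* If the frontier split as [P] and [Q], counting signed crossings near [Q] only would give
   a cocycle; its primitive is constant on [D] and on the complement, yet jumps across [Q]
   and not across [P]. *)
Lemma frontier_connected D : open D -> connected D -> connected (~` D) ->
  compact (closure D `\` D) -> connected (closure D `\` D).
Proof.
move=> oD cD cDc; set C := (closure D `\` D); move=> cC Q Q0 [G oG QG] [F cF QF].
apply: contrapT => QC; pose P := C `\` Q.
have sQC : Q `<=` C by rewrite QG; exact: subIsetl.
have cQ : compact Q by rewrite QF; apply: compact_closedI.
have cP : compact P.
  rewrite (_ : P = C `&` ~` G); first by apply: compact_closedI => //; exact: open_closedC.
  by rewrite /P QG setDE setCI setIUr setICr set0U.
have P0 : P !=set0.
  apply/set0P/negP => /eqP P0; apply: QC; apply/seteqP; split => // x Cx.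
  by apply: contrapT => Qx; have : P x by []; rewrite P0.
have PQ : P `&` Q = set0 by rewrite /P setDKI.
have [h4 h40 sep] := compact_separation cP cQ P0 Q0 PQ.
(* With a quarter of the gap, a step shorter than [h] that crosses the frontier in [Q] has both ends
   within [2 * h] of [Q], and one that crosses in [P] has neither. *)
pose h := h4 / 4; have h0 : 0 < h by rewrite divr_gt0.
have hh4 : h4 = 4 * h by rewrite /h; lra.
pose chi x : R := (x \in D)%:R.
pose n x : R := (x \in [set x | exists2 q, Q q & rho x q < 2 * h])%:R.
have n1 x : (exists2 q, Q q & rho x q < 2 * h) -> n x = 1 by move=> H; rewrite /n mem_set.
have n0 x : ~ (exists2 q, Q q & rho x q < 2 * h) -> n x = 0 by move=> H; rewrite /n memNset.
have cross x y : rho x y < h -> D x -> ~ D y -> n x = n y.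
  move=> xy Dx Dy; have [t /andP[t0 t1] Cz] := segment_meets_frontier oD Dx Dy.
  set z := seg x y t in Cz.
  have xz : rho x z < h.
    by rewrite rhoC rho_seg_l//; apply: le_lt_trans xy; rewrite ler_piMl ?rho_ge0.
  have yz : rho y z < h.
    rewrite rhoC rho_seg_r//; apply: le_lt_trans xy; rewrite ler_piMl ?rho_ge0//; lra.
  have [Qz|nQz] := pselect (Q z).
    by rewrite !n1//; exists z => //; lra.
  have Pz : P z by [].
  have far w : rho w z < h -> n w = 0.
    move=> wz; apply: n0 => -[q Qq wq]; have := sep z q Pz Qq.
    have := rho_triangle z w q; rewrite (rhoC z w); lra.
  by rewrite !far.
have chi1 x : D x -> chi x = 1 by move=> H; rewrite /chi mem_set.
have chi0 x : ~ D x -> chi x = 0 by move=> H; rewrite /chi memNset.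
have dich x y : rho x y < h -> chi x = chi y \/ n x = n y.
  move=> xy; have [Dx|Dx] := pselect (D x); have [Dy|Dy] := pselect (D y).
  - by left; rewrite !chi1.
  - by right; exact: cross.
  - by right; apply/esym; apply: cross => //; rewrite rhoC.
  - by left; rewrite !chi0.
pose c x y := (chi y - chi x) * n x.
have [M0 hM0] := compact_bounded_pt cQ.
have [|||th hth] := @discrete_primitive c h (`|M0| + 2 * h) h0.
- by have := normr_ge0 M0; lra.
- move=> x y z xy yz xz; rewrite /c.
  (* This product is the defect of the cocycle identity; [dich] on the three sides of the triangle
     kills it. *)
  suff E : (chi z - chi y) * (n y - n x) = 0 by apply/eqP; rewrite -subr_eq0 -E; apply/eqP; ring.
  case: (dich x y xy) => e1; last by rewrite e1 subrr mulr0.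
  case: (dich y z yz) => e2; first by rewrite e2 subrr mul0r.
  case: (dich x z xz) => e3; first by rewrite -e3 e1 subrr mul0r.
  by rewrite e3 e2 subrr mulr0.
- move=> x y H xy; rewrite /c (n0 x) ?mulr0// => -[q /hM0 Mq xq].
  have := rho_triangle x q (0, 0).
  have := normr_le_rho1 x (0, 0); have := normr_le_rho2 x (0, 0); rewrite /= !subr0.
  have := ler_norm M0; case: H; lra.
have h20 : 0 < h / 2 by rewrite divr_gt0.
have thD : forall x y, D x -> D y -> th x = th y.
  apply: (locally_constant_connected h20 cD) => x y Dx Dy xy.
  have := hth x y xy; rewrite /c !chi1// subrr mul0r; lra.
have thDc : forall x y, ~ D x -> ~ D y -> th x = th y.
  apply: (locally_constant_connected h20 cDc) => x y Dx Dy xy.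
  have := hth x y xy; rewrite /c !chi0// subrr mul0r; lra.
have jump q : C q -> exists x, [/\ D x, rho x q < h / 2 & th q - th x = - n x].
  move=> [clq Dq]; have /closureP_sqd/(_ ((h / 2) ^+ 2))[|x Dx xq] := clq.
    by rewrite exprn_gt0.
  exists x; split => //; first by rewrite rho_lt// ltW.
  by rewrite hth ?rho_lt ?(ltW h20)// /c chi0// chi1// sub0r mulN1r.
have [q Qq] := Q0; have [p Pp] := P0.
have [x [Dx xq tq]] := jump q (sQC q Qq).
have [y [Dy yp tp]] := jump p Pp.1.
have nx : n x = 1 by apply: n1; exists q => //; lra.
have ny : n y = 0.
  apply: n0 => -[q' Qq' yq']; have := sep p q' Pp Qq'.
  have := rho_triangle p y q'; rewrite (rhoC p y); lra.
have := thD x y Dx Dy; have := thDc p q Pp.1.2 (sQC q Qq).2; lra.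
Qed.

End BoundaryConnected.


(** * Arcs and simple closed curves *)

Section Arcs.
Variable R : realType.
Local Notation pt := (R * R)%type.
Implicit Types (p q x y z : pt) (X Y J : set pt) (s t : R) (f g : R -> pt).

(** Relative openness of [J] has to be checked only at points of [X] already in [J]; most arguments
    about arcs below have this form. *)
Lemma connected_absorb X J : connected X -> closed J -> X `&` J !=set0 ->
  (forall y, X y -> J y -> \forall z \near y, X z -> J z) -> X `<=` J.
Proof.
move=> cX cJ XJ h.
have -> : X `<=` J = (X `&` J = X) by rewrite propeqE; split => /setIidPl.
apply: cX => //; last by exists J.
exists (interior [set z | X z -> J z]); first exact: open_interior.
apply/seteqP; split => z [Xz Jz]; split => //; first exact: h.
exact: interior_subset Jz Xz.
Qed.

Definition inj01 g := forall s t, 0 <= s <= 1 -> 0 <= t <= 1 -> g s = g t -> s = t.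

Definition simple_arc g := continuous g /\ inj01 g.

Definition revp g t : pt := g (1 - t).

Definition subp g (a b : R) t : pt := g (a + t * (b - a)).

(** The sum is continuous on the whole line without gluing. If [f 1 = g 0], one of the first two
    terms equals [f 1] and cancels the last, which leaves the usual concatenation. *)
Definition joinp f g t : pt :=
  ((f (Num.min (2 * t) 1)).1 + (g (Num.max (2 * t - 1) 0)).1 - (f 1).1,
   (f (Num.min (2 * t) 1)).2 + (g (Num.max (2 * t - 1) 0)).2 - (f 1).2).

Lemma revpK g : revp (revp g) = g.
Proof. by apply/funext => t; rewrite /revp; congr g; lra. Qed.

Lemma cont_rev g : continuous g -> continuous (revp g).
Proof. by move=> cg; apply: (cont_comp (f := fun t => _) cg); cont. Qed.

Lemma cont_sub g a b : continuous g -> continuous (subp g a b).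
Proof. by move=> cg; apply: (cont_comp (f := fun t => _) cg); cont. Qed.

Lemma cont_join f g : continuous f -> continuous g -> continuous (joinp f g).
Proof.
move=> cf cg.
have c1 : continuous (fun t => f (Num.min (2 * t) 1)) by apply: (cont_comp cf); cont.
have c2 : continuous (fun t => g (Num.max (2 * t - 1) 0)) by apply: (cont_comp cg); cont.
by rewrite /joinp; cont.
Qed.

Lemma joinpl f g t : f 1 = g 0 -> t <= 2^-1 -> joinp f g t = f (2 * t).
Proof.
move=> fg th; rewrite /joinp min_l; last by lra.
rewrite max_r; last by lra.
by rewrite -fg !addrK -surjective_pairing.
Qed.

Lemma joinpr f g t : 2^-1 <= t -> joinp f g t = g (2 * t - 1).
Proof.
move=> th; rewrite /joinp min_r; last by lra.
rewrite max_l; last by lra.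
by rewrite ![_ + _ - _]addrAC !subrr !add0r -surjective_pairing.
Qed.

Lemma arc_rev g : simple_arc g -> simple_arc (revp g).
Proof.
move=> [cg ig]; split; first exact: cont_rev.
move=> s t s01 t01 /ig H; have := H _ _; lra.
Qed.

Lemma arc_sub g a b : simple_arc g -> 0 <= a <= 1 -> 0 <= b <= 1 -> a != b -> simple_arc (subp g a b).
Proof.
move=> [cg ig] a01 b01 ab; split; first exact: cont_sub.
move=> s t s01 t01 /ig H.
have ba : b - a != 0 by rewrite subr_eq0 eq_sym.
suff : s * (b - a) = t * (b - a) by move/(mulIf ba).
have : a + s * (b - a) = a + t * (b - a) by apply: H; nra.
lra.
Qed.

Lemma arc_join f g : simple_arc f -> simple_arc g -> f 1 = g 0 ->
  (forall s t, 0 <= s <= 1 -> 0 < t <= 1 -> f s <> g t) -> simple_arc (joinp f g).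
Proof.
move=> [cf jf] [cg jg] fg dis; split; first exact: cont_join.
move=> s t s01 t01.
have [sh|sh] := leP s 2^-1; have [th|th] := leP t 2^-1.
- rewrite !joinpl// => /jf H; have := H _ _; lra.
- rewrite joinpl// joinpr ?(ltW th)// => /dis H; exfalso; apply: H; lra.
- rewrite joinpr ?(ltW sh)// joinpl// => /esym/dis H; exfalso; apply: H; lra.
- rewrite !joinpr ?ltW// => /jg H; have := H _ _; lra.
Qed.

Definition im g (a b : R) : set pt := [set y | exists2 t, a <= t <= b & g t = y].

Lemma imE g a b : im g a b = g @` `[a, b].
Proof. by apply/seteqP; split => y [t /= h <-]; exists t => //=; move: h; rewrite in_itv. Qed.

Lemma compact_im g a b : continuous g -> compact (im g a b).
Proof.
move=> cg; rewrite imE; apply: continuous_compact; last exact: segment_compact.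
exact: continuous_subspaceT.
Qed.

Lemma closed_im g a b : continuous g -> closed (im g a b).
Proof. by move=> cg; apply: compact_closed; [exact: pt_hausdorff|exact: compact_im]. Qed.

Lemma connected_im g a b : continuous g -> connected (im g a b).
Proof.
move=> cg; rewrite imE; apply: connected_continuous_connected; first exact: segment_connected.
exact: continuous_subspaceT.
Qed.

Lemma connected_im_oc g a b : continuous g ->
  connected [set y | exists2 t, a < t <= b & g t = y].
Proof.
move=> cg; rewrite (_ : mkset _ = g @` `]a, b]).
  apply: connected_continuous_connected; last exact: continuous_subspaceT.
  by apply/connected_intervalP; exact: interval_is_interval.
by apply/seteqP; split => y [t /= h <-]; exists t => //=; move: h; rewrite in_itv.
Qed.

Lemma notin_nbhs X y : closed X -> ~ X y -> \forall z \near y, ~ X z.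
Proof. by move=> cX nX; apply: open_nbhs_nbhs; split => //; exact: closed_openC. Qed.

(** A connected part of the arc that misses [g r] cannot pass from [im g 0 r] to [im g r 1]. *)
Lemma arc_connected_full g X : simple_arc g -> connected X -> X `<=` im g 0 1 ->
  X (g 0) -> X (g 1) -> im g 0 1 `<=` X.
Proof.
move=> [cg ig] cX Xg X0 X1 _ [r r01 <-]; apply: contrapT => nX.
have r0 : 0 < r.
  rewrite lt_neqAle; have /andP[-> _] := r01; rewrite andbT.
  by apply/eqP => E; apply: nX; rewrite -E.
have r1 : r < 1.
  rewrite lt_neqAle; have /andP[_ ->] := r01; rewrite andbT.
  by apply/eqP => E; apply: nX; rewrite E.
have H : X `<=` im g 0 r.
  apply: connected_absorb => //; first exact: closed_im.
    by exists (g 0); split => //; exists 0 => //; lra.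
  move=> y Xy [t t01 ty].
  have tr : t < r.
    rewrite lt_neqAle; have /andP[_ ->] := t01; rewrite andbT.
    by apply/eqP => E; apply: nX; rewrite -E ty.
  have : \forall z \near y, ~ im g r 1 z.
    apply: notin_nbhs; first exact: closed_im.
    move=> [t' t'01]; rewrite -ty => /ig E; have : t' = t by apply: E; lra.
    by lra.
  apply: filterS => z nz Xz; have [w w01 wz] := Xg z Xz; exists w => //.
  have [wr|wr] := leP w r; first lra.
  by exfalso; apply: nz; exists w => //; lra.
have [t t01 /ig E] := H _ X1; have : t = 1 by apply: E; lra.
lra.
Qed.

End Arcs.

(** * Gluing two arcs into a simple closed curve *)

Section Curve.
Variable R : realType.
Local Notation pt := (R * R)%type.
Implicit Types (p q x y z : pt) (X Y J : set pt) (s t : R) (f g : R -> pt).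

Lemma homeo_of_compact X (f : pt -> pt) : compact X -> {within X, continuous f} ->
  (forall x y, X x -> X y -> f x = f y -> x = y) ->
  exists g : pt -> pt, {within f @` X, continuous g} /\ (forall x, X x -> g (f x) = x).
Proof.
move=> cX cf fi; pose g y := xget (0, 0) [set x | X x /\ f x = y].
have gf x : X x -> g (f x) = x.
  by move=> Xx; rewrite /g; case: xgetP => [z _ [Xz zx]|/(_ x)]; [exact: fi|case].
exists g; split => //; apply/subspace_continuousP => _ [x Xx <-] W Wgx.
have Wx : nbhs x W by rewrite -(gf _ Xx).
have cY : compact (f @` (X `&` ~` interior W)).
  apply: continuous_compact; first exact: continuous_subspaceW cf.
  by apply: compact_closedI => //; apply: open_closedC; exact: open_interior.
have := @notin_nbhs R _ (f x) (compact_closed (@pt_hausdorff R) cY).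
have h : ~ (f @` (X `&` ~` interior W)) (f x).
  by move=> [z [Xz nz] /fi zx]; apply: nz; rewrite zx.
move=> /(_ h); rewrite /within /= ; apply: filterS => y nz [z Xz zy].
rewrite /= /from_subspace -zy gf//.
by apply: contrapT => nW; apply: nz; exists z => //; split => // /interior_subset.
Qed.

Lemma compact_circle : compact (@circle R).
Proof.
apply: bounded_closed_compact_pt.
  rewrite (_ : @circle R = [set p | p.1 ^+ 2 + p.2 ^+ 2 <= 1] `&` [set p | 1 <= p.1 ^+ 2 + p.2 ^+ 2]).
    by apply: closedI; apply: closed_lef; cont.
  apply/seteqP; split => p; rewrite /circle /= => H; first by rewrite H lexx.
  by apply/eqP; rewrite eq_le; case: H => -> ->.
by exists 1 => p; rewrite /circle /= => H; rewrite rho_le// /sqd !subr0 H expr1n.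
Qed.

(** Both half circles are parametrised by the abscissa through [h], which sends [(1, 0)] to [0] and
    [(-1, 0)] to [1]; [f] serves the upper half and [g] the lower one. *)
Lemma closed_curve_of_arcs f g : simple_arc f -> simple_arc g -> f 0 = g 0 -> f 1 = g 1 ->
  (forall s t, 0 < s < 1 -> 0 < t < 1 -> f s <> g t) ->
  simple_closed_curve (im f 0 1 `|` im g 0 1).
Proof.
move=> [cf jf] [cg jg] fg0 fg1 dis.
pose h (p : pt) := (1 - p.1) / 2.
have ch : continuous h by rewrite /h; cont.
pose F (p : pt) := if 0 <= p.2 then f (h p) else g (h p).
have h01 p : circle p -> 0 <= h p <= 1.
  by rewrite /circle /h /= => H; have := sqr_ge0 p.2; nra.
have hinj p q : circle p -> circle q -> h p = h q -> 0 <= p.2 * q.2 -> p = q.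
  rewrite /circle /h /= => Hp Hq E pq.
  have e1 : p.1 = q.1 by lra.
  have e2 : (p.2 - q.2) * (p.2 + q.2) = 0.
    by have : p.1 ^+ 2 = q.1 ^+ 2 by [rewrite e1]; lra.
  rewrite [p]surjective_pairing [q]surjective_pairing e1; congr (_, _).
  by move/eqP: e2; rewrite mulf_eq0 => /orP[|] /eqP e2; nra.
have hend p : circle p -> p.2 = 0 -> h p = 0 \/ h p = 1.
  rewrite /circle /h /= => Hp E; rewrite E expr0n /= addr0 in Hp.
  have : (p.1 - 1) * (p.1 + 1) = 0 by lra.
  by move/eqP; rewrite mulf_eq0 => /orP[|] /eqP e2; [left|right]; lra.
have Fg p : circle p -> p.2 <= 0 -> F p = g (h p).
  move=> Cp p2; rewrite /F; case: ifP => // p2'.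
  have p0 : p.2 = 0 by lra.
  by have [->|->] := hend p Cp p0.
have cF : {within @circle R, continuous F}.
  have -> : @circle R = (@circle R `&` [set p | 0 <= p.2]) `|` (@circle R `&` [set p | p.2 <= 0]).
    apply/seteqP; split => p; last by case=> -[].
    by move=> Cp; have [|/ltW] := leP 0 p.2; [left|right].
  have ccl : closed (@circle R) by apply: compact_closed; [exact: pt_hausdorff|exact: compact_circle].
  apply: withinU_continuous.
  - by apply: closedI => //; apply: closed_lef; cont.
  - by apply: closedI => //; apply: closed_lef; cont.
  - apply: (@subspace_eq_continuous _ _ _ (fun p => f (h p))).
      by move=> p; rewrite inE => -[_ /= p2]; rewrite /from_subspace /F p2.
    by apply: continuous_subspaceT; apply: (cont_comp cf).
  - apply: (@subspace_eq_continuous _ _ _ (fun p => g (h p))).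
      by move=> p; rewrite inE => -[Cp /= p2]; rewrite /from_subspace Fg.
    by apply: continuous_subspaceT; apply: (cont_comp cg).
have Finj p q : circle p -> circle q -> F p = F q -> p = q.
  move=> Cp Cq.
  have hp := h01 p Cp; have hq := h01 q Cq.
  have mix u v : circle u -> circle v -> 0 <= u.2 -> v.2 < 0 -> f (h u) = g (h v) -> u = v.
    move=> Cu Cv u2 v2 E.
    have hv : 0 < h v < 1 by move: Cv; rewrite /circle /h /=; nra.
    have hu := h01 u Cu.
    have [u0|u0] := eqVneq (h u) 0.
      have : h v = 0 by apply: jg; [lra|lra|rewrite -E u0 fg0].
      by move=> hv0; move: hv; rewrite hv0 ltxx.
    have [u1|u1] := eqVneq (h u) 1.
      have : h v = 1 by apply: jg; [lra|lra|rewrite -E u1 fg1].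
      by move=> hv1; move: hv; rewrite hv1 ltxx andbF.
    exfalso; apply: (dis (h u) (h v)) => //.
    by rewrite !lt_neqAle u1 [0 == _]eq_sym u0.
  rewrite /F; case: ifP => p2; case: ifP => q2.
  - by move=> E; apply: hinj => //; [exact: jf|exact: mulr_ge0].
  - by apply: mix => //; rewrite ltNge q2.
  - by move=> /esym E; apply/esym; move: E; apply: mix => //; rewrite ltNge p2.
  - move=> E; apply: hinj => //; first exact: jg.
    by move/negbT: p2; move/negbT: q2; rewrite -!ltNge; nra.
have imF : F @` @circle R = im f 0 1 `|` im g 0 1.
  have sq t : 0 <= t <= 1 -> 0 <= 1 - (1 - 2 * t) ^+ 2 by nra.
  apply/seteqP; split => [_ [p Cp <-]|y].
    rewrite /F; case: ifP => p2; [left|right]; exists (h p) => //; exact: h01.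
  have hx t (v : R) : h (1 - 2 * t, v) = t by rewrite /h /=; lra.
  case=> -[t t01 <-].
    exists (1 - 2 * t, Num.sqrt (1 - (1 - 2 * t) ^+ 2)).
      by rewrite /circle /= sqr_sqrtr ?sq//; ring.
    by rewrite /F /= sqrtr_ge0 hx.
  have C : @circle R (1 - 2 * t, - Num.sqrt (1 - (1 - 2 * t) ^+ 2)).
    by rewrite /circle /= sqrrN sqr_sqrtr ?sq//; ring.
  exists (1 - 2 * t, - Num.sqrt (1 - (1 - 2 * t) ^+ 2)) => //.
  by rewrite Fg// ?hx//= oppr_le0 sqrtr_ge0.
have [G [cG GF]] := homeo_of_compact compact_circle cF Finj.
exists F, G; rewrite -imF; split => //; split => //; split => //; split.
  by move=> _ [_ [p Cp <-] <-]; rewrite GF.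
by split => // _ [p Cp <-]; rewrite GF.
Qed.

End Curve.


(** * Compact connected 1-manifolds in the plane are simple closed curves *)

Section Charts.
Variables (R : realType) (C : set (R * R)).
Local Notation pt := (R * R)%type.
Implicit Types (p q x y z : pt) (X Y J : set pt) (s t r : R) (f g h : R -> pt).

(** Only the open part of the arc has to be open in [C]. Nothing is asked of [C] around the two
    ends, which is what allows a chart to be prolonged there. *)
Definition chart g := [/\ simple_arc g, im g 0 1 `<=` C &
  forall t, 0 < t < 1 -> \forall y \near g t, C y -> exists2 s, 0 < s < 1 & g s = y].

Lemma chart_rev g : chart g -> chart (revp g).
Proof.
move=> [ag gC go]; split; first exact: arc_rev.
  by move=> _ [t t01 <-]; apply: gC; exists (1 - t) => //; lra.
move=> t t01; have t01' : 0 < 1 - t < 1 by lra.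
move: (go _ t01'); apply: filterS => y h /h[s s01 <-]; exists (1 - s); first lra.
by rewrite /revp; congr g; lra.
Qed.

Lemma chart_nbhs g (a b t : R) : chart g -> 0 <= a -> a < t -> t < b -> b <= 1 ->
  \forall y \near g t, C y -> exists2 s, a < s < b & g s = y.
Proof.
move=> [[cg ig] gC go] a0 ta tb b1.
have t01 : 0 < t < 1 by lra.
have Na : ~ im g 0 a (g t).
  by move=> [s s0 /ig E]; (suff : s = t by lra); apply: E; lra.
have Nb : ~ im g b 1 (g t).
  by move=> [s s0 /ig E]; (suff : s = t by lra); apply: E; lra.
move: (go _ t01) (notin_nbhs (closed_im (a := 0) (b := a) cg) Na)
  (notin_nbhs (closed_im (a := b) (b := 1) cg) Nb).
apply: filterS3 => y h ha hb /h[s s01 sy]; exists s => //; rewrite !ltNge; apply/andP; split.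
  by apply/negP => sa; apply: ha; exists s => //; lra.
by apply/negP => sb; apply: hb; exists s => //; lra.
Qed.

(* [f] leaves the point [g t] along [g] in the increasing direction. *)
Definition ahead g t f := exists d s, [/\ 0 < d < 1, t < s < 1,
  (forall u, 0 < u <= d -> exists2 v, t < v < 1 & g v = f u) &
  (forall v, t <= v <= s -> exists2 u, 0 <= u <= d & f u = g v)].

(** An intermediate value argument inside the chart: a connected piece of [f] that contains [f d]
    and misses an earlier [g r] lies wholly beyond [g r] ([sep]). Missing [g t] keeps [f] ahead of
    it; missing some later [g v] would put even the start [f 0] beyond [v]. *)
Lemma ahead_of_meet g t f (d : R) : chart g -> simple_arc f -> 0 < t < 1 -> f 0 = g t -> 0 < d < 1 ->
  (forall u, 0 <= u <= d -> exists2 v, 0 < v < 1 & g v = f u) ->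
  (exists2 v, t < v < 1 & g v = f d) -> ahead g t f.
Proof.
move=> hg [cf jf] t01 fg d01 fd [s s01 gs]; have [[cg ig] gC go] := hg.
have sep r : 0 < r < 1 -> ~ im g 0 r (f d) ->
    forall X, connected X -> X `<=` im f 0 d -> X (f d) -> ~ X (g r) ->
    forall u, X u -> exists2 v, r < v < 1 & g v = u.
  move=> r01 nr X cX Xf Xd Xr u Xu.
  have Xg z : X z -> exists2 v, 0 < v < 1 & g v = z.
    by move=> /Xf[w w0 <-]; exact: fd.
  have H : X `<=` im g r 1.
    apply: connected_absorb => //; first exact: closed_im.
      exists (f d); split => //; have [v v01 gv] := Xg _ Xd; exists v => //.
      rewrite leNgt; apply/andP; split; last lra.
      by apply/negP => vr; apply: nr; exists v => //; lra.
    move=> y Xy [v v01 vy].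
    have rv : r < v.
      rewrite lt_neqAle; have /andP[-> _] := v01; rewrite andbT.
      by apply/eqP => E; apply: Xr; rewrite E vy.
    have [w w01 wy] := Xg y Xy.
    have wv : w = v by apply: ig; [lra|lra|rewrite wy vy].
    have := @chart_nbhs g r 1 v hg ltac:(lra) rv ltac:(lra) ltac:(lra); rewrite vy.
    apply: filterS => z hz Xz; have [|k k01 kz] := hz; last by exists k => //; lra.
    by have [k k01 <-] := Xg z Xz; apply: gC; exists k => //; lra.
  have [v v01 vu] := H u Xu; exists v => //.
  have [k k01 ku] := Xg u Xu; have vk : v = k by apply: ig; [lra|lra|rewrite vu ku].
  rewrite vk; apply/andP; split; last lra.
  rewrite lt_neqAle; apply/andP; split; last lra.
  by apply/eqP => E; apply: Xr; rewrite E ku.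
have nd r : 0 <= r < s -> ~ im g 0 r (f d).
  by move=> rs [w w0]; rewrite -gs => /ig E; (suff : w = s by lra); apply: E; lra.
exists d, s; split => //.
  move=> u ud.
  apply: (sep t t01 _ [set y | exists2 w, 0 < w <= d & f w = y]).
  - by apply: nd; lra.
  - exact: connected_im_oc.
  - by move=> _ [w w0 <-]; exists w => //; lra.
  - by exists d => //; lra.
  - by move=> [w w0]; rewrite -fg => /jf E; (suff : w = 0 by lra); apply: E; lra.
  - by exists u.
move=> v vs; apply: contrapT => nv.
have vt : v <> t.
  by move=> E; apply: nv; exists 0; [lra|rewrite E].
have vs' : v <> s.
  by move=> E; apply: nv; exists d; [lra|rewrite E].
have v01 : t < v < s by rewrite !lt_neqAle; apply/andP; split; apply/andP; split; try lra; apply/eqP => // /esym.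
have [w w0] : exists2 w, v < w < 1 & g w = f 0.
  apply: (sep v _ _ (im f 0 d)).
  - lra.
  - by apply: nd; lra.
  - exact: connected_im.
  - by [].
  - by exists d => //; lra.
  - by move=> [u u0 gu]; apply: nv; exists u.
  - by exists 0 => //; lra.
by rewrite fg => /ig E; (suff : w = t by lra); apply: E; lra.
Qed.

Lemma ahead_or_behind g t f : chart g -> simple_arc f -> 0 < t < 1 -> f 0 = g t -> im f 0 1 `<=` C ->
  ahead g t f \/ ahead (revp g) (1 - t) f.
Proof.
move=> hg af t01 fg fC; have [[cg ig] gC go] := hg; have [cf jf] := af.
have [d d01 hd] : exists2 d, 0 < d < 1 & forall u, 0 <= u <= d -> exists2 v, 0 < v < 1 & g v = f u.
  have := go t t01; rewrite -fg => /(cf 0); rewrite /nbhs /= => -[r /= r0 hr].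
  have [d [d0 dr d2]] : exists d, [/\ 0 < d, d <= r / 2 & d <= 2^-1].
    by apply: exists_le2; rewrite ?divr_gt0 ?invr_gt0.
  exists d; first lra.
  move=> u u01; apply: hr.
    by rewrite /ball /= sub0r normrN ger0_norm//; lra.
  by apply: fC; exists u => //; lra.
have [v v01 gv] := hd d (ltac:(lra)).
have [tv|vt|tv] := ltgtP t v.
- by left; apply: (@ahead_of_meet g t f d) => //; exists v => //; lra.
- right; apply: (@ahead_of_meet _ _ f d) => //.
  + exact: chart_rev.
  + lra.
  + by rewrite fg /revp; congr g; lra.
  + move=> u /hd[w w01 gw]; exists (1 - w); first lra.
    by rewrite -gw /revp; congr g; lra.
  + exists (1 - v); first lra.
    by rewrite -gv /revp; congr g; lra.
- by exfalso; move: gv; rewrite -tv -fg => /jf E; (suff : 0 = d by lra); apply: E; lra.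
Qed.

(** Two arcs leaving in the same direction would both cover a stretch of [g] next to [g t] and meet
    there. So they leave in opposite directions and cover both sides of [g t]. *)
Lemma two_arcs_nbhs g t f h : chart g -> 0 < t < 1 -> simple_arc f -> simple_arc h ->
  im f 0 1 `<=` C -> im h 0 1 `<=` C -> f 0 = g t -> h 0 = g t ->
  (forall u v, 0 < u < 1 -> 0 < v < 1 -> f u <> h v) ->
  \forall y \near g t, C y -> im f 0 1 y \/ im h 0 1 y.
Proof.
move=> hg t01 af ah fC hC fg hgt dis.
have same k r : inj01 k -> 0 < r < 1 -> f 0 = k r -> h 0 = k r -> ahead k r f -> ahead k r h -> False.
  move=> ik r01 fk hk [d [s [d01 s01 _ h2]]] [d' [s' [d01' s01' _ h2']]].
  have [rs _] := andP s01; have [rs' _] := andP s01'.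
  have [m [rm ms ms']] := exists_le2 rs rs'.
  have [u u0 fu] := h2 m ltac:(lra); have [v v0 hv] := h2' m ltac:(lra).
  have km : k m <> k r by move=> E; have := ik m r ltac:(lra) ltac:(lra) E; lra.
  apply: (dis u v); last by rewrite fu hv.
    suff : u <> 0 by move/eqP; rewrite neq_lt => ?; lra.
    by move=> u0'; apply: km; rewrite -fu u0'.
  suff : v <> 0 by move/eqP; rewrite neq_lt => ?; lra.
  by move=> v0'; apply: km; rewrite -hv v0'.
have opp k r f' h' : chart k -> 0 < r < 1 -> ahead k r f' -> ahead (revp k) (1 - r) h' ->
  \forall y \near k r, C y -> im f' 0 1 y \/ im h' 0 1 y.
  move=> hk r01 [d [s [d01 s01 _ h2]]] [d' [s' [d01' s01' _ h2']]].
  have := @chart_nbhs k (1 - s') s r hk; move=> /(_ ltac:(lra) ltac:(lra) ltac:(lra) ltac:(lra)).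
  apply: filterS => y H /H[w w01 <-]; have [rw|wr] := leP r w.
    by left; have [|u u0 <-] := h2 w; [lra|exists u => //; lra].
  right; have [|u u0] := h2' (1 - w); first lra.
  by rewrite /revp (_ : 1 - (1 - w) = w); [move=> <-; exists u => //; lra|lra].
have [a1|a1] := ahead_or_behind hg af t01 fg fC; have [a2|a2] := ahead_or_behind hg ah t01 hgt hC.
- by exfalso; by apply: (same g t) => //; case: hg => -[].
- exact: opp.
- by move: (opp g t h f hg t01 a2 a1); apply: filterS => y H /H[]; [right|left].
- exfalso; apply: (same (revp g) (1 - t)) => //.
  + by have [[]] := chart_rev hg.
  + lra.
  + by rewrite fg /revp; congr g; lra.
  + by rewrite hgt /revp; congr g; lra.
Qed.

End Charts.


(** * Counting and finite covers *)

Lemma count_lt (T : Type) (a b : pred T) (l : seq T) : (forall i, b i -> a i) ->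
  has (fun i => a i && ~~ b i) l -> (count b l < count a l)%N.
Proof.
move=> ba; elim: l => //= x l IH /orP[/andP[ax nbx]|/IH H].
  by rewrite ax (negbTE nbx) add0n add1n ltnS; exact: sub_count.
rewrite -addnS; apply: leq_add => //.
by case: (b x) (ba x) => // ->.
Qed.

(** Compactness in its near-covering form, along the filter of all lists that contain a given finite
    list. *)
Lemma compact_seq_cover (T : topologicalType) (I : eqType) (K : set T) (W : I -> set T) :
  compact K -> (forall x, K x -> exists i, nbhs x (W i)) ->
  exists l : seq I, forall x, K x -> exists2 i, i \in l & W i x.
Proof.
move=> kK KW.
pose F : set_system (seq I) := [set Q | exists l0 : seq I, forall l : seq I, {subset l0 <= l} -> Q l].
have FF : Filter F.
  split => [|P Q [l1 h1] [l2 h2]|P Q PQ [l1 h1]]; first by exists [::].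
    exists (l1 ++ l2) => l ll; split; [apply: h1|apply: h2] => i il; apply: ll.
      by rewrite mem_cat il.
    by rewrite mem_cat il orbT.
  by exists l1 => l /h1; exact: PQ.
have [l0 h0] : \forall l \near F, K `<=` [set x | exists2 i, i \in l & W i x].
  move/compact_near_coveringP: kK; apply => x /KW[i Wi].
  exists (W i, [set l : seq I | i \in l]).
    by split => //; exists [:: i] => l /(_ i); apply; rewrite inE.
  by move=> [y l] /= [Wy il]; exists i.
by exists l0; exact: h0.
Qed.

Section Images.
Variable R : realType.
Local Notation pt := (R * R)%type.
Implicit Types (s t : R) (f g h : R -> pt).

Lemma im_rev g : im (revp g) 0 1 = im g 0 1.
Proof.
apply/seteqP; split => _ [t t01 <-]; exists (1 - t); [lra|by []|lra|].
by rewrite /revp; congr g; lra.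
Qed.

Lemma im_sub g (a b : R) : a < b -> im (subp g a b) 0 1 = im g a b.
Proof.
move=> ab; apply/seteqP; split => _ [t t01 <-].
  exists (a + t * (b - a)) => //; nra.
have ba : b - a != 0 by rewrite subr_eq0 gt_eqF.
exists ((t - a) / (b - a)); last by rewrite /subp mulfVK//; congr g; lra.
by rewrite divr_ge0 ?ler_pdivrMr; lra.
Qed.

Lemma im_join f g : f 1 = g 0 -> im (joinp f g) 0 1 = im f 0 1 `|` im g 0 1.
Proof.
move=> fg; apply/seteqP; split => [_ [t t01 <-]|_ [] [t t01 <-]].
- have [th|th] := leP t 2^-1.
    by left; rewrite joinpl//; exists (2 * t) => //; lra.
  by right; rewrite joinpr ?ltW//; exists (2 * t - 1) => //; lra.
- exists (t / 2); first lra.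
  by rewrite joinpl//; [congr f; lra|lra].
- exists ((t + 1) / 2); first lra.
  by rewrite joinpr; [congr g; lra|lra].
Qed.

End Images.

Section Classification.
Variables (R : realType) (C : set (R * R)).
Local Notation pt := (R * R)%type.
Implicit Types (p q x y z : pt) (X Y J : set pt) (s t r : R) (f g h : R -> pt).

Hypothesis cC : connected C.
Hypothesis Cchart : forall p, C p -> exists g t, [/\ chart C g, 0 < t < 1 & g t = p].

Lemma chart_sub g s : chart C g -> 0 <= s <= 1 -> C (g s).
Proof. by move=> [_ gC _] s01; apply: gC; exists s. Qed.

(** The union of [g] and the stretch of [h] is closed and also open in [C], the two junctions being
    handled by [two_arcs_nbhs]; so it exhausts the connected [C]. *)
Lemma chart_close g h t r : chart C g -> chart C h -> g 1 = h t -> g 0 = h r ->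
  0 < t -> t < r -> r <= 1 -> (forall v, t < v < r -> ~ im g 0 1 (h v)) ->
  simple_closed_curve C.
Proof.
move=> hg hh gt gr t0 tr r1 dis.
have [[cg ig] gC go] := hg; have [[ch ih] hC ho] := hh.
pose b := revp (subp h t r).
have ab0 : simple_arc (subp h t r) by apply: arc_sub; [|lra|lra|rewrite lt_eqF].
have ab : simple_arc b by exact: arc_rev.
have imb : im b 0 1 = im h t r by rewrite im_rev im_sub.
have b0 : b 0 = g 0 by rewrite gr /b /revp /subp; congr h; lra.
have b1 : b 1 = g 1 by rewrite gt /b /revp /subp; congr h; lra.
have bC : im b 0 1 `<=` C by rewrite imb => _ [v v01 <-]; apply: chart_sub => //; lra.
have dis' u v : 0 < u < 1 -> 0 < v < 1 -> g u <> b v.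
  move=> u01 v01 E; apply: (dis (t + (1 - v) * (r - t))); first nra.
  by exists u; [lra|rewrite E].
have scc := @closed_curve_of_arcs R g b (conj cg ig) ab (esym b0) (esym b1) dis'.
suff E : C = im g 0 1 `|` im b 0 1 by rewrite E.
apply/seteqP; split; last by move=> y []; [exact: gC|exact: bC].
apply: connected_absorb => //.
- by apply: closedU; [exact: closed_im|apply: closed_im; case: ab].
- by exists (g 0); split; [apply: chart_sub => //; lra|left; exists 0 => //; lra].
(* [r] may be [1], and then [h] is not a chart around [g 0]; another chart is taken there. *)
have at0 : \forall z \near g 0, C z -> (im g 0 1 `|` im b 0 1) z.
  have [k [w [hk w01 kw]]] := Cchart (chart_sub hg (s := 0) ltac:(lra)).
  rewrite -kw.
  exact: (two_arcs_nbhs hk w01 (conj cg ig) ab gC bC (esym kw) (etrans b0 (esym kw)) dis').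
have at1 : \forall z \near g 1, C z -> (im g 0 1 `|` im b 0 1) z.
  rewrite gt -(im_rev g) -(im_rev b); apply: (two_arcs_nbhs hh).
  - lra.
  - exact: arc_rev (conj cg ig).
  - exact: arc_rev.
  - by rewrite im_rev.
  - by rewrite im_rev.
  - by rewrite /revp subr0.
  - by rewrite /revp subr0 b1.
  - by move=> u v u01 v01; apply: dis'; lra.
move=> y Cy [[w w01 wy]|].
  have [w0|w0] := eqVneq w 0; first by rewrite -wy w0.
  have [w1|w1] := eqVneq w 1; first by rewrite -wy w1.
  have w01' : 0 < w < 1 by rewrite !lt_neqAle w1 [0 == _]eq_sym w0.
  rewrite -wy; move: (go w w01'); apply: filterS => z hz /hz[k k01 <-].
  by left; exists k => //; lra.
rewrite imb => -[v v01 vy].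
have [vt|vt] := eqVneq v t; first by rewrite -vy vt -gt -imb.
have [vr|vr] := eqVneq v r; first by rewrite -vy vr -gr -imb.
have v01' : t < v < r by rewrite !lt_neqAle vr [t == _]eq_sym vt.
rewrite -vy; have := @chart_nbhs R C h t r v hh ltac:(lra) ltac:(lra) ltac:(lra) r1.
apply: filterS => z hz /hz[k k01 <-].
by right; exists k => //; lra.
Qed.

(** Prolonging [g] by the part of [h] after [t] is not enough: progress is measured by the charts
    swallowed, so the part before [t] must be covered too. That part follows [g] backwards and can
    escape only through [g 0]. *)
Lemma chart_grow g h t (s : R) : chart C g -> chart C h -> g 1 = h t -> 0 < t < 1 ->
  0 <= s < t -> (forall v, s <= v <= t -> im g 0 1 (h v)) ->
  (forall v, t < v <= 1 -> ~ im g 0 1 (h v)) ->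
  exists g', [/\ chart C g', im g 0 1 `<=` im g' 0 1,
    forall v, 0 < v < 1 -> im g' 0 1 (h v) & exists2 v, 0 < v < 1 & ~ im g 0 1 (h v)].
Proof.
move=> hg hh gt t01 st back dis.
have [[cg ig] gC go] := hg; have [[ch ih] hC ho] := hh.
have new : exists2 v, 0 < v < 1 & ~ im g 0 1 (h v).
  by exists ((1 + t) / 2); [lra|apply: dis; lra].
(* The arc [g] is open in [C] at its inner points, [g 0] is excluded by assumption, and at [g 1] it
   is [back] that keeps [h] inside. *)
have follow a : 0 <= a < t -> (forall v, a < v < t -> h v <> g 0) ->
    forall v, a < v <= t -> im g 0 1 (h v).
  move=> a01 na v0 v001.
  suff : [set y | exists2 v, a < v <= t & h v = y] `<=` im g 0 1 by apply; exists v0.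
  apply: connected_absorb; [exact: connected_im_oc|exact: closed_im| |].
    by exists (h t); split; [exists t => //; lra|apply: back; lra].
  move=> y [v v01 vy] [w w01 wy].
  have [w0|w0] := eqVneq w 0.
    have [vt|vt] := eqVneq v t; first by have : 0 = 1 :> R by
      [apply: ig; [lra|lra|rewrite gt -vt vy -wy w0]]; lra.
    exfalso; apply: (na v); last by rewrite vy -wy w0.
    by apply/andP; split; [lra|rewrite lt_neqAle vt; lra].
  have [w1|w1] := eqVneq w 1.
    rewrite -wy w1 gt.
    have := @chart_nbhs R C h s 1 t hh ltac:(lra) ltac:(lra) ltac:(lra) ltac:(lra).
    apply: filterS => z hz [k k01 kz]; have [|k' k'01 k'z] := hz.
      by rewrite -kz; apply: chart_sub => //; lra.
    have E : k = k' by apply: ih; [lra|lra|rewrite kz].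
    by rewrite -kz; apply: back; lra.
  have w01' : 0 < w < 1 by rewrite !lt_neqAle w1 [0 == _]eq_sym w0.
  rewrite -wy; move: (go w w01'); apply: filterS => z hz [k k01 kz].
  by have [|k' k'01 <-] := hz; [rewrite -kz; apply: chart_sub => //; lra|exists k' => //; lra].
have [[a a01 ha]|na] := pselect (exists2 a, 0 < a < t & h a = g 0).
  (* [h] runs back along the whole of [g], so [h] itself is the larger chart. *)
  have back' : im h a t `<=` im g 0 1.
    move=> _ [v v01 <-]; have [->|va] := eqVneq v a.
      by rewrite ha; exists 0 => //; lra.
    apply: (follow a); first lra.
      move=> w w01; rewrite -ha => /ih E; (suff : w = a by lra); apply: E; lra.
    by apply/andP; split; [rewrite lt_neqAle eq_sym va; lra|lra].
  have full := @arc_connected_full R g (im h a t) (conj cg ig) (connected_im ch) back'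
    ltac:(by exists a => //; lra) ltac:(by exists t => //; lra).
  exists h; split => //.
  - by move=> y /full[v v01 <-]; exists v => //; lra.
  - by move=> v v01; exists v => //; lra.
pose b := subp h t 1.
have lt1 : t < 1 by lra.
have ab : simple_arc b by apply: arc_sub; [|lra|lra|rewrite lt_eqF].
have imb : im b 0 1 = im h t 1 by rewrite im_sub.
have b0 : g 1 = b 0 by rewrite gt /b /subp; congr h; lra.
have bE u : b u = h (t + u * (1 - t)) by [].
have imj := im_join b0.
exists (joinp g b); rewrite imj; split => //; last first.
  move=> v v01; have [tv|vt] := leP t v; first by right; rewrite imb; exists v => //; lra.
  by left; apply: (follow 0); [lra| |lra] => w w01 E; apply: na; exists w.
have dis' u v : 0 <= u <= 1 -> 0 < v <= 1 -> g u <> b v.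
  by move=> u01 v01 E; apply: (dis (t + v * (1 - t))); [nra|exists u].
have bC : im b 0 1 `<=` C by rewrite imb => _ [v v01 <-]; apply: chart_sub => //; lra.
split; first exact: arc_join.
  by rewrite imj => y []; [exact: gC|exact: bC].
move=> w w01; have [wh|wh|wh] := ltgtP w 2^-1.
- rewrite joinpl ?ltW//; move: (go (2 * w) ltac:(lra)); apply: filterS => z hz /hz[k k01 <-].
  by exists (k / 2); [lra|rewrite joinpl//; [congr g; lra|lra]].
- rewrite joinpr ?ltW// bE.
  have := @chart_nbhs R C h t 1 (t + (2 * w - 1) * (1 - t)) hh ltac:(lra) ltac:(nra) ltac:(nra) ltac:(lra).
  apply: filterS => z hz /hz[k k01 <-].
  have t1 : 0 < 1 - t by lra.
  pose m := (k - t) / (1 - t).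
  have m01 : 0 < m < 1 by rewrite /m divr_gt0 ?ltr_pdivrMr//; lra.
  exists ((m + 1) / 2); first lra.
  rewrite joinpr; last lra.
  rewrite bE; congr h; rewrite (_ : 2 * _ - 1 = m); last lra.
  by rewrite /m mulfVK ?gt_eqF//; lra.
- rewrite joinpl ?wh// (_ : 2 * 2^-1 = 1) ?divff// gt.
  (* At the junction [two_arcs_nbhs] yields closed arcs; the outer ends [g 0] and [h 1] are cut off
     to land in the open part. *)
  have n0 : ~ im g 0 0 (h t).
    by move=> [k k0]; rewrite -gt => /ig E; (suff : k = 1 by lra); apply: E; lra.
  have n1 : ~ im h 1 1 (h t).
    by move=> [k k0] /ih E; (suff : k = t by lra); apply: E; lra.
  have := @two_arcs_nbhs R C h t (revp g) b hh t01 (arc_rev (conj cg ig)) ab.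
  rewrite im_rev => /(_ gC bC); rewrite {1}/revp subr0 -b0 => /(_ gt gt) H.
  have {H} := H (fun u v u01 v01 => dis' (1 - u) v ltac:(lra) ltac:(lra)).
  move: (notin_nbhs (closed_im (a := 0) (b := 0) cg) n0) (notin_nbhs (closed_im (a := 1) (b := 1) ch) n1).
  apply: filterS3 => z z0 z1 hz /hz[[k k01 kz]|].
    have k0 : k <> 0 by move=> E; apply: z0; exists 0; [lra|rewrite -kz E].
    exists (k / 2); first by move/eqP: k0; rewrite neq_lt => ?; lra.
    by rewrite joinpl//; [rewrite -kz; congr g; lra|lra].
  move=> [k k01 kz].
  have k1 : k <> 1 by move=> E; apply: z1; exists 1; [lra|rewrite -kz E bE; congr h; lra].
  exists ((k + 1) / 2); first by move/eqP: k1; rewrite neq_lt => ?; lra.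
  by rewrite joinpr; [rewrite -kz; congr b; lra|lra].
Qed.

(** Just after [t] the arc [h] leaves [g]. A first return can only be at [g 0]: at an inner point of
    [g] the points of [h] just before would already lie on [g], and [g 1] is [h t]. *)
Lemma chart_extend_ahead g h t : chart C g -> chart C h -> g 1 = h t -> 0 < t < 1 ->
  ahead (revp h) (1 - t) (revp g) ->
  simple_closed_curve C \/ exists g', [/\ chart C g', im g 0 1 `<=` im g' 0 1,
    forall v, 0 < v < 1 -> im g' 0 1 (h v) & exists2 v, 0 < v < 1 & ~ im g 0 1 (h v)].
Proof.
move=> hg hh gt t01 [d [s [d01 s01 h1 h2]]].
have [[cg ig] gC go] := hg; have [[ch ih] hC ho] := hh.
have back v : 1 - s <= v <= t -> im g 0 1 (h v).
  move=> v01; have [|u u01] := h2 (1 - v); first lra.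
  by rewrite /revp (_ : 1 - (1 - v) = v); [move=> <-; exists (1 - u) => //; lra|lra].
have near_t w v : 1 - d <= w <= 1 -> t < v <= 1 -> g w <> h v.
  move=> w01 v01 E; have [w1|w1] := eqVneq w 1.
    have : t = v by apply: ih; [lra|lra|rewrite -gt -w1 E].
    lra.
  have [|u u01] := h1 (1 - w); first by apply/andP; split; [rewrite subr_gt0 lt_neqAle w1|]; lra.
  rewrite /revp (_ : 1 - (1 - w) = w); last lra.
  by rewrite E => /ih E'; (suff : 1 - u = v by lra); apply: E'; lra.
(* The head start [e] makes the set of return times compact, so a first one exists. *)
have [e e01 he] : exists2 e, 0 < e < 1 - t & forall v, t < v <= t + e -> ~ im g 0 1 (h v).
  have nt : ~ im g 0 (1 - d) (h t).
    by move=> [w w01]; rewrite -gt => /ig E; (suff : w = 1 by lra); apply: E; lra.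
  have := notin_nbhs (closed_im (a := 0) (b := 1 - d) cg) nt.
  move=> /(ch t); rewrite /nbhs /= => -[r /= r0 hr].
  have [e [e0 er et]] : exists e, [/\ 0 < e, e <= r / 2 & e <= (1 - t) / 2].
    by apply: exists_le2; rewrite ?divr_gt0// subr_gt0; case/andP: t01.
  exists e; first lra.
  move=> v v01 [w w01 wv]; have [wd|wd] := leP w (1 - d).
    have : ball t r v by rewrite /ball /= distrC gtr0_norm; lra.
    by move=> /hr; apply; exists w => //; lra.
  by apply: (near_t w v) => //; lra.
have [hit|nohit] := pselect (exists2 v, t < v <= 1 & im g 0 1 (h v)); last first.
  right; apply: (@chart_grow g h t (1 - s)) => //; first lra.
  by move=> v v01 Jv; apply: nohit; exists v.
left; have [v v01 Jv] := hit.
pose Z := `[t + e, 1] `&` h @^-1` im g 0 1.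
have cZ : compact Z.
  apply: compact_closedI; first exact: segment_compact.
  by apply: closed_comp => [x _|]; [exact: ch|exact: closed_im].
have Zv : Z v.
  split => //=; rewrite in_itv /=; apply/andP; split; last lra.
  by rewrite leNgt; apply/negP => ve; apply: (he v) => //; lra.
have [||r] := @compact_EVT_min _ R (fun x : R => x) Z _ cZ.
- by exists v.
- by apply: continuous_subspaceT; exact: cont_id.
rewrite inE => -[]; rewrite /= in_itv /= => r01 Jr rmin.
have free w : t < w < r -> ~ im g 0 1 (h w).
  move=> w01; have [we|we] := leP w (t + e); first by apply: he; lra.
  move=> Jw; have := rmin w; rewrite inE => H.
  have : r <= w by apply: H; split => //=; rewrite in_itv /=; lra.
  lra.
have [w w01 wr] := Jr.
have [w0|w0] := eqVneq w 0.
  by apply: (@chart_close g h t r) => //; [rewrite -w0|lra|lra|lra].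
have [w1|w1] := eqVneq w 1.
  by exfalso; apply: (@near_t 1 r); [lra|lra|rewrite -w1].
exfalso; have w01' : 0 < w < 1 by rewrite !lt_neqAle w1 [0 == _]eq_sym w0.
have := go w w01'; rewrite wr => /(ch r); rewrite /nbhs /= => -[k /= k0 hk].
have tr : t < r by clear - cC Cchart e01 r01; lra.
have [m [m0 m1 m2]] : exists m, [/\ 0 < m, m <= (r - t) / 2 & m <= k / 2].
  by apply: exists_le2; rewrite ?divr_gt0// subr_gt0.
apply: (free (r - m)); first by clear - cC Cchart m0 m1 tr; lra.
have : ball r k (r - m) by rewrite /ball /= subKr gtr0_norm//; clear - cC Cchart k0 m2; lra.
move=> /hk H; have [|u u01 um] := H; last by exists u => //; lra.
by apply: chart_sub => //; lra.
Qed.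

Lemma chart_extend g h t : chart C g -> chart C h -> g 1 = h t -> 0 < t < 1 ->
  simple_closed_curve C \/ exists g', [/\ chart C g', im g 0 1 `<=` im g' 0 1,
    forall v, 0 < v < 1 -> im g' 0 1 (h v) & exists2 v, 0 < v < 1 & ~ im g 0 1 (h v)].
Proof.
move=> hg hh gt t01; have hrg := chart_rev hg; have hrh := chart_rev hh.
have g0 : revp g 0 = h t by rewrite /revp subr0.
have [arg rgC _] := hrg.
have [a|a] := ahead_or_behind hh arg t01 g0 rgC; last exact: (chart_extend_ahead hg hh gt t01 a).
have [|||//|[g' [hg' gg' hv [v v01 nv]]]] := @chart_extend_ahead g (revp h) (1 - t) hg hrh.
- by rewrite gt /revp; congr h; lra.
- lra.
- by rewrite revpK (_ : 1 - (1 - t) = t); [|lra].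
- by left.
right; exists g'; split => //.
  by move=> w w01; have := hv (1 - w) ltac:(lra); rewrite /revp (_ : 1 - (1 - w) = w); [|lra].
by exists (1 - v); [lra|exact: nv].
Qed.

(** Each extension absorbs the chart of a finite cover that contains the end [g 1], so the number of
    charts not yet absorbed drops until the curve closes. *)
Lemma closed_curve_of_charts : compact C -> C !=set0 -> simple_closed_curve C.
Proof.
move=> kC [p0 Cp0].
have [F hF] : {F : pt -> (R -> pt) * R & forall p, C p ->
    [/\ chart C (F p).1, 0 < (F p).2 < 1 & (F p).1 (F p).2 = p]}.
  apply: (@choice _ _ (fun p (gt : (R -> pt) * R) => C p -> [/\ chart C gt.1, 0 < gt.2 < 1 & gt.1 gt.2 = p])) => p.
  have [/Cchart[g [t H]]|nC] := pselect (C p); first by exists (g, t).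
  by exists (fun=> p, 0).
(* [F] has a dummy value off [C]; keeping [C p] in [W p] ensures that an index found through the
   cover is a point of [C]. *)
pose W p := [set y | C p /\ (C y -> exists2 s, 0 < s < 1 & (F p).1 s = y)].
have [|L cov] := @compact_seq_cover pt pt C W kC.
  move=> p Cp; exists p; have [[_ _ go] t01 gt] := hF p Cp.
  by have := go _ t01; rewrite gt; apply: filterS.
pose bad g := fun p => ~~ `[< forall v, 0 < v < 1 -> im g 0 1 ((F p).1 v) >].
suff H n : forall g, chart C g -> (count (bad g) L < n)%N -> simple_closed_curve C.
  by have [hg _ _] := hF p0 Cp0; exact: (H _ _ hg (ltnSn _)).
elim: n => // n IH g hg ln.
have C1 : C (g 1) by apply: chart_sub => //; lra.
have [p Lp [Cp Wp]] := cov _ C1.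
have [hp _ _] := hF p Cp; have [t t01 gt] := Wp C1.
have [//|[g' [hg' gg' hv [v v01 nv]]]] := chart_extend hg hp (esym gt) t01.
rewrite ltnS in ln; apply: (IH g' hg'); apply: leq_trans ln.
apply: count_lt.
  move=> x; apply: contra => /asboolP H; apply/asboolP => w w01; exact: gg' (H w w01).
apply/hasP; exists p => //; rewrite /bad negbK; apply/andP; split; last exact/asboolP.
by apply/asboolPn => H; apply: nv; exact: H.
Qed.

End Classification.


(** * No component meets a pinch point from both sides *)

Section Pinch.
Variables (R : realType) (e : R) (K : set (R * R)).
Local Notation pt := (R * R)%type.
Implicit Types (p q x y z u : pt) (X D : set pt) (Q : pt -> pt).
Hypothesis e0 : 0 < e.

(* Points are read as complex numbers: [ang x y z] is (y - z) * conj (x - z), whose argument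
   is the angle under which z sees the segment [x, y], and [csq] is squaring. *)
Definition ang x y z : pt :=
  ((y.1 - z.1) * (x.1 - z.1) + (y.2 - z.2) * (x.2 - z.2),
   (y.2 - z.2) * (x.1 - z.1) - (y.1 - z.1) * (x.2 - z.2)).

Definition csq x : pt := (x.1 ^+ 2 - x.2 ^+ 2, 2 * (x.1 * x.2)).

Definition cabs x : R := Num.sqrt (x.1 ^+ 2 + x.2 ^+ 2).

(* A positive multiple of the principal square root of [x]. *)
Definition croot x : pt := (x.1 + cabs x, x.2).

Lemma cabs_sqr x : cabs x ^+ 2 = x.1 ^+ 2 + x.2 ^+ 2.
Proof. by rewrite sqr_sqrtr// addr_ge0 ?sqr_ge0. Qed.

Lemma cabs_ge0 x : 0 <= cabs x.
Proof. exact: sqrtr_ge0. Qed.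

Lemma csq_croot x : csq (croot x) = scale (2 * (croot x).1) x.
Proof.
have h := cabs_sqr x; rewrite /csq /croot /scale /=.
by set m := cabs x in h *; congr (_, _); nra.
Qed.

Lemma cont_ang x y : continuous (ang x y).
Proof. by rewrite /ang; cont. Qed.

Lemma cont_croot (T : topologicalType) (f : T -> pt) : continuous f -> continuous (fun i => croot (f i)).
Proof. by move=> cf; rewrite /croot /cabs; cont. Qed.

Lemma cabs_ang x y z : cabs (ang x y z) ^+ 2 = sqd x z * sqd y z.
Proof. by rewrite cabs_sqr /ang /sqd /=; ring. Qed.

(** By the law of cosines the last hypothesis says that the real part of [ang x y z] exceeds
    [- e ^+ 2], while the modulus is at least [e ^+ 2]. So [ang x y z] is off the cut of the
    principal root. *)
Lemma croot_ang_gt0 x y z : e ^+ 2 <= sqd x z -> e ^+ 2 <= sqd y z ->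
  sqd x y < sqd x z + sqd y z + 2 * e ^+ 2 -> 0 < (croot (ang x y z)).1.
Proof.
move=> xz yz xy; set w := ang x y z; change (0 < w.1 + cabs w).
have n0 := cabs_ge0 w; have n2 := cabs_sqr w; have n3 := cabs_ang x y z; rewrite -/w in n3.
have xyE : sqd x y = sqd x z + sqd y z - 2 * w.1 by rewrite /w /ang /sqd /=; ring.
have ne : e ^+ 2 <= cabs w.
  have h1 : (e ^+ 2) ^+ 2 <= cabs w ^+ 2 by rewrite n3 expr2 ler_pM ?sqr_ge0.
  by rewrite -(@ler_sqr _ (e ^+ 2)) ?nnegrE ?sqr_ge0.
lra.
Qed.

(** [Q] is continuous on the whole plane but a square root of [ang x y] only off the open
    neighbourhood, and only up to a positive factor depending on the viewpoint; this freedom spares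
    all normalisation. *)
Definition linked x y := [/\ K x, K y & exists Q, continuous Q /\
  forall z, ~ onbhd e K z -> exists2 k, 0 < k & csq (Q z) = scale k (ang x y z)].

Lemma notin_onbhd x z : K x -> ~ onbhd e K z -> e ^+ 2 <= sqd x z.
Proof. by move=> Kx nz; rewrite leNgt; apply/negP => h; apply: nz; exists x => //; rewrite sqdC. Qed.

Lemma linked_close x y : K x -> K y -> rho x y < 2 * e -> linked x y.
Proof.
move=> Kx Ky; rewrite rho_lt ?mulr_ge0 ?(ltW e0)// => xy; split => //.
exists (fun z => croot (ang x y z)); split; first by apply: cont_croot; exact: cont_ang.
move=> z nz; exists (2 * (croot (ang x y z)).1); last exact: csq_croot.
have xz := notin_onbhd Kx nz; have yz := notin_onbhd Ky nz.
by rewrite mulr_gt0// croot_ang_gt0//; nra.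
Qed.

(** [ang x y w] times [ang y z w] is [ang x z w] times the squared distance from [y] to [w], so the
    product of the roots is a root. *)
Lemma linked_trans x y z : linked x y -> linked y z -> linked x z.
Proof.
move=> [Kx Ky [Q [cQ hQ]]] [_ Kz [P [cP hP]]]; split => //.
exists (fun w => ((Q w).1 * (P w).1 - (Q w).2 * (P w).2, (Q w).1 * (P w).2 + (Q w).2 * (P w).1)).
split; first by cont.
move=> w nw; have [k k0 hk] := hQ w nw; have [l l0 hl] := hP w nw.
exists (k * l * sqd y w).
  rewrite !mulr_gt0//; apply: lt_le_trans (notin_onbhd Ky nw); rewrite exprn_gt0//.
move: hk hl; rewrite /csq /scale /ang /sqd /= => -[k1 k2] [l1 l2].
set q := Q w in k1 k2 *; set p := P w in l1 l2 *; congr (_, _).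
  transitivity ((q.1 ^+ 2 - q.2 ^+ 2) * (p.1 ^+ 2 - p.2 ^+ 2) - (2 * (q.1 * q.2)) * (2 * (p.1 * p.2))).
    by ring.
  by rewrite k1 k2 l1 l2; ring.
transitivity ((q.1 ^+ 2 - q.2 ^+ 2) * (2 * (p.1 * p.2)) + (2 * (q.1 * q.2)) * (p.1 ^+ 2 - p.2 ^+ 2)).
  by ring.
by rewrite k1 k2 l1 l2; ring.
Qed.

Lemma sign_constant X (g : pt -> R) : connected X -> continuous g -> (forall x, X x -> g x != 0) ->
  forall x y, X x -> X y -> 0 < g x -> 0 < g y.
Proof.
move=> cX cg g0 x y Xx Xy gx.
have := @connected_trap R X [set z | 0 < g z] [set z | 0 <= g z] cX.
apply => //.
- by apply: open_ltf => //; exact: contC.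
- by apply: closed_lef => //; exact: contC.
- by move=> z /= /ltW.
- by move=> z [Xz /=]; rewrite le_eqVlt eq_sym (negbTE (g0 z Xz)).
- by exists x.
Qed.

Hypothesis Kchain : forall T : pt -> pt -> Prop,
  (forall x y z, T x y -> T y z -> T x z) ->
  (forall x y, K x -> K y -> rho x y < 2 * e -> T x y) ->
  forall x y, K x -> K y -> T x y.

Variable D : set pt.
Hypothesis cD : is_component (~` cnbhd e K) D.

(* The principal root of [ang a b] jumps across the segment [a, b] at [p], while the root
   continued along a chain from [a] to [b] does not; they agree up to a constant sign on [D]. *)
Lemma no_pinch p u : dotp u u = 1 ->
  K (p.1 + e * u.1, p.2 + e * u.2) -> K (p.1 - e * u.1, p.2 - e * u.2) -> ~ onbhd e K p ->
  exists2 N : set pt, nbhs p N & forall x y, N x -> N y -> D x -> D y ->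
    0 <= (u.1 * (x.2 - p.2) - u.2 * (x.1 - p.1)) * (u.1 * (y.2 - p.2) - u.2 * (y.1 - p.1)).
Proof.
set a := (p.1 + _, _); set b := (p.1 - _, _) => u1 Ka Kb Up.
have [_ _ [Q [cQ hQ]]] := Kchain linked_trans linked_close Ka Kb.
pose S z := croot (ang a b z).
have cS : continuous S by apply: cont_croot; exact: cont_ang.
have u1' : u.1 * u.1 + u.2 * u.2 = 1 by [].
have ab : sqd a b = 4 * e ^+ 2.
  rewrite (_ : sqd a b = 4 * e ^+ 2 * (u.1 * u.1 + u.2 * u.2)); first by rewrite u1' mulr1.
  by rewrite /sqd /a /b /=; ring.
have [k k0 hk] := hQ p Up.
have hk1 : (Q p).1 ^+ 2 - (Q p).2 ^+ 2 = k * (ang a b p).1 := congr1 fst hk.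
have angp1 : (ang a b p).1 = - e ^+ 2.
  rewrite (_ : _.1 = - e ^+ 2 * (u.1 * u.1 + u.2 * u.2)); first by rewrite u1' mulr1.
  by rewrite /ang /a /b /=; ring.
have ang2 z : (ang a b z).2 = - 2 * e * (u.1 * (z.2 - p.2) - u.2 * (z.1 - p.1)).
  by rewrite /ang /a /b /=; ring.
rewrite angp1 in hk1.
have e2 : 0 < e ^+ 2 by rewrite exprn_gt0.
(* Seen from [p], the points [a] and [b] are opposite; [ang a b p] is negative, so its root is not
   real. *)
have q2 : (Q p).2 != 0.
  apply/eqP => E; move: hk1; rewrite E expr0n /= subr0 => hk1.
  by have := sqr_ge0 (Q p).1; nra.
exists [set z | 0 < (Q z).2 * (Q p).2].
  apply: open_nbhs_nbhs; split; first by apply: open_ltf; cont.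
  by rewrite /= -expr2 lt_def sqr_ge0 sqrf_eq0 q2.
(* The scalar product of the two roots: they turn out parallel on [D], and the sign of [g] tells
   whether they point the same way. *)
pose g z := (Q z).1 * (S z).1 + (Q z).2 * (S z).2.
have key z : D z -> [/\ 0 < (S z).1, g z != 0 & (Q z).1 * (S z).2 = (Q z).2 * (S z).1].
  move=> Dz; have Bz := is_component_sub cD Dz.
  have far c : K c -> e ^+ 2 < sqd c z.
    by move=> Kc; rewrite ltNge; apply/negP => h; apply: Bz; exists c => //; rewrite sqdC.
  have az := far a Ka; have bz := far b Kb.
  have S1 : 0 < (S z).1 by apply: croot_ang_gt0; rewrite ?ltW// ab; lra.
  have [l l0 hl] := hQ z (fun h => Bz (onbhd_sub h)).
  have hS : csq (S z) = scale (2 * (S z).1) (ang a b z) by exact: csq_croot.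
  have n3 := cabs_ang a b z; rewrite cabs_sqr in n3.
  have w0 : 0 < (ang a b z).1 ^+ 2 + (ang a b z).2 ^+ 2.
    by rewrite n3 mulr_gt0//; lra.
  set w := ang a b z in hl hS w0; set q := Q z in hl *; set s := S z in S1 hS *.
  have hl1 : q.1 ^+ 2 - q.2 ^+ 2 = l * w.1 := congr1 fst hl.
  have hl2 : 2 * (q.1 * q.2) = l * w.2 := congr1 snd hl.
  have hs1 : s.1 ^+ 2 - s.2 ^+ 2 = 2 * s.1 * w.1 := congr1 fst hS.
  have hs2 : 2 * (s.1 * s.2) = 2 * s.1 * w.2 := congr1 snd hS.
  (* The square of [Q z] times the conjugate of [S z] is a positive real: [I0] says that its
     imaginary part vanishes, [I1] that its real part is positive. *)
  have I0 : (q.1 * s.1 + q.2 * s.2) * (q.1 * s.2 - q.2 * s.1) = 0.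
    have : 2 * ((q.1 * s.1 + q.2 * s.2) * (q.1 * s.2 - q.2 * s.1)) =
       (q.1 ^+ 2 - q.2 ^+ 2) * (2 * (s.1 * s.2)) - (2 * (q.1 * q.2)) * (s.1 ^+ 2 - s.2 ^+ 2).
      by ring.
    rewrite hl1 hl2 hs1 hs2 => H.
    have : 2 * ((q.1 * s.1 + q.2 * s.2) * (q.1 * s.2 - q.2 * s.1)) = 0 by rewrite H; ring.
    lra.
  have I1 : 0 < (q.1 * s.1 + q.2 * s.2) ^+ 2 - (q.1 * s.2 - q.2 * s.1) ^+ 2.
    rewrite (_ : _ - _ = (q.1 ^+ 2 - q.2 ^+ 2) * (s.1 ^+ 2 - s.2 ^+ 2) + (2 * (q.1 * q.2)) * (2 * (s.1 * s.2))).
      rewrite hl1 hl2 hs1 hs2 (_ : _ + _ = l * (2 * s.1) * (w.1 ^+ 2 + w.2 ^+ 2)); last by ring.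
      by rewrite !mulr_gt0.
    by ring.
  have gn : q.1 * s.1 + q.2 * s.2 != 0.
    by apply/eqP => E; move: I1; rewrite E; have := sqr_ge0 (q.1 * s.2 - q.2 * s.1); lra.
  split => //; move/eqP: I0; rewrite mulf_eq0 (negbTE gn) /= subr_eq0 => /eqP//.
have cg : continuous g by rewrite /g; cont.
have gne z : D z -> g z != 0 by move=> /key[].
have cDc := is_component_connected cD.
have sg := sign_constant cDc cg gne.
have gS z : D z -> g z * (S z).2 = (Q z).2 * ((S z).1 ^+ 2 + (S z).2 ^+ 2).
  move=> /key[_ _ h]; rewrite /g mulrDl (mulrAC (Q z).1) h; ring.
have Ssq z : D z -> 0 < (S z).1 ^+ 2 + (S z).2 ^+ 2.
  by move=> /key[h _ _]; rewrite ltr_pwDl ?sqr_ge0// exprn_gt0.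
have S2 z : (S z).2 = - 2 * e * (u.1 * (z.2 - p.2) - u.2 * (z.1 - p.1)) by rewrite -ang2.
move=> x y /= Nx Ny Dx Dy; rewrite leNgt; apply/negP => opp.
have gg : 0 < g x * g y.
  have := gne x Dx; rewrite neq_lt => /orP[gx|gx].
    have sg' := @sign_constant D (fun z => - g z) cDc (contN cg) _ x y Dx Dy.
    have : 0 < - g y by apply: sg'; [move=> z Dz; rewrite oppr_eq0 gne|lra].
    by nra.
  by rewrite mulr_gt0//; exact: (sg x y).
have SS : (S x).2 * (S y).2 < 0.
  rewrite !S2 (_ : _ * _ * _ * _ = 4 * e ^+ 2 * ((u.1 * (x.2 - p.2) - u.2 * (x.1 - p.1)) * (u.1 * (y.2 - p.2) - u.2 * (y.1 - p.1)))); last by ring.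
  by rewrite nmulr_llt0// mulr_gt0.
have QQ : 0 < (Q x).2 * (Q y).2.
  have : 0 < ((Q x).2 * (Q p).2) * ((Q y).2 * (Q p).2) by rewrite mulr_gt0.
  have : 0 < (Q p).2 ^+ 2 by rewrite lt_def sqr_ge0 sqrf_eq0 q2.
  rewrite (_ : (Q x).2 * (Q p).2 * _ = (Q x).2 * (Q y).2 * (Q p).2 ^+ 2); last by ring.
  by move=> h; rewrite pmulr_lgt0.
have : g x * (S x).2 * (g y * (S y).2) = g x * g y * ((S x).2 * (S y).2) by ring.
rewrite !gS// => E.
have : 0 < (Q x).2 * ((S x).1 ^+ 2 + (S x).2 ^+ 2) * ((Q y).2 * ((S y).1 ^+ 2 + (S y).2 ^+ 2)).
  rewrite (_ : _ * _ * _ = (Q x).2 * (Q y).2 * (((S x).1 ^+ 2 + (S x).2 ^+ 2) * ((S y).1 ^+ 2 + (S y).2 ^+ 2))).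
    exact: (mulr_gt0 QQ (mulr_gt0 (Ssq _ Dx) (Ssq _ Dy))).
  by ring.
by rewrite E pmulr_rgt0// => h; lra.
Qed.

End Pinch.


(** * Local structure of the frontier *)

Section Graph.
Variable R : realType.
Local Notation pt := (R * R)%type.
Implicit Types (s t : R).

(** By [mono] the sets [B] and [U] differ by a single height over each abscissa, the value of [f].
    Openness of [U] makes [f] lower semicontinuous, closedness of [B] makes it upper
    semicontinuous. *)
Lemma graph_of_monotone (B U : set pt) (d : R) : 0 < d -> closed B -> open U -> U `<=` B ->
  (forall s t t', `|s| <= d -> - d <= t -> t < t' -> t' <= d -> B (s, t') -> U (s, t)) ->
  B (0, 0) -> ~ U (0, 0) ->
  exists sg f, [/\ 0 < sg <= d, continuous f, f 0 = 0,
    forall s, `|s| <= sg -> - d < f s < d &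
    forall s t, `|s| <= sg -> `|t| <= d -> (B (s, t) <-> t <= f s) /\ (U (s, t) <-> t < f s)].
Proof.
move=> d0 cB oU UB mono B0 U0.
have Um : U (0, - d) by apply: (mono 0 (- d) 0) => //; rewrite ?normr0; lra.
have Bp : ~ B (0, d) by move=> Bd; apply: U0; apply: (mono 0 0 d) => //; rewrite ?normr0; lra.
have cs t : continuous (fun s => (s, t) : pt) by cont.
have sec (W : set pt) s t : nbhs (s, t) W -> exists2 r, 0 < r & forall s', `|s' - s| < r -> W (s', t).
  move=> /(cs t s); rewrite /nbhs /= => -[r /= r0 hr]; exists r => // s' h.
  by apply: hr; rewrite /ball /= distrC.
have [r1 r10 h1] := sec _ _ _ (open_nbhs_nbhs (conj oU Um)).
have [r2 r20 h2] := sec _ _ _ (open_nbhs_nbhs (conj (closed_openC cB) Bp)).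
(* Over abscissas below [r] the lower edge of the box lies in [U] and the upper edge off [B], so the
   graph leaves through neither. *)
have [r [r0 rd rr1 rr2]] : exists r, [/\ 0 < r, r <= d, r <= r1 & r <= r2].
  have [r [r0 rr1 rr2]] := exists_le2 r10 r20; have [r' [r'0 r'd r'r]] := exists_le2 d0 r0.
  by exists r'; split => //; exact: le_trans r'r _.
have bot s : `|s| < r -> U (s, - d) by move=> sr; apply: h1; rewrite subr0; lra.
have top s : `|s| < r -> ~ B (s, d) by move=> sr; apply: h2; rewrite subr0; lra.
have : forall s, exists t, `|s| < r -> [/\ - d <= t <= d, B (s, t) &
    forall t', t < t' <= d -> ~ B (s, t')].
  move=> s; have [sr|nsr] := pselect (`|s| < r); last by exists 0.
  pose Z := `[- d, d] `&` (fun t => (s, t) : pt) @^-1` B.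
  have cZ : compact Z.
    apply: compact_closedI; first exact: segment_compact.
    by apply: closed_comp => // x _; apply: cont_pair; [exact: contC|exact: cont_id].
  have Zm : Z (- d).
    by split; [rewrite /= in_itv /=; lra|apply: UB; exact: bot].
  have [||t] := @compact_EVT_max _ R (fun x : R => x) Z _ cZ.
  - by exists (- d).
  - by apply: continuous_subspaceT; exact: cont_id.
  rewrite inE => -[/=]; rewrite in_itv /= => td Bt tmax; exists t => _; split => //.
  move=> t' tt' Bt'; have := tmax t'; rewrite inE => H.
  have : t' <= t by apply: H; split => //=; rewrite in_itv /=; lra.
  lra.
move=> /choice[f0 hf0].
have spec s t : `|s| < r -> `|t| <= d -> (B (s, t) <-> t <= f0 s) /\ (U (s, t) <-> t < f0 s).
  move=> sr; rewrite ler_norml => td; have [fd Bf nB] := hf0 s sr.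
  have BE : B (s, t) -> t <= f0 s.
    by move=> Bt; rewrite leNgt; apply/negP => h; apply: (nB t) => //; lra.
  have UE : t < f0 s -> U (s, t) by move=> h; apply: (mono s t (f0 s)) => //; clear - sr rd td fd; lra.
  split; split => //.
  - by rewrite le_eqVlt => /orP[/eqP->//|/UE/UB].
  - move=> Ut; have := BE (UB _ Ut); rewrite le_eqVlt => /orP[/eqP E|//]; exfalso.
    have td' : t < d.
      rewrite lt_neqAle; apply/andP; split; last lra.
      by apply/eqP => E'; apply: (top s) => //; rewrite -E'; exact: UB.
    have ct : continuous (fun x => (s, x) : pt) by cont.
    have := open_nbhs_nbhs (conj oU Ut) => /(ct t); rewrite /nbhs /= => -[k /= k0 hk].
    have [m [m0 m1 m2]] : exists m, [/\ 0 < m, m <= k / 2 & m <= (d - t) / 2].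
      by apply: exists_le2; rewrite ?divr_gt0// subr_gt0.
    have : ball t k (t + m).
      by rewrite /ball /= opprD addNKr normrN gtr0_norm//; clear - k0 m1; lra.
    by move=> /hk/UB; apply: nB; clear - E m0 m2 td'; lra.
have f0c s : `|s| < r -> {for s, continuous f0}.
  move=> sr; apply/cvgrPdist_lt => k k0.
  have [fd Bf nB] := hf0 s sr.
  have near_r : \forall s' \near s, `|s'| < r.
    exists (r - `|s|) => /=; first lra.
    by move=> s' /=; have := ler_normD s (s' - s); rewrite (addrC s) subrK (distrC s'); lra.
  have fl : \forall s' \near s, f0 s - k < f0 s'.
    have [h|h] := leP (- d) (f0 s - k).
      have tk : `|f0 s - k| <= d by rewrite ler_norml; lra.
      have Us : U (s, f0 s - k) by apply/(spec s _ sr tk).2; lra.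
      have [q q0 hq] := sec _ _ _ (open_nbhs_nbhs (conj oU Us)).
      have nq : \forall s' \near s, U (s', f0 s - k).
        by exists q => //= s' h'; apply: hq; rewrite distrC.
      by move: near_r nq; apply: filterS2 => s' sr' Us'; apply/(spec s' _ sr' tk).2.
    move: near_r; apply: filterS => s' sr'; have [fd' _ _] := hf0 s' sr'; lra.
  have fu : \forall s' \near s, f0 s' < f0 s + k.
    have [h|h] := leP (f0 s + k) d.
      have tk : `|f0 s + k| <= d by rewrite ler_norml; lra.
      have Bs : (~` B) (s, f0 s + k) by move/(spec s _ sr tk).1; lra.
      have [q q0 hq] := sec _ _ _ (open_nbhs_nbhs (conj (closed_openC cB) Bs)).
      have nq : \forall s' \near s, (~` B) (s', f0 s + k).
        by exists q => //= s' h'; apply: hq; rewrite distrC.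
      move: near_r nq; apply: filterS2 => s' sr' Bs'.
      by rewrite ltNge; apply/negP => /(spec s' _ sr' tk).1.
    move: near_r; apply: filterS => s' sr'; have [fd' _ _] := hf0 s' sr'; lra.
  by move: fl fu; apply: filterS2 => s' h h'; rewrite ltr_norml; lra.
(* Clamping the abscissa extends the function continuously to the whole line. *)
exists (r / 2), (fun s => f0 (clamp (- (r / 2)) (r / 2) s)).
have rr : - (r / 2) <= r / 2 by lra.
have cl s : `|s| <= r / 2 -> clamp (- (r / 2)) (r / 2) s = s by rewrite ler_norml => h; rewrite clamp_id.
have cr s : `|clamp (- (r / 2)) (r / 2) s| < r by have := clamp_itv s rr; rewrite ltr_norml; lra.
split.
- lra.
- move=> s; apply: (@continuous_comp _ _ _ (clamp _ _) f0); first exact: cont_clamp.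
  exact: f0c.
- rewrite cl ?normr0; last lra.
  have n0 : `|0 : R| < r by rewrite normr0.
  have n0' : `|0 : R| <= d by rewrite normr0; lra.
  have [[/(_ B0) H _] [_ H']] := spec 0 0 n0 n0'.
  apply/eqP; rewrite eq_le H andbT leNgt; apply/negP => /H'; exact: U0.
- move=> s sr; rewrite cl//; have sr' : `|s| < r by lra.
  have [fd Bf nB] := hf0 s sr'.
  have d1 : `|- d| <= d by rewrite normrN gtr0_norm.
  have := (spec s _ sr' d1).2.1 (bot s sr') => ->/=.
  rewrite lt_neqAle; apply/andP; split; last lra.
  by apply/eqP => E; apply: (top s sr'); rewrite -E.
- by move=> s t sr td; rewrite cl//; apply: spec => //; lra.
Qed.

End Graph.

(** * Rotated coordinates *)

Section Frame.
Variable R : realType.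
Local Notation pt := (R * R)%type.
Implicit Types (p q x y z u a : pt) (s t : R).

(** Coordinates around [p] with the second axis along [u] and the first along [u] turned by a right
    angle; [lcoord] is the inverse when [u] is a unit vector. *)
Definition frame p u x : pt := (p.1 - x.1 * u.2 + x.2 * u.1, p.2 + x.1 * u.1 + x.2 * u.2).

Definition lcoord p u x : pt :=
  (u.1 * (x.2 - p.2) - u.2 * (x.1 - p.1), u.1 * (x.1 - p.1) + u.2 * (x.2 - p.2)).

Lemma cont_frame p u : continuous (frame p u).
Proof. by rewrite /frame; cont. Qed.

Lemma cont_lcoord p u : continuous (lcoord p u).
Proof. by rewrite /lcoord; cont. Qed.

Lemma frame0 p u : frame p u (0, 0) = p.
Proof. by rewrite /frame /= !mul0r subr0 !addr0 -surjective_pairing. Qed.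

Lemma lcoord0 p u : lcoord p u p = (0, 0).
Proof. by rewrite /lcoord !subrr !mulr0 subrr addr0. Qed.

Section Unit.
Variables (p u : pt).
Hypothesis u1 : dotp u u = 1.

Let u1' : u.1 * u.1 + u.2 * u.2 = 1. Proof. exact: u1. Qed.

Lemma frameK x : lcoord p u (frame p u x) = x.
Proof.
rewrite [RHS]surjective_pairing /lcoord /frame /=; congr (_, _).
  by rewrite -[RHS]mulr1 -[in RHS]u1'; ring.
by rewrite -[RHS]mulr1 -[in RHS]u1'; ring.
Qed.

Lemma lcoordK x : frame p u (lcoord p u x) = x.
Proof.
rewrite [RHS]surjective_pairing /lcoord /frame /=; congr (_, _).
  rewrite (_ : _ + _ = p.1 + (x.1 - p.1) * (u.1 * u.1 + u.2 * u.2)); last by ring.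
  by rewrite u1' mulr1; ring.
rewrite (_ : _ + _ = p.2 + (x.2 - p.2) * (u.1 * u.1 + u.2 * u.2)); last by ring.
by rewrite u1' mulr1; ring.
Qed.

Lemma sqd_frame x y : sqd (frame p u x) (frame p u y) = sqd x y.
Proof.
rewrite -[RHS]mulr1 -[in RHS]u1' /sqd /frame /=; ring.
Qed.

Lemma sqd_lcoord x a : sqd (frame p u x) a = sqd x (lcoord p u a).
Proof. by rewrite -[in LHS](lcoordK a) sqd_frame. Qed.

Lemma sqd_lcoord_p a : sqd a p = (lcoord p u a).1 ^+ 2 + (lcoord p u a).2 ^+ 2.
Proof. by rewrite sqdC -[in LHS](frame0 p u) sqd_lcoord /sqd /= !sub0r !sqrrN. Qed.

Lemma frame_inj x y : frame p u x = frame p u y -> x = y.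
Proof. by move=> h; rewrite -(frameK x) h frameK. Qed.

Lemma rho_frame_le (d : R) x : 0 <= d -> `|x.1| <= d -> `|x.2| <= d -> rho (frame p u x) p <= 2 * d.
Proof.
move=> d0; rewrite !ler_norml => x1 x2; rewrite rho_le ?mulr_ge0// sqd_lcoord_p frameK; nra.
Qed.

Definition box (d d' : R) : set pt := [set x | `|(lcoord p u x).1| < d /\ `|(lcoord p u x).2| < d'].

Lemma open_box d d' : open (box d d').
Proof.
rewrite (_ : box d d' = [set x | `|(lcoord p u x).1| < d] `&` [set x | `|(lcoord p u x).2| < d']) //.
have cc := @cont_lcoord p u.
by apply: openI; apply: open_ltf; cont.
Qed.

Lemma box_p d d' : 0 < d -> 0 < d' -> box d d' p.
Proof. by move=> d0 d0'; split; rewrite lcoord0 /= normr0. Qed.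

End Unit.
End Frame.


Section LocalTools.
Variable R : realType.
Local Notation pt := (R * R)%type.
Implicit Types (p q x y z u a : pt) (s t r : R) (X : set pt).

Lemma chart_of_path (C W : set pt) (f : R -> pt) (d : R) : continuous f -> 0 < d -> open W ->
  (forall r s, `|r| <= d -> `|s| <= d -> f r = f s -> r = s) ->
  (forall r, `|r| <= d -> C (f r)) -> (forall r, `|r| < d -> W (f r)) ->
  (forall y, W y -> C y -> exists2 r, `|r| < d & f r = y) ->
  exists g t, [/\ chart C g, 0 < t < 1 & g t = f 0].
Proof.
move=> cf d0 oW fi fC fW WC.
exists (fun w => f ((2 * w - 1) * d)), 2^-1; split; [|lra|by congr f; lra].
have ab w : 0 <= w <= 1 -> `|(2 * w - 1) * d| <= d by move=> w01; rewrite ler_norml; nra.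
split.
- split; first by apply: (cont_comp (f := fun w => _) cf); cont.
  move=> s t s01 t01 /fi H.
  have : (2 * s - 1) * d = (2 * t - 1) * d by apply: H; exact: ab.
  by move/(mulIf (lt0r_neq0 d0)); lra.
- by move=> _ [w w01 <-]; apply: fC; exact: ab.
move=> w w01.
have : nbhs (f ((2 * w - 1) * d)) W.
  by apply: open_nbhs_nbhs; split => //; apply: fW; rewrite ltr_norml; nra.
apply: filterS => y Wy Cy; have [r] := WC y Wy Cy; rewrite ltr_norml => rd <-.
exists ((r / d + 1) / 2).
  have : - 1 < r / d < 1 by rewrite ltr_pdivlMr// ltr_pdivrMr//; lra.
  lra.
congr f; rewrite (_ : 2 * _ - 1 = r / d); last lra.
by rewrite mulfVK// gt_eqF.
Qed.

Lemma nbhs_frame p u s t (W : set pt) : nbhs (frame p u (s, t)) W ->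
  exists2 k, 0 < k & forall h, `|h| < k -> W (frame p u (s, t + h)).
Proof.
move=> /(@cont_frame R p u (s, t))/nbhs_boxP[k k0 hk]; exists k => // h hk'.
by apply: (hk (s, t + h)); rewrite /= ?subrr ?normr0// addrAC subrr add0r.
Qed.

Lemma compact_gap X p (e : R) : compact X -> (forall a, X a -> e < rho a p) ->
  exists2 e1, e < e1 & forall a, X a -> e1 <= rho a p.
Proof.
move=> cX h; have [->|/set0P X0] := eqVneq X set0; first by exists (e + 1) => //; lra.
have [a Xa ha] := nearestP p cX X0; exists (rho a p); first exact: h.
by move=> b Xb; rewrite rhoC (rhoC b); exact: ha.
Qed.

Lemma compact_neg X (f : pt -> R) : compact X -> continuous f -> (forall a, X a -> f a < 0) ->
  exists2 c, 0 < c & forall a, X a -> f a <= - c.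
Proof.
move=> cX cf h; have [->|/set0P X0] := eqVneq X set0; first by exists 1.
have [|a] := @compact_EVT_max _ R f _ X0 cX; first exact: continuous_subspaceT.
rewrite inE => Xa ha; exists (- f a); first by rewrite oppr_gt0; exact: h.
by move=> b Xb; rewrite opprK; apply: ha; rewrite inE.
Qed.

(** All centres that matter lie below the box, so moving down inside it brings a point strictly
    closer to each of them; this is the monotonicity that yields a graph. *)
Lemma cone_graph (K : set pt) (e d : R) p u : 0 < e -> dotp u u = 1 -> 0 < d -> compact K ->
  (forall a x, K a -> `|x.1| <= d -> `|x.2| <= d -> sqd (frame p u x) a <= e ^+ 2 ->
     (lcoord p u a).2 <= - d) ->
  cnbhd e K p -> ~ onbhd e K p ->
  exists sg f, [/\ 0 < sg <= d, continuous f, f 0 = 0,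
    forall s, `|s| <= sg -> - d < f s < d &
    forall s t, `|s| <= sg -> `|t| <= d -> (cnbhd e K (frame p u (s, t)) <-> t <= f s) /\
      (onbhd e K (frame p u (s, t)) <-> t < f s)].
Proof.
move=> e0 u1 d0 cK cone Bp Up.
have cF := @cont_frame R p u.
apply: (@graph_of_monotone R (frame p u @^-1` cnbhd e K) (frame p u @^-1` onbhd e K) d) => //.
- by apply: closed_comp => [x _|]; [exact: cF|exact: closed_cnbhd (ltW e0) cK].
- by apply: open_comp => [x _|]; [exact: cF|exact: open_onbhd].
- by move=> x; exact: onbhd_sub.
- move=> s t t' sd td tt' t'd [a Ka h]; exists a => //.
  have t'd' : `|t'| <= d by rewrite ler_norml; lra.
  have at0 := cone a (s, t') Ka sd t'd' h.
  by move: h; rewrite !sqd_lcoord// /sqd; move: at0; set b := lcoord p u a => /=; nra.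
- by rewrite /preimage /= frame0.
- by rewrite /preimage /= frame0.
Qed.

End LocalTools.

(** * Regular frontier points and limit directions *)

Section Local.
Variables (R : realType) (e : R) (K : set (R * R)).
Local Notation pt := (R * R)%type.
Implicit Types (p q x y z u a b : pt) (s t r d : R) (X : set pt).
Hypothesis e0 : 0 < e.
Hypothesis cK : compact K.

Lemma regular_graph p u : dotp u u = 1 -> cnbhd e K p -> ~ onbhd e K p ->
  (forall a, K a -> sqd a p <= e ^+ 2 -> (lcoord p u a).2 < 0) ->
  exists d sg f, [/\ 0 < sg <= d, continuous f, f 0 = 0,
    forall s, `|s| <= sg -> - d < f s < d &
    forall s t, `|s| <= sg -> `|t| <= d -> (cnbhd e K (frame p u (s, t)) <-> t <= f s) /\
      (onbhd e K (frame p u (s, t)) <-> t < f s)].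
Proof.
move=> u1 Bp Up neg.
have cc : continuous (fun a => (lcoord p u a).2) by apply: cont_snd; exact: cont_lcoord.
have cs : continuous (fun a => sqd a p) by apply: cont_sqd; [exact: cont_id|exact: contC].
have [c c0 hc] : exists2 c, 0 < c & forall a, K a -> sqd a p <= e ^+ 2 -> (lcoord p u a).2 <= - c.
  have cN : compact (K `&` [set a | sqd a p <= e ^+ 2]).
    by apply: compact_closedI => //; apply: closed_lef => //; exact: contC.
  have [|c c0 hc] := compact_neg cN cc; first by move=> a [Ka h]; exact: neg.
  by exists c => // a Ka h; exact: hc.
have [e1 ee1 he1] : exists2 e1, e < e1 &
    forall a, (K `&` [set a | - (c / 2) <= (lcoord p u a).2]) a -> e1 <= rho a p.
  apply: compact_gap.
    by apply: compact_closedI => //; apply: closed_lef => //; exact: contC.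
  move=> a [Ka h]; change (is_true (- (c / 2) <= (lcoord p u a).2)) in h.
  rewrite ltNge; apply/negP; rewrite rho_le ?(ltW e0)// => h'.
  by have := hc a Ka h'; lra.
(* A point of the box is at distance at most [2 * d] from [p], so a centre within [e] of it is at
   most [e + 2 * d < e1] away from [p]; hence the third. *)
have [d [d0 d1 d2]] : exists d, [/\ 0 < d, d <= c / 2 & d <= (e1 - e) / 3].
  by apply: exists_le2; rewrite divr_gt0// subr_gt0.
exists d; apply: cone_graph => // a x Ka x1 x2 xa.
rewrite leNgt; apply/negP => h.
have := he1 a; have := rho_triangle a (frame p u x) p.
have := rho_frame_le p u1 (ltW d0) x1 x2.
have : rho a (frame p u x) <= e by rewrite rhoC rho_le// ltW.
move=> h1 h2 h3 h4; have : e1 <= rho a p by apply: h4; split => //; change (is_true (- (c / 2) <= (lcoord p u a).2)); lra.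
lra.
Qed.

Lemma seg_frame p u x y t : seg (frame p u x) (frame p u y) t = frame p u (seg x y t).
Proof. by rewrite /seg /frame /=; congr (_, _); ring. Qed.

(** Up to the top edge of the box, along it, and down again. *)
Lemma regular_component p u d sg (f : R -> R) : dotp u u = 1 -> 0 < sg <= d ->
  (forall s, `|s| <= sg -> - d < f s < d) ->
  (forall s t, `|s| <= sg -> `|t| <= d -> (cnbhd e K (frame p u (s, t)) <-> t <= f s) /\
      (onbhd e K (frame p u (s, t)) <-> t < f s)) ->
  forall s t s' t', `|s| <= sg -> `|s'| <= sg -> f s < t <= d -> f s' < t' <= d ->
  connected_component (~` cnbhd e K) (frame p u (s, t)) (frame p u (s', t')).
Proof.
move=> u1 sgd fd hf s t s' t' sr sr' st st'.
have out v w : `|v| <= sg -> f v < w <= d -> (~` cnbhd e K) (frame p u (v, w)).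
  move=> vs vw; have := fd v vs => fv.
  have wd : `|w| <= d by rewrite ler_norml; lra.
  by move/(hf v w vs wd).1; lra.
have up v w : `|v| <= sg -> f v < w <= d ->
    connected_component (~` cnbhd e K) (frame p u (v, w)) (frame p u (v, d)).
  move=> vs vw; apply: seg_component => k k01; rewrite seg_frame /seg /= subrr mulr0 addr0.
  by apply: out => //; nra.
apply: connected_component_trans (up s t sr st) _.
apply: (connected_component_trans (y := frame p u (s', d))); last first.
  by apply: connected_component_sym; exact: up.
apply: seg_component => k k01; rewrite seg_frame /seg /= subrr mulr0 addr0.
have h : `|s + k * (s' - s)| <= sg by move: sr sr'; rewrite !ler_norml; nra.
by apply: out => //; have := fd _ h; lra.
Qed.

Variable D : set pt.
Hypothesis cD : is_component (~` cnbhd e K) D.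

Lemma regular_chart p u : dotp u u = 1 -> closure D p -> ~ D p ->
  (forall a, K a -> sqd a p <= e ^+ 2 -> (lcoord p u a).2 < 0) ->
  exists g t, [/\ chart (closure D `\` D) g, 0 < t < 1 & g t = p].
Proof.
move=> u1 clp Dp neg.
have [Bp Up] := closure_component e0 cK cD clp Dp.
have [d [sg [f [sgd cf f0 fd hf]]]] := regular_graph u1 Bp Up neg.
have comp := regular_component u1 sgd fd hf.
have oB : nbhs p (box p u sg d) by apply: open_nbhs_nbhs; split; [exact: open_box|apply: box_p; lra].
have [x [Dx [x1 x2]]] := clp _ oB.
have above s t : `|s| <= sg -> f s < t <= d -> D (frame p u (s, t)).
  move=> sr st; apply: (component_in cD Dx); rewrite -(lcoordK p u1 x) [lcoord p u x]surjective_pairing.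
  move: x2; rewrite ltr_norml => x2.
  apply: comp => //; first exact: ltW.
  have := is_component_sub cD Dx; rewrite -{1}(lcoordK p u1 x) [lcoord p u x]surjective_pairing => nB.
  apply/andP; split; last lra.
  rewrite ltNge; apply/negP => h; apply: nB; apply/(hf _ _ (ltW x1) _).1 => //.
  by rewrite ler_norml; lra.
pose g r := frame p u (r, f r).
have cg : continuous g by apply: (cont_compP (@cont_frame R p u)); cont.
have gC r : `|r| <= sg -> (closure D `\` D) (g r).
  move=> rs; have fr := fd r rs; have frd : `|f r| <= d by rewrite ler_norml; lra.
  split; last first.
    by apply: (cnbhd_notin cD); apply/(hf r (f r) rs frd).1.
  move=> W /nbhs_frame[k k0 hk].
  have [m [m0 m1 m2]] : exists m, [/\ 0 < m, m <= k / 2 & m <= d - f r].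
    by apply: exists_le2; rewrite ?divr_gt0// subr_gt0; case/andP: fr.
  exists (frame p u (r, f r + m)); split; first by apply: above => //; lra.
  by apply: hk; rewrite ger0_norm ?(ltW m0)//; lra.
have g0 : g 0 = p by rewrite /g f0 frame0.
rewrite -g0; apply: (@chart_of_path R _ (box p u sg d) g sg cg) => //.
- lra.
- exact: open_box.
- by move=> r s _ _ /(frame_inj u1)[].
- move=> r rs; split; rewrite frameK//=.
  by have := fd r (ltW rs); rewrite ltr_norml; lra.
move=> y [y1 y2] [cly Dy]; exists (lcoord p u y).1 => //.
have [By Uy] := closure_component e0 cK cD cly Dy.
rewrite -[RHS](lcoordK p u1 y) /g [in RHS](surjective_pairing (lcoord p u y)); congr (frame p u (_, _)).
have [h1 h2] := hf (lcoord p u y).1 (lcoord p u y).2 (ltW y1) (ltW y2).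
rewrite -surjective_pairing lcoordK// in h1 h2.
apply/eqP; rewrite eq_le; apply/andP; split; last exact/h1.
by rewrite leNgt; apply/negP => /h2.
Qed.

(** [w] is a limit of directions from [p] to points of [D] tending to [p]. These points are farther
    than [e] from [a] while [p] is not, so to first order they cannot lie towards [a]. *)
Lemma limit_direction p : closure D p -> ~ D p -> exists w,
  [/\ dotp w w = 1,
      forall r, 0 < r -> exists x, [/\ D x, rho x p < r & 0 < dotp w (x.1 - p.1, x.2 - p.2)] &
      forall a, K a -> sqd a p <= e ^+ 2 -> dotp w (a.1 - p.1, a.2 - p.2) <= 0].
Proof.
move=> clp Dp.
pose dir x : pt := ((x.1 - p.1) / rho x p, (x.2 - p.2) / rho x p).
have pos x : D x -> 0 < rho x p.
  move=> Dx; rewrite lt_def rho_ge0 andbT; apply/eqP => E; apply: Dp.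
  have e1 := normr_le_rho1 x p; have e2 := normr_le_rho2 x p.
  rewrite E normr_le0 subr_eq0 in e1; rewrite E normr_le0 subr_eq0 in e2.
  by rewrite [p]surjective_pairing -(eqP e1) -(eqP e2) -surjective_pairing.
have dircirc x : D x -> circle (dir x).
  move=> /pos x0; rewrite /circle /dir /= !expr_div_n -mulrDl rho_sqr /sqd divff//.
  by rewrite -/(sqd x p) -rho_sqr gt_eqF// exprn_gt0.
have [w [Cw Lw]] : exists w, circle w /\
    forall r, 0 < r -> exists x, [/\ D x, rho x p < r & rho (dir x) w < r].
  apply: contrapT => nw.
  (* If no direction were a limit, compactness of the circle would give one radius below which all
     directions are avoided. *)
  have [r r0 hr] : exists2 r, 0 < r & forall x, D x -> rho x p < r -> ~ circle (dir x).
    have /(_ _ (0^'+) (fun r w => forall x, D x -> rho x p < r -> dir x <> w)) cov :=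
      (compact_near_coveringP (@circle R)).1 (@compact_circle R).
    have : \forall r \near 0^'+, @circle R `<=` [set w | forall x, D x -> rho x p < r -> dir x <> w].
      apply: cov => w Cw.
      have [r [r0 hr]] : exists r, 0 < r /\ forall x, D x -> rho x p < r -> r <= rho (dir x) w.
        apply: contrapT => nr; apply: nw; exists w; split => // r r0.
        apply: contrapT => nx; apply: nr; exists r; split => // x Dx xp.
        by rewrite leNgt; apply/negP => h; apply: nx; exists x.
      exists ([set w' | rho w' w < r], [set i | i < r]).
        split => /=; last exact: nbhs_right_lt.
        apply: open_nbhs_nbhs; split; last by rewrite /= rhoE /sqd !subrr expr0n /= addr0 sqrtr0.
        by apply: open_ltf; [apply: cont_rho; [exact: cont_id|exact: contC]|exact: contC].
      move=> [w' i] /= [w'w ir] x Dx xi E; have := hr x Dx (lt_trans xi ir).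
      by rewrite E leNgt w'w.
    move=> H; have [r [hr r0]] := @filter_ex _ (0^'+) _ _ (filterI H (nbhs_right_gt (0 : R))).
    by exists r => // x Dx xr Cx; apply: (hr _ Cx x Dx xr).
  have /closureP_sqd/(_ (r ^+ 2))[|x Dx xp] := clp; first by rewrite exprn_gt0.
  by apply: (hr x Dx); [rewrite rho_lt// ltW|exact: dircirc].
have w1 : w.1 * w.1 + w.2 * w.2 = 1 by move: Cw; rewrite /circle /= !expr2.
have dirE x (v : pt) : D x -> dotp v (dir x) * rho x p = dotp v (x.1 - p.1, x.2 - p.2).
  move=> /pos x0; rewrite /dotp /dir /= mulrDl -!mulrA !mulVf ?gt_eqF// !mulr1//.
exists w; split => //.
  move=> r r0; have [|x [Dx xp xw]] := Lw (Num.min r 1); first by rewrite lt_min r0 ltr01.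
  exists x; move: xp xw; rewrite !lt_min => /andP[xp _] /andP[_ xw]; split => //.
  rewrite -dirE// mulr_gt0 ?pos//.
  move: xw; rewrite rho_lt// expr1n; have := dircirc x Dx; rewrite /circle /= /sqd /dotp.
  nra.
move=> a Ka ap; rewrite leNgt; apply/negP => b0.
set b := dotp _ _ in b0.
(* For this radius [r], Cauchy-Schwarz costs at most [r * e] and the quadratic term less than
   [r / 2], together less than [b = r * (e + 1)]. *)
have [|x [Dx xp xw]] := Lw (b / (e + 1)); first by rewrite divr_gt0// addr_gt0.
set r := b / (e + 1) in xp xw.
have rE : b = r * (e + 1) by rewrite /r mulfVK// gt_eqF// addr_gt0.
have nB := is_component_sub cD Dx.
have xa : e ^+ 2 < sqd x a by rewrite ltNge; apply/negP => h; apply: nB; exists a.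
have x0 := pos x Dx.
have d1 : dotp (a.1 - p.1, a.2 - p.2) (dir x) * rho x p < rho x p ^+ 2 / 2.
  by rewrite dirE// rho_sqr; move: xa ap; rewrite /sqd /dotp /=; nra.
have d2 : dotp (a.1 - p.1, a.2 - p.2) (dir x) < rho x p / 2.
  by rewrite -(ltr_pM2r x0); move: d1; rewrite expr2; nra.
have d3 : b - dotp (a.1 - p.1, a.2 - p.2) (dir x) <= r * e.
  have r0 : 0 <= r by apply: le_trans (ltW xw); exact: rho_ge0.
  rewrite (_ : b - _ = dotp (w.1 - (dir x).1, w.2 - (dir x).2) (a.1 - p.1, a.2 - p.2)); last first.
    by rewrite /b /dotp /=; ring.
  apply: le_trans (ler_norm _) _.
  have re0 : 0 <= r * e := mulr_ge0 r0 (ltW e0).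
  rewrite -(@ler_sqr _ `|_| (r * e)) ?nnegrE ?normr_ge0//.
  rewrite real_normK ?num_real//.
  apply: (@le_trans _ _ (sqd (dir x) w * sqd a p)).
    rewrite -subr_ge0 (_ : _ - _ = ((w.1 - (dir x).1) * (a.2 - p.2) - (w.2 - (dir x).2) * (a.1 - p.1)) ^+ 2).
      exact: sqr_ge0.
    by rewrite /sqd /dotp /=; ring.
  by rewrite exprMn ler_pM ?sqd_ge0// -rho_le// ltW.
lra.
Qed.

End Local.


(** Outside both discs tangent at the origin [|t| * e < s ^+ 2], so the sideways term [2 * (t * y)]
    is beaten by [s ^+ 2]; moving right only increases the distance to a centre behind. Such a
    centre does not reach into the cusp. *)
Lemma cusp_estimate (R : realType) (e s t x y : R) : 0 < e -> 0 < s -> `|t| <= e / 2 ->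
  e ^+ 2 < s ^+ 2 + (t - - e) ^+ 2 -> e ^+ 2 < s ^+ 2 + (t - e) ^+ 2 ->
  x < - (e / 2) -> - (e / 2) < y -> y < e / 2 -> e ^+ 2 <= x ^+ 2 + y ^+ 2 ->
  e ^+ 2 < (s - x) ^+ 2 + (t - y) ^+ 2.
Proof.
move=> e0 s0 td h1 h2 xe ye ye' xy.
have te : `|t| * e < s ^+ 2.
  by move: td; case: (ger0P t) => t0 td; nra.
have ty : 2 * (t * y) <= `|t| * e.
  by case: (ger0P t) => t0; nra.
have sx : s * e < - 2 * (s * x) by nra.
have se : 0 < s * e by rewrite mulr_gt0.
have := sqr_ge0 t; nra.
Qed.

(** * The cusp between two tangent discs *)

Section Cusp.
Variables (R : realType) (e : R) (K : set (R * R)).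
Local Notation pt := (R * R)%type.
Implicit Types (p q x y z u a b : pt) (s t r d : R) (X : set pt).
Hypothesis e0 : 0 < e.
Hypothesis cK : compact K.

Lemma frame_opp p u x : frame p (- u.1, - u.2) x = frame p u (- x.1, - x.2).
Proof. by rewrite /frame /=; congr (_, _); ring. Qed.

Lemma lcoord_opp p u a : lcoord p (- u.1, - u.2) a = (- (lcoord p u a).1, - (lcoord p u a).2).
Proof. by rewrite /lcoord /=; congr (_, _); ring. Qed.

Lemma lcoord_normal p u (c : R) : dotp u u = 1 ->
  lcoord p u (p.1 + c * u.1, p.2 + c * u.2) = (0, c).
Proof.
move=> u1; have u1' : u.1 * u.1 + u.2 * u.2 = 1 by [].
rewrite /lcoord /=; congr (_, _); first by ring.
rewrite (_ : _ + _ = c * (u.1 * u.1 + u.2 * u.2)); last by ring.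
by rewrite u1' mulr1.
Qed.

Lemma cnbhd_mono X : X `<=` K -> cnbhd e X `<=` cnbhd e K.
Proof. by move=> XK x [a /XK Ka h]; exists a. Qed.

Lemma onbhd_mono X : X `<=` K -> onbhd e X `<=` onbhd e K.
Proof. by move=> XK x [a /XK Ka h]; exists a. Qed.

(* The two graphs bounding the cusp at [p] between the discs around [p + e u] and [p - e u]. *)
Lemma cusp_graphs p u (k : R) : dotp u u = 1 -> 0 < k ->
  K (p.1 + e * u.1, p.2 + e * u.2) -> K (p.1 + - e * u.1, p.2 + - e * u.2) -> ~ onbhd e K p ->
  (forall a, K a -> sqd a p <= e ^+ 2 -> (lcoord p u a).1 <= 0) ->
  exists d sg f g, [/\ 0 < sg <= d, d <= k, d <= e / 2 & [/\ continuous f, continuous g,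
    f 0 = 0, g 0 = 0 &
    [/\ forall s, `|s| <= sg -> - d < f s < d,
      forall s, `|s| <= sg -> - d < g s < d,
      forall s t, 0 < s <= sg -> `|t| <= d ->
        (cnbhd e K (frame p u (s, t)) <-> t <= f s \/ g s <= t) &
      forall s t, 0 < s <= sg -> `|t| <= d -> t < f s \/ g s < t -> onbhd e K (frame p u (s, t))]]].
Proof.
move=> u1 k0 Ka Kb Up neg.
have cc := @cont_lcoord R p u.
have c2 : continuous (fun a => (lcoord p u a).2) by exact: cont_snd.
have c1 : continuous (fun a => (lcoord p u a).1) by exact: cont_fst.
(* Centres above, centres below, and those in between that are not far behind. The last stay clear
   of [p]; centres in between but far behind are left to [cusp_estimate]. *)
pose Kp := K `&` [set a | e / 2 <= (lcoord p u a).2].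
pose Km := K `&` [set a | (lcoord p u a).2 <= - (e / 2)].
pose K0 := K `&` [set a | - (e / 2) <= (lcoord p u a).1] `&`
  [set a | - (e / 2) <= (lcoord p u a).2] `&` [set a | (lcoord p u a).2 <= e / 2].
have cKp : compact Kp by apply: compact_closedI => //; apply: closed_lef => //; exact: contC.
have cKm : compact Km by apply: compact_closedI => //; apply: closed_lef => //; exact: contC.
have cK0 : compact K0.
  by do 3! (apply: compact_closedI; last by apply: closed_lef => //; exact: contC).
have far a : K a -> e ^+ 2 <= sqd a p.
  by move=> Ka'; rewrite leNgt; apply/negP => h; apply: Up; exists a => //; rewrite sqdC.
have [e1 ee1 he1] : exists2 e1, e < e1 & forall a, K0 a -> e1 <= rho a p.
  apply: compact_gap => // a [[[Ka' h1] h2] h3].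
  rewrite ltNge rho_le ?(ltW e0)//; apply/negP => h.
  have := neg a Ka' h; have := far a Ka'; move: h1 h2 h3; rewrite /mkset (sqd_lcoord_p p u1).
  set c := lcoord p u a => h1 h2 h3 h4 h5.
  have half (v : R) : - (e / 2) <= v -> v <= e / 2 -> v ^+ 2 <= (e / 2) ^+ 2.
    by move=> v1 v2; have : 0 <= (e / 2 - v) * (e / 2 + v) by [apply: mulr_ge0; lra]; nra.
  have q1 := half c.1 h1 ltac:(lra); have q2 := half c.2 h2 h3.
  have : 0 < e ^+ 2 by rewrite exprn_gt0.
  by move: h4 q1 q2; rewrite !expr_div_n; lra.
have [d [d0 d1 d2 d3]] : exists d, [/\ 0 < d, d <= k, d <= e / 2 & d <= (e1 - e) / 3].
  have [d [d0 d1 d2]] : exists d, [/\ 0 < d, d <= e / 2 & d <= (e1 - e) / 3].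
    by apply: exists_le2; rewrite divr_gt0// subr_gt0.
  have [d' [d'0 d'k d'd]] := exists_le2 k0 d0.
  by exists d'; split => //; exact: le_trans d'd _.
have Kpp : Kp (p.1 + e * u.1, p.2 + e * u.2).
  by split => //; rewrite /mkset lcoord_normal//=; lra.
have Kmm : Km (p.1 + - e * u.1, p.2 + - e * u.2).
  by split => //; rewrite /mkset lcoord_normal//=; lra.
have dist c x : sqd (frame p u x) (p.1 + c * u.1, p.2 + c * u.2) = x.1 ^+ 2 + (x.2 - c) ^+ 2.
  by rewrite sqd_lcoord// lcoord_normal// /sqd /= subr0.
have u1o : dotp (- u.1, - u.2) (- u.1, - u.2) = 1 by rewrite -u1 /dotp /=; ring.
have [s1 [f [s1d cf f0 fd hf]]] := @cone_graph R Km e d p u e0 u1 d0 cKm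
  ltac:(by move=> a x [_ h] _ _ _; change (is_true ((lcoord p u a).2 <= - (e / 2))) in h; lra)
  ltac:(by exists (p.1 + - e * u.1, p.2 + - e * u.2) => //; rewrite -{1}(frame0 p u) dist /=; lra)
  ltac:(by move/(onbhd_mono (@subIsetl _ _ _))).
have [s2 [g [s2d cg g0 gd hg]]] := @cone_graph R Kp e d p (- u.1, - u.2) e0 u1o d0 cKp
  ltac:(by move=> a x [_ h] _ _ _; change (is_true (e / 2 <= (lcoord p u a).2)) in h;
    rewrite lcoord_opp /=; change (is_true (- (lcoord p u a).2 <= - d)); lra)
  ltac:(by exists (p.1 + e * u.1, p.2 + e * u.2) => //; rewrite -{1}(frame0 p u) dist /=; lra)
  ltac:(by move/(onbhd_mono (@subIsetl _ _ _))).
have [s10 s1d'] := andP s1d; have [s20 s2d'] := andP s2d.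
have [sg [sg0 sg1 sg2]] := exists_le2 s10 s20.
(* The graph for [Kp] was obtained in the frame of [- u], which reverses both axes; hence the two
   signs. *)
exists d, sg, f, (fun s => - g (- s)); split => //; first lra.
have hg' s t : `|s| <= sg -> `|t| <= d -> (cnbhd e Kp (frame p u (s, t)) <-> - g (- s) <= t) /\
    (onbhd e Kp (frame p u (s, t)) <-> - g (- s) < t).
  move=> ss td; have [||h1 h2] := hg (- s) (- t); rewrite ?normrN//; first lra.
  by rewrite frame_opp /= !opprK in h1 h2; rewrite lerNl ltrNl.
split => //.
- by apply: contN; apply: (cont_comp (f := fun s => - s) cg); cont.
- by rewrite oppr0 g0 oppr0.
split.
- by move=> s ss; apply: fd; lra.
- by move=> s ss; have := gd (- s); rewrite normrN => /(_ ltac:(lra)); lra.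
- move=> s t ss td.
  have ssn : `|s| <= sg by rewrite ler_norml; lra.
  have [h1 h2] := hf s t ltac:(lra) td; have [h3 h4] := hg' s t ssn td.
  split; last first.
    by case=> [/h1|/h3]; apply: cnbhd_mono; exact: subIsetl.
  move=> [a Ka' xa]; apply: contrapT => /not_orP[n1 n2].
  have nm : ~ Km a by move=> Kma; apply: n1; apply/h1; exists a.
  have np : ~ Kp a by move=> Kpa; apply: n2; apply/h3; exists a.
  have far1 : e ^+ 2 < s ^+ 2 + (t - - e) ^+ 2.
    rewrite ltNge; apply/negP => h; apply: n1; apply/h1.
    by exists (p.1 + - e * u.1, p.2 + - e * u.2) => //; rewrite dist.
  have far2 : e ^+ 2 < s ^+ 2 + (t - e) ^+ 2.
    rewrite ltNge; apply/negP => h; apply: n2; apply/h3.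
    by exists (p.1 + e * u.1, p.2 + e * u.2) => //; rewrite dist.
  have am : - (e / 2) < (lcoord p u a).2 by rewrite ltNge; apply/negP => h; apply: nm.
  have ap : (lcoord p u a).2 < e / 2 by rewrite ltNge; apply/negP => h; apply: np.
  have sd : `|s| <= d by apply: le_trans ssn _; exact: le_trans sg1 s1d'.
  have apd : rho a p < e1.
    have := rho_triangle a (frame p u (s, t)) p.
    have := @rho_frame_le R p u u1 d (s, t) (ltW d0) sd td.
    have : rho a (frame p u (s, t)) <= e by rewrite rhoC rho_le// ltW.
    by clear - e0 cK d3 ee1; lra.
  have a1 : (lcoord p u a).1 < - (e / 2).
    rewrite ltNge; apply/negP => h; have : K0 a.
      by split; [split; [split|]|] => //; exact: ltW.
    by move/he1; rewrite leNgt apd.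
  have := far a Ka'; rewrite (sqd_lcoord_p p u1) => fa.
  have td2 : `|t| <= e / 2 := le_trans td d2.
  have s0 : 0 < s by case/andP: ss.
  move: xa; rewrite sqd_lcoord// leNgt => /negP; apply.
  exact: (cusp_estimate e0 s0 td2 far1 far2 a1 am ap fa).
- move=> s t ss td; have ssn : `|s| <= sg by rewrite ler_norml; lra.
  have [h1 h2] := hf s t ltac:(lra) td; have [h3 h4] := hg' s t ssn td.
  by case=> [/h2|/h4]; apply: onbhd_mono; exact: subIsetl.
Qed.

End Cusp.


Lemma convex_lt (R : realType) (lo hi b b' w : R) : 0 <= w <= 1 -> lo < b < hi ->
  lo < b' < hi -> lo < b + w * (b' - b) < hi.
Proof. by move=> w01 h h'; apply/andP; split; case: (lerP w 2^-1) => ?; nra. Qed.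

Lemma sqr_eq_pos (R : realType) (e z : R) : 0 < e -> - (e / 2) <= z -> z ^+ 2 = e ^+ 2 -> z = e.
Proof. by move=> e0 ze /eqP; rewrite eqf_sqr => /orP[/eqP//|/eqP ?]; lra. Qed.

Lemma le_of_sum_sqr (R : realType) (e s z : R) : 0 < e -> s ^+ 2 + z ^+ 2 = e ^+ 2 -> z <= e.
Proof. by move=> e0 h; rewrite leNgt; apply/negP => ez; have := sqr_ge0 s; nra. Qed.

(** The chart comes in along the graph of [f] and goes out along that of [g], with [|r|] as
    abscissa; as both functions vanish at [0], a single sum describes it without gluing. *)
Lemma chart_of_two_graphs (R : realType) (C : set (R * R)) (p u : R * R) (f g : R -> R) (m d : R) :
  dotp u u = 1 -> 0 < m -> continuous f -> continuous g -> f 0 = 0 -> g 0 = 0 ->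
  (forall s, `|s| <= m -> - d < f s < d) -> (forall s, `|s| <= m -> - d < g s < d) ->
  (forall s, 0 < s <= m -> f s < g s) -> C p ->
  (forall s, 0 < s <= m -> C (frame p u (s, f s))) ->
  (forall s, 0 < s <= m -> C (frame p u (s, g s))) ->
  (forall s t, `|s| < m -> `|t| < d -> C (frame p u (s, t)) ->
     (s = 0 /\ t = 0) \/ 0 < s /\ (t = f s \/ t = g s)) ->
  exists h t, [/\ chart C h, 0 < t < 1 & h t = p].
Proof.
move=> u1 m0 cf cg f0 g0 fd gd fg Cp Cf Cg onC.
have [h [ch hpos hneg]] : exists h : R -> R * R, [/\ continuous h,
    forall r, 0 <= r -> h r = frame p u (r, g r) &
    forall r, r <= 0 -> h r = frame p u (- r, f (- r))].
  exists (fun r => frame p u (`|r|, f (Num.max (- r) 0) + g (Num.max r 0))); split.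
  - apply: (cont_compP (@cont_frame R p u)); apply: cont_pair; first exact: (cont_norm (@cont_id _)).
    by apply: contD; [apply: (cont_comp (f := fun r => _) cf)|apply: (cont_comp (f := fun r => _) cg)]; cont.
  - by move=> r r0; rewrite ger0_norm// (max_l r0) max_r ?f0 ?add0r// oppr_le0.
  - by move=> r r0; rewrite ler0_norm// (max_r r0) max_l ?g0 ?addr0// oppr_ge0.
have h0 : h 0 = p by rewrite hpos// g0 frame0.
have mixed r s : 0 <= r -> s < 0 -> `|s| <= m -> h r <> h s.
  move=> r0 s0 sm; rewrite (hpos r r0) (hneg s (ltW s0)) => /(frame_inj u1)[rs E].
  have : 0 < - s <= m by rewrite oppr_gt0 s0 -(ltr0_norm s0).
  by move/fg; rewrite -E rs ltxx.
rewrite -h0; apply: (@chart_of_path R C (box p u m d) h m ch m0 (@open_box R p u m d)).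
- move=> r s rm sm E; case: (lerP 0 r) => r0; case: (lerP 0 s) => s0.
  + by move: E; rewrite !hpos// => /(frame_inj u1)[].
  + by case: (mixed _ _ r0 s0 sm).
  + by case: (mixed _ _ s0 r0 rm).
  + by move: E; rewrite !hneg ?ltW// => /(frame_inj u1)[/oppr_inj].
- move=> r rm; case: (ltgtP r 0) => [r0|r0|->]; last by rewrite h0.
  + by rewrite hneg ?(ltW r0)//; apply: Cf; rewrite oppr_gt0 r0 -(ltr0_norm r0).
  + by rewrite hpos ?(ltW r0)//; apply: Cg; rewrite r0 -(gtr0_norm r0).
- move=> r rm; have rm' : `|- r| <= m by rewrite normrN ltW.
  case: (lerP 0 r) => r0; [rewrite hpos//|rewrite hneg ?(ltW r0)//]; split; rewrite frameK//=.
  + by rewrite ltr_norml; apply: gd; exact: ltW.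
  + by rewrite normrN.
  + by rewrite ltr_norml; exact: fd.
move=> y [y1 y2]; rewrite -(lcoordK p u1 y); move: y1 y2.
case: (lcoord p u y) => a b /= am bd Cab; have [[-> ->]|[a0 [->|->]]] := onC a b am bd Cab.
- by exists 0; [rewrite normr0|rewrite h0 frame0].
- by exists (- a); rewrite ?normrN// hneg ?opprK// oppr_le0 ltW.
- by exists a => //; rewrite hpos// ltW.
Qed.

(** * Charts at all frontier points *)

Section BoundaryCharts.
Variables (R : realType) (e : R) (K D : set (R * R)).
Local Notation pt := (R * R)%type.
Implicit Types (p q x y z u a b : pt) (s t r d : R) (X : set pt).
Hypothesis e0 : 0 < e.
Hypothesis cK : compact K.
Hypothesis Kchain : forall T : pt -> pt -> Prop,
  (forall x y z, T x y -> T y z -> T x z) ->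
  (forall x y, K x -> K y -> rho x y < 2 * e -> T x y) ->
  forall x y, K x -> K y -> T x y.
Hypothesis cD : is_component (~` cnbhd e K) D.

Lemma lcoord_le_rho p u x : dotp u u = 1 ->
  `|(lcoord p u x).1| <= rho x p /\ `|(lcoord p u x).2| <= rho x p.
Proof.
move=> u1; rewrite rhoE (sqd_lcoord_p p u1) -!sqrtr_sqr.
by split; apply: ler_wsqrtr; rewrite ?lerDl ?lerDr sqr_ge0.
Qed.

Let C := closure D `\` D.

(** [no_pinch] confines [D] near [p] to one side of the line along [u], so only the cusp on that
    side matters; it remains to see that this cusp is open and filled by [D]. *)
Lemma cusp_chart p u : dotp u u = 1 -> closure D p -> ~ D p ->
  K (p.1 + e * u.1, p.2 + e * u.2) -> K (p.1 + - e * u.1, p.2 + - e * u.2) ->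
  (forall a, K a -> sqd a p <= e ^+ 2 -> (lcoord p u a).1 <= 0) ->
  (forall r, 0 < r -> exists x, [/\ D x, rho x p < r & 0 < (lcoord p u x).1]) ->
  exists g t, [/\ chart C g, 0 < t < 1 & g t = p].
Proof.
move=> u1 clp Dp Ka Kb neg acc.
have [Bp Up] := closure_component e0 cK cD clp Dp.
have [N Np sideN] : exists2 N : set pt, nbhs p N & forall x y, N x -> N y -> D x -> D y ->
    0 <= (lcoord p u x).1 * (lcoord p u y).1.
  by apply: (no_pinch e0 Kchain cD u1) => //; move: Kb; rewrite !mulNr.
have [k k0 hk] : exists2 k, 0 < k & forall s t, `|s| < k -> `|t| < k -> N (frame p u (s, t)).
  have : nbhs (frame p u (0, 0)) N by rewrite frame0.
  move=> /(@cont_frame R p u (0, 0))/nbhs_boxP[k k0 h]; exists k => // s t sk tk.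
  by apply: (h (s, t)); rewrite subr0.
have k2 : 0 < k / 2 by rewrite divr_gt0.
have [d [sg [f [g [sgd dk de [cf cg f0 g0 [fd gd hB hU]]]]]]] := cusp_graphs e0 cK u1 k2 Ka Kb Up neg.
have d0 : 0 < d by lra.
have toN s t : `|s| <= d -> `|t| <= d -> N (frame p u (s, t)).
  by move=> sd td; apply: hk; lra.
have near_acc r : 0 < r -> r <= d -> exists x, [/\ D x, 0 < (lcoord p u x).1 < r & `|(lcoord p u x).2| < r].
  move=> r0 rd; have [x [Dx xp x1]] := acc r r0; exists x; split => //.
    by rewrite x1; have [h _] := lcoord_le_rho p x u1; move: h; rewrite ler_norml; lra.
  by have [_ h] := lcoord_le_rho p x u1; exact: le_lt_trans h xp.
have midline t : `|t| <= d -> ~ D (frame p u (0, t)).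
  move=> td; apply: (cnbhd_notin cD); move: td; case: (ger0P t) => t0 td.
    exists (p.1 + e * u.1, p.2 + e * u.2) => //.
    by rewrite sqd_lcoord// lcoord_normal// /sqd /= subr0; nra.
  exists (p.1 + - e * u.1, p.2 + - e * u.2) => //.
  by rewrite sqd_lcoord// lcoord_normal// /sqd /= subr0; nra.
have Dpos y : D y -> `|(lcoord p u y).1| <= d -> `|(lcoord p u y).2| <= d -> 0 < (lcoord p u y).1.
  move=> Dy y1 y2; have [x [Dx x1 x2]] := near_acc d d0 (lexx d).
  have Nx : N x.
    rewrite -(lcoordK p u1 x) [lcoord p u x]surjective_pairing; apply: toN; rewrite ?(ltW x2)//.
    by rewrite gtr0_norm; case/andP: x1 => // _ /ltW.
  have Ny : N y by rewrite -(lcoordK p u1 y) [lcoord p u y]surjective_pairing; exact: toN.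
  have := sideN x y Nx Ny Dx Dy; rewrite pmulr_rge0; last by case/andP: x1.
  rewrite le_eqVlt => /orP[/eqP E|//]; exfalso.
  by apply: (midline (lcoord p u y).2) => //; rewrite [X in (X, _)]E -surjective_pairing lcoordK.
have [m m0 open_cusp] : exists2 m, 0 < m <= sg & forall s, 0 < s <= m -> f s < g s.
  (* A blocked abscissa [s1] would trap [D] between it and the segment through [p]. *)
  apply: contrapT => nm.
  have [sg0 sgd'] := andP sgd.
  have [x0 [Dx0 x01 _]] := near_acc sg sg0 sgd'.
  have [s1 [s10 s1x gf]] : exists s1, [/\ 0 < s1, s1 <= (lcoord p u x0).1 / 2 & g s1 <= f s1].
    apply: contrapT => ns; apply: nm; exists ((lcoord p u x0).1 / 2); first lra.
    move=> s sm; rewrite ltNge; apply/negP => gf; apply: ns; exists s.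
    by split => //; clear - e0 cK Kchain cD sm; lra.
  have [x2 [Dx2 x21 x22]] := near_acc s1 s10 ltac:(lra).
  have cL := @cont_lcoord R p u.
  have c1 : continuous (fun x => (lcoord p u x).1) by exact: cont_fst.
  have c2 : continuous (fun x => `|(lcoord p u x).2|) by apply: cont_norm; exact: cont_snd.
  pose V := [set x | 0 < (lcoord p u x).1] `&` [set x | (lcoord p u x).1 < s1] `&`
    [set x | `|(lcoord p u x).2| < d].
  pose V' := [set x | 0 <= (lcoord p u x).1] `&` [set x | (lcoord p u x).1 <= s1] `&`
    [set x | `|(lcoord p u x).2| <= d].
  suff /(_ x0 Dx0)[[_ h] _] : D `<=` V by rewrite /mkset in h; clear - e0 cK Kchain cD h s1x x01 s10; lra.
  apply: (@connected_trap R D V V') => //.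
  - exact: (is_component_connected cD).
  - by apply: openI; [apply: openI|]; apply: open_ltf => //; exact: contC.
  - by apply: closedI; [apply: closedI|]; apply: closed_lef => //; exact: contC.
  - by move=> x [[/ltW h1 /ltW h2] /ltW h3].
  - move=> y [Dy [[y0 y1] y2]]; rewrite /mkset in y0 y1 y2.
    have yp : 0 < (lcoord p u y).1 by apply: Dpos => //; rewrite ger0_norm//; clear - e0 cK Kchain cD y1 s1x x01 sgd; lra.
    have nB := is_component_sub cD Dy.
    have ys : 0 < (lcoord p u y).1 <= sg by rewrite yp; clear - e0 cK Kchain cD y1 s1x x01; lra.
    have := hB _ _ ys y2; rewrite -surjective_pairing lcoordK// => hBy.
    have ysn : `|(lcoord p u y).1| <= sg by rewrite gtr0_norm//; case/andP: ys.
    have fy := fd _ ysn; have gy := gd _ ysn.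
    split; [split => //|]; rewrite /mkset.
      rewrite lt_neqAle y1 andbT; apply/eqP => E; apply: nB; apply/hBy; rewrite E.
      by case: (leP (lcoord p u y).2 (f s1)) => h; [left|right; clear - e0 cK Kchain cD h gf; lra].
    rewrite lt_neqAle y2 andbT; apply/eqP => E; apply: nB; apply/hBy.
    by move: E; case: (ger0P (lcoord p u y).2) => h E; [right|left]; clear - e0 cK Kchain cD E fy gy; lra.
  - exists x2; split => //; case/andP: x21 => x21 x21'; split; first by split.
    by rewrite /mkset (lt_le_trans x22)//; clear - e0 cK Kchain cD s1x x01 sgd; lra.
have mid s : 0 < s <= m -> f s < (f s + g s) / 2 < g s.
  by move=> sm; have := open_cusp s sm; lra.
(* Vertically to the curve midway between the graphs, along it, and vertically again. *)
have region s t : 0 < s <= m -> f s < t < g s -> D (frame p u (s, t)).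
  have out (a b : R) : 0 < a <= m -> f a < b < g a -> (~` cnbhd e K) (frame p u (a, b)).
    move=> am ab; have as_ : 0 < a <= sg by clear - e0 cK Kchain cD am m0; lra.
    have an : `|a| <= sg by rewrite gtr0_norm; case/andP: as_.
    have fa := fd a an; have ga := gd a an.
    have bd : `|b| <= d by rewrite ler_norml; clear - e0 cK Kchain cD fa ga ab; lra.
    by case/(hB a b as_ bd) => h; clear - e0 cK Kchain cD ab h; lra.
  have vert (a b b' : R) : 0 < a <= m -> f a < b < g a -> f a < b' < g a ->
      connected_component (~` cnbhd e K) (frame p u (a, b)) (frame p u (a, b')).
    move=> am ab ab'; apply: seg_component => w w01; rewrite seg_frame /seg /= subrr mulr0 addr0.
    by apply: out => //; exact: convex_lt.
  pose q r := frame p u (r, (f r + g r) / 2).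
  have cq : continuous q by apply: (cont_compP (@cont_frame R p u)); cont.
  have along (a b : R) : 0 < a -> a <= b -> b <= m -> connected_component (~` cnbhd e K) (q a) (q b).
    move=> a0 ab bm; apply: path_component => // w w01.
    have wm : 0 < w <= m by clear - e0 cK Kchain cD a0 bm w01; lra.
    by apply: out => //; exact: mid.
  have [m0' msg] := andP m0; have [_ sgd'] := andP sgd.
  have [x [Dx x1 x2]] := near_acc m m0' (le_trans msg sgd').
  have xE : x = frame p u ((lcoord p u x).1, (lcoord p u x).2).
    by rewrite -surjective_pairing lcoordK.
  set a := (lcoord p u x).1 in xE x1; set b := (lcoord p u x).2 in xE x2.
  have am : 0 < a <= m by case/andP: x1 => -> /ltW.
  have ab : f a < b < g a.
    have := is_component_sub cD Dx; rewrite xE => nB.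
    have as_ : 0 < a <= sg by clear - e0 cK Kchain cD am m0; lra.
    have bd : `|b| <= d by clear - e0 cK Kchain cD x2 m0 sgd; lra.
    rewrite !ltNge; apply/andP; split; apply/negP => h; apply: nB; apply/(hB a b as_ bd).
      by left.
    by right.
  move=> sm ft; apply: (component_in cD Dx); rewrite xE.
  apply: connected_component_trans (vert a b _ am ab (mid a am)) _.
  apply: (connected_component_trans (y := q s)); last exact: vert (mid s sm) ft.
  case/andP: am => a0 am'; case/andP: sm => s0 sm'.
  have [as_|sa] := leP a s; first exact: along.
  by apply: connected_component_sym; apply: along => //; exact: ltW.
have m0' : 0 < m by case/andP: m0.
have msg : m <= sg by case/andP: m0.
have sgd' : sg <= d by case/andP: sgd.
have md : m <= d := le_trans msg sgd'.
have small s : 0 < s <= m -> 0 < s <= sg /\ `|s| <= sg.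
  by move=> /andP[s0 sm]; rewrite s0 (ger0_norm (ltW s0)) (le_trans sm).
have edge s t : 0 < s <= m -> t = f s \/ t = g s -> C (frame p u (s, t)).
  move=> sm ts; have [ss sn] := small s sm.
  have fs := fd s sn; have gs := gd s sn; have fg := open_cusp s sm.
  have td : `|t| <= d.
    by case: ts => ->; rewrite ler_norml; clear - e0 cK Kchain cD fs gs; lra.
  split; last first.
    by apply: (cnbhd_notin cD); apply/(hB s t ss td); case: ts => ->; [left|right].
  move=> W /nbhs_frame[w w0 hw].
  have [n [n0 n1 n2]] : exists n, [/\ 0 < n, n <= w / 2 & n <= (g s - f s) / 2].
    by apply: exists_le2; rewrite divr_gt0// subr_gt0.
  have nw : `|n| < w by rewrite gtr0_norm//; clear - e0 cK Kchain cD w0 n1; lra.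
  case: ts => ts.
    exists (frame p u (s, t + n)); split; last exact: hw.
    by apply: region => //; clear - e0 cK Kchain cD ts n0 n2 fg; lra.
  exists (frame p u (s, t - n)); split; last by apply: hw; rewrite normrN.
  by apply: region => //; clear - e0 cK Kchain cD ts n0 n2 fg; lra.
apply: (chart_of_two_graphs u1 m0' cf cg f0 g0 (d := d)).
- by move=> s sm; apply: fd; exact: le_trans sm msg.
- by move=> s sm; apply: gd; exact: le_trans sm msg.
- exact: open_cusp.
- by split.
- by move=> s sm; apply: edge => //; left.
- by move=> s sm; apply: edge => //; right.
(* For [a < 0] there would be points of [D] on the wrong side; for [a > 0] a point of the closed but
   not the open neighbourhood is on a graph; for [a = 0] only [p] escapes the two open discs. *)
move=> a b am bd [cly Dy]; have [By Uy] := closure_component e0 cK cD cly Dy.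
have [a0|a0|a0] := ltgtP a 0.
- exfalso.
  have [|z [Dz [[z1 z2] z0]]] := cly (box p u m d `&` [set z | (lcoord p u z).1 < 0]).
    apply: open_nbhs_nbhs; split; last by rewrite /box /setI /mkset frameK.
    apply: openI; first exact: open_box.
    by apply: open_ltf; [apply: cont_fst; exact: cont_lcoord|exact: contC].
  have z0' : 0 < (lcoord p u z).1.
    by apply: Dpos => //; apply: ltW => //; exact: lt_le_trans z1 md.
  by have := lt_trans z0' z0; rewrite ltxx.
- right; have am' : a <= m by move: am; rewrite gtr0_norm// => /ltW.
  have [ss _] := small a ltac:(by rewrite a0 am'); split => //.
  have nU : ~ (b < f a \/ g a < b) by move/(hU a b ss (ltW bd)).
  case: ((hB a b ss (ltW bd)).1 By) => bf; [left|right]; apply/eqP; rewrite eq_le bf ?andbT /=.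
    by rewrite leNgt; apply/negP => h'; apply: nU; left.
  by rewrite leNgt; apply/negP => h'; apply: nU; right.
- left; split => //; apply: contrapT => b0; apply: Uy; rewrite a0.
  have b2 : 0 < `|b| by rewrite normr_gt0; exact/eqP.
  have be : `|b| < e.
    apply: lt_le_trans bd (le_trans de _).
    by rewrite ler_pdivrMr// ler_peMr ?(ltW e0)// ler1n.
  have sq (c : R) : 0 < c -> c < e -> 0 ^+ 2 + (c - e) ^+ 2 < e ^+ 2.
    by clear - e0 cK Kchain cD; move=> c0 ce; nra.
  case: (ger0P b) b2 be => b0' b2 be.
    exists (p.1 + e * u.1, p.2 + e * u.2) => //.
    by rewrite sqd_lcoord// lcoord_normal// /sqd /= subr0; exact: sq.
  exists (p.1 + - e * u.1, p.2 + - e * u.2) => //.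
  rewrite sqd_lcoord// lcoord_normal// /sqd /= subr0 (_ : b - - e = - (- b - e)) ?sqrrN; last by ring.
  exact: sq.
Qed.

(** If one of the two antipodal positions is empty, tilting the normal [w] slightly towards it makes
    all nearest points strictly negative, and the regular case applies. *)
Lemma boundary_chart p : C p -> exists g t, [/\ chart C g, 0 < t < 1 & g t = p].
Proof.
move=> [clp Dp]; have [Bp Up] := closure_component e0 cK cD clp Dp.
have [w [w1 acc neg]] := limit_direction e0 cD clp Dp.
(* With this choice the first axis of the frame is [w] itself. *)
pose u : pt := (w.2, - w.1).
have w1' : w.1 * w.1 + w.2 * w.2 = 1 by [].
have u1 : dotp u u = 1 by rewrite -w1 /u /dotp /=; ring.
have lw x : (lcoord p u x).1 = dotp w (x.1 - p.1, x.2 - p.2) by rewrite /u /lcoord /dotp /=; ring.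
have acc' r : 0 < r -> exists x, [/\ D x, rho x p < r & 0 < (lcoord p u x).1].
  by move=> /acc[x [? ? ?]]; exists x; rewrite lw.
have neg' a : K a -> sqd a p <= e ^+ 2 -> (lcoord p u a).1 <= 0.
  by move=> Ka ap; rewrite lw; exact: neg.
have [[Ka Kb]|nK] := pselect (K (p.1 + e * u.1, p.2 + e * u.2) /\ K (p.1 + - e * u.1, p.2 + - e * u.2)).
  exact: (cusp_chart u1 clp Dp Ka Kb neg' acc').
have [c [c1 nKc]] : exists c, (c = 1 \/ c = - 1) /\ ~ K (p.1 + e * (c * u.1), p.2 + e * (c * u.2)).
  have [Ka|nKa] := pselect (K (p.1 + e * u.1, p.2 + e * u.2)); last first.
    by exists 1; split; [left|rewrite !mul1r].
  exists (- 1); split; first by right.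
  have eN (z : R) : e * (- 1 * z) = - e * z by ring.
  by rewrite !eN => Kb; apply: nK.
have e2 : 0 < e ^+ 2 by rewrite exprn_gt0.
have cc : c * c = 1 by case: c1 => ->; ring.
pose tc a := c * (lcoord p u a).2.
pose sc a := (lcoord p u a).1.
have cL := @cont_lcoord R p u.
have ctc : continuous tc by apply: contM; [exact: contC|exact: cont_snd].
have csc : continuous sc by exact: cont_fst.
have onc a : K a -> sqd a p <= e ^+ 2 -> sc a ^+ 2 + tc a ^+ 2 = e ^+ 2.
  move=> Ka ap; have := sqd_lcoord_p p u1 a; rewrite /sc /tc exprMn (expr2 c) cc mul1r => <-.
  by apply/eqP; rewrite eq_le ap /= leNgt; apply/negP => h; apply: Up; exists a => //; rewrite sqdC.
pose M := K `&` [set a | sqd a p <= e ^+ 2] `&` [set a | - (e / 2) <= tc a].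
have cM : compact M.
  apply: compact_closedI; last by apply: closed_lef => //; exact: contC.
  apply: compact_closedI => //; apply: closed_lef; last exact: contC.
  by apply: cont_sqd; [exact: cont_id|exact: contC].
have [k k0 hk] : exists2 k, 0 < k & forall a, M a -> sc a <= - k.
  apply: compact_neg => // a [[Ka ap] at0]; rewrite /mkset in ap at0.
  have := neg' a Ka ap; rewrite -/(sc a) le_eqVlt => /orP[/eqP s0|//]; exfalso.
  have := onc a Ka ap; rewrite s0 expr0n /= add0r => t2.
  have te := sqr_eq_pos e0 at0 t2.
  apply: nKc; rewrite (_ : (_, _) = a) //.
  rewrite -[RHS](lcoordK p u1 a) [lcoord p u a]surjective_pairing -/(sc a) s0.
  have -> : (lcoord p u a).2 = c * e by rewrite -te /tc mulrA cc mul1r.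
  by rewrite /frame /=; congr (_, _); ring.
(* The tilt uses up at most half of the margin [k] of the points in [M]; for the remaining nearest
   points [tc] is negative, so the tilt helps. *)
pose l := k / (2 * e).
have l0 : 0 < l by rewrite divr_gt0// mulr_gt0.
have le : l * e = k / 2 by rewrite /l; field; rewrite gt_eqF.
pose n := Num.sqrt (1 + l ^+ 2).
have n2 : n ^+ 2 = 1 + l ^+ 2 by rewrite sqr_sqrtr// addr_ge0// sqr_ge0.
have n0 : 0 < n by rewrite sqrtr_gt0 ltr_pwDl// sqr_ge0.
pose v : pt := ((w.1 + l * (c * u.1)) / n, (w.2 + l * (c * u.2)) / n).
have v1 : dotp v v = 1.
  rewrite (_ : dotp v v = ((w.1 * w.1 + w.2 * w.2) * (1 + l ^+ 2 * (c * c))) / n ^+ 2).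
    by rewrite w1' cc mulr1 mul1r -n2 divff// gt_eqF// exprn_gt0.
  by rewrite /v /u /dotp /=; field; rewrite gt_eqF.
apply: (regular_chart e0 cK cD v1 clp Dp) => a Ka ap.
have -> : (lcoord p v a).2 = (sc a + l * tc a) / n.
  by rewrite /lcoord /v /sc /tc /lcoord /u /=; ring.
rewrite pmulr_llt0 ?invr_gt0//.
have := onc a Ka ap => sph.
have te := le_of_sum_sqr e0 sph.
have [h|h] := leP (- (e / 2)) (tc a).
  have sk : sc a <= - k by apply: hk.
  have : l * tc a <= l * e by rewrite ler_wpM2l// ltW.
  by rewrite le; lra.
have : sc a <= 0 by exact: neg'.
have : l * tc a < l * 0 by rewrite ltr_pM2l//; lra.
lra.
Qed.

End BoundaryCharts.


(** * Inside and outside *)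

Section Sides.
Variables (R : realType) (e : R) (K D : set (R * R)).
Local Notation pt := (R * R)%type.
Implicit Types (p q x y z u a b : pt) (s t r d : R) (X : set pt).
Hypothesis e0 : 0 < e.
Hypothesis cK : compact K.
Hypothesis K0 : K !=set0.
Hypothesis Kchain : forall T : pt -> pt -> Prop,
  (forall x y z, T x y -> T y z -> T x z) ->
  (forall x y, K x -> K y -> rho x y < 2 * e -> T x y) ->
  forall x y, K x -> K y -> T x y.
Hypothesis cD : is_component (~` cnbhd e K) D.

Let C := closure D `\` D.

Lemma frontier_sub : C `<=` cnbhd e K `\` onbhd e K.
Proof. by move=> x [clx Dx]; have [] := closure_component e0 cK cD clx Dx. Qed.

Lemma component_trapped x y : D x -> connected_component (~` C) x y -> D y.
Proof.
move=> Dx xy.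
suff : connected_component (~` C) x `<=` D by apply.
have oD := component_open e0 cK cD.
apply: (@connected_trap R _ D (closure D)) => //.
- exact: component_connected.
- exact: closed_closure.
- exact: subset_closure.
- move=> z [xz clz]; apply: contrapT => Dz.
  by have := connected_component_sub xz; apply; split.
- exists x; split => //; apply: connected_component_refl => -[_]; exact.
Qed.

Lemma far_component (M : R) x y : 0 <= M -> (forall z, cnbhd e K z -> rho z (0, 0) <= M) ->
  M < `|x.1| \/ M < `|x.2| -> M < `|y.1| \/ M < `|y.2| ->
  connected_component (~` cnbhd e K) x y.
Proof.
move=> M0 hM.
have out z : M < `|z.1| \/ M < `|z.2| -> (~` cnbhd e K) z.
  move=> h /hM; have := normr_le_rho1 z (0, 0); have := normr_le_rho2 z (0, 0).
  by rewrite /= !subr0; case: h; lra.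
have hor (a b v : R) : M < `|v| -> connected_component (~` cnbhd e K) (a, v) (b, v).
  move=> Mv; apply: seg_component => t _; rewrite /seg /= subrr mulr0 addr0.
  by apply: out; right.
have ver (a b v : R) : M < `|v| -> connected_component (~` cnbhd e K) (v, a) (v, b).
  move=> Mv; apply: seg_component => t _; rewrite /seg /= subrr mulr0 addr0.
  by apply: out; left.
have MN : M < `|M + 1| by rewrite gtr0_norm; lra.
have corner z : M < `|z.1| \/ M < `|z.2| ->
    connected_component (~` cnbhd e K) z (M + 1, M + 1).
  case: z => z1 z2 /= [h|h].
    by apply: connected_component_trans (ver z2 (M + 1) z1 h) _; exact: hor.
  by apply: connected_component_trans (hor z1 (M + 1) z2 h) _; exact: ver.
move=> /corner xc /corner yc; apply: connected_component_trans xc _.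
exact: connected_component_sym.
Qed.

(** An unbounded [D] reaches beyond a square containing the neighbourhood, and all of that outer
    region lies in one component. *)
Lemma compl_bounded : ~ bounded_pt D -> bounded_pt (~` D).
Proof.
move=> nD; have [M0 hM0] := compact_bounded_pt (compact_cnbhd (ltW e0) cK).
pose M := `|M0|; have Mge0 : 0 <= M by exact: normr_ge0.
have hM z : cnbhd e K z -> rho z (0, 0) <= M.
  by move=> /hM0 h; apply: le_trans h (ler_norm _).
have far z : ~ rho z (0, 0) <= 2 * M -> M < `|z.1| \/ M < `|z.2|.
  move=> h; apply: contrapT => /not_orP[/negP + /negP]; rewrite -!leNgt !ler_norml => h1 h2.
  by apply: h; rewrite rho_le ?mulr_ge0// /sqd /= !subr0; nra.
have [y Dy /far fy] : exists2 y, D y & ~ rho y (0, 0) <= 2 * M.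
  apply: contrapT => h; apply: nD; exists (2 * M) => y Dy.
  by apply: contrapT => h'; apply: h; exists y.
exists (2 * M) => x Dx; apply: contrapT => /far fx; apply: Dx.
exact: (component_in cD Dy (far_component Mge0 hM fy fx)).
Qed.

(* Where a segment from outside to a nearest point of [K] enters the neighbourhood, the
   outside is locally connected. *)
Lemma entry_notin_closure x a : ~ closure D x -> K a ->
  (forall b, K b -> rho x a <= rho x b) -> ~ cnbhd e K x ->
  ~ closure D (a.1 + e * ((x.1 - a.1) / rho x a), a.2 + e * ((x.2 - a.2) / rho x a)).
Proof.
move=> Dx Ka near Bx.
have [r rE] : exists r, rho x a = r by exists (rho x a).
rewrite rE; set q := (_, _) => clq.
have er : e < r.
  by rewrite -rE ltNge; apply/negP => h; apply: Bx; exists a => //; rewrite -rho_le// ltW.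
have r0 : 0 < r := lt_trans e0 er.
pose u : pt := ((x.1 - a.1) / r, (x.2 - a.2) / r).
have u1 : dotp u u = 1.
  rewrite (_ : dotp u u = sqd x a / r ^+ 2).
    by rewrite -rho_sqr rE divff// gt_eqF// exprn_gt0.
  by rewrite /dotp /u /sqd /=; field; rewrite gt_eqF.
have uE : (r * u.1 = x.1 - a.1) * (r * u.2 = x.2 - a.2).
  by split; rewrite /u /= mulrC mulfVK// gt_eqF.
have qE : q = (a.1 + e * u.1, a.2 + e * u.2) by [].
have fE w : frame q u (0, w) = seg x a (1 - (e + w) / r).
  rewrite /frame /seg qE /=; congr (_, _).
    rewrite (_ : a.1 = x.1 - r * u.1); last by rewrite uE; ring.
    by field; rewrite gt_eqF.
  rewrite (_ : a.2 = x.2 - r * u.2); last by rewrite uE; ring.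
  by field; rewrite gt_eqF.
have fx : frame q u (0, r - e) = x.
  by rewrite fE (_ : 1 - _ = 0) ?seg0// (addrC e) subrK divff ?gt_eqF// subrr.
have dist (w : R) b : 0 <= w <= r - e -> K b -> e + w <= rho (frame q u (0, w)) b.
  move=> w0 Kb; rewrite fE.
  have w01 : 0 <= 1 - (e + w) / r <= 1.
    have [w1 w2] := andP w0.
    by rewrite subr_ge0 ler_pdivrMr// mul1r -lerBrDl w2 gerBl divr_ge0 ?addr_ge0 ?(ltW e0) ?(ltW r0).
  apply: le_trans (rho_seg_nearest near Kb w01).
  by rewrite subKr rE mulfVK// gt_eqF.
have Bq : cnbhd e K q.
  exists a => //; rewrite -(frame0 q u) sqd_lcoord//.
  rewrite (_ : lcoord q u a = (0, - e)); first by rewrite /sqd /=; lra.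
  rewrite -(lcoord_normal q (- e) u1) qE /=; congr lcoord.
  by rewrite [a in LHS]surjective_pairing; congr (_, _); ring.
have Uq : ~ onbhd e K q.
  move=> [b Kb]; rewrite -rho_lt ?(ltW e0)// => qb.
  by have := dist 0 b ltac:(lra) Kb; rewrite frame0; lra.
(* A centre within [e] of [q] but not below it would be closer to [x] than the nearest point. *)
have neg b : K b -> sqd b q <= e ^+ 2 -> (lcoord q u b).2 < 0.
  move=> Kb; rewrite (sqd_lcoord_p q u1) => bq.
  have : r ^+ 2 <= sqd x b.
    by rewrite -rho_sqr ler_sqr ?nnegrE ?rho_ge0 ?(ltW r0)// -rE; exact: near.
  rewrite -{1}fx sqd_lcoord// /sqd; move: bq; set c := lcoord q u b; clear - e0 er => /= bq h.
  rewrite ltNge; apply/negP => c2.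
  have : 0 <= (r - e) * c.2 by rewrite mulr_ge0//; lra.
  have : 0 < (r - e) * e by rewrite mulr_gt0//; lra.
  nra.
have [d [sg [f [sgd cf f0 fd hf]]]] := regular_graph e0 cK u1 Bq Uq neg.
have oB : nbhs q (box q u sg d) by apply: open_nbhs_nbhs; split; [exact: open_box|apply: box_p; lra].
have [y [Dy [y1 y2]]] := clq _ oB.
have yE : y = frame q u ((lcoord q u y).1, (lcoord q u y).2).
  by rewrite -surjective_pairing lcoordK.
have [w [w0 wd wr]] : exists w, [/\ 0 < w, w <= d & w <= r - e].
  by apply: exists_le2; rewrite ?subr_gt0//; case/andP: sgd => ?; exact: lt_le_trans.
have fy : f (lcoord q u y).1 < (lcoord q u y).2 <= d.
  move: (y2); rewrite ltr_norml => y2'; apply/andP; split; last lra.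
  rewrite ltNge; apply/negP => h.
  apply: (is_component_sub cD Dy); rewrite yE; apply/(hf _ _ (ltW y1) _).1 => //.
  by rewrite ler_norml; lra.
have sg0 : `|0 : R| <= sg by rewrite normr0; lra.
(* [D] can approach [q] only from above the graph, and that region is joined to [x] along the
   segment. *)
have c1 := regular_component u1 sgd fd hf sg0 (ltW y1) (s := 0) (t := w) ltac:(rewrite f0; lra) fy.
have c2 : connected_component (~` cnbhd e K) x (frame q u (0, w)).
  rewrite -fx; apply: seg_component => t t01; rewrite seg_frame /seg /= subrr mulr0 addr0.
  move=> [b Kb]; rewrite -rho_le ?(ltW e0)// => h.
  have := dist (r - e + t * (w - (r - e))) b ltac:(nra) Kb; nra.
apply: Dx; apply: subset_closure; apply: (component_in cD Dy).
apply: connected_component_sym; apply: connected_component_trans c2 _.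
by rewrite yE.
Qed.

Lemma exterior_component x a : ~ closure D x -> K a -> connected_component (~` C) x a.
Proof.
move=> Dx Ka.
have UC : onbhd e K `<=` ~` C by move=> z Uz /frontier_sub[].
have KU b : K b -> onbhd e K b.
  by move=> Kb; exists b => //; rewrite /sqd !subrr expr0n /= addr0 exprn_gt0.
have toa b : K b -> connected_component (~` C) b a.
  move=> Kb; apply: (connected_component_mono UC).
  by apply: (onbhd_component e0 Kchain); exact: KU.
have Cx : ~ C x by move=> [].
have [[b Kb xb]|Bx] := pselect (cnbhd e K x).
  apply: connected_component_trans (toa b Kb); apply: seg_component => t /andP[t0 t1].
  have [->|tn] := eqVneq t 0; first by rewrite seg0.
  by apply: UC; apply: seg_onbhd => //; rewrite lt_def tn t0.
have [b Kb near] := nearestP x cK K0.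
apply: connected_component_trans (toa b Kb); apply: seg_component => t t01.
have nq := entry_notin_closure Dx Kb near Bx.
have [r rE] : exists r, rho x b = r by exists (rho x b).
rewrite rE in nq; have er : e < r.
  by rewrite -rE ltNge; apply/negP => h; apply: Bx; exists b => //; rewrite -rho_le// ltW.
have r0 : r != 0 by rewrite gt_eqF// (lt_trans e0).
(* Before the entry the segment is off the closed neighbourhood, after it in the open one; only the
   entry itself needs [nq]. *)
have [h|h|h] := ltgtP e ((1 - t) * r).
- move=> /frontier_sub[[c Kc]]; rewrite -rho_le ?(ltW e0)// => h' _.
  by have := rho_seg_nearest near Kc t01; rewrite rE; lra.
- by apply: UC; exists b => //; rewrite -rho_lt ?(ltW e0)// rho_seg_r ?rE//; case/andP: t01.
- move=> [clq _]; apply: nq; rewrite (_ : (_, _) = seg x b t) // h /seg.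
  by congr (_, _); field.
Qed.

End Sides.


(** * The frontier curve and its two sides *)

Theorem theorem1 (R : realType) (eps : R) (A D : set (R * R)) :
  0 < eps ->
  A !=set0 ->
  bounded_pt A ->
  chained (2 * eps) A ->
  is_component (~` Bnbhd eps A) D ->
  simple_closed_curve (boundary D) /\
  boundary D `<=` Sbdry eps A /\
  (bounded_pt D -> D = inside (boundary D)) /\
  (~ bounded_pt D -> D = outside (boundary D)).
Proof.
move=> e0 A0 bA chA; rewrite Bnbhd_cnbhd//; set K := closure A => cD.
have cK : compact K.
  by apply: bounded_closed_compact_pt; [exact: closed_closure|exact: closure_bounded].
have K0 : K !=set0 by case: A0 => a Aa; exists a; exact: subset_closure.
have Kchain (T : R * R -> R * R -> Prop) : (forall x y z, T x y -> T y z -> T x z) ->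
    (forall x y, K x -> K y -> rho x y < 2 * eps -> T x y) -> forall x y, K x -> K y -> T x y.
  exact: chained_closure_ind.
have [a Ka] := K0.
have oD := component_open e0 cK cD.
rewrite boundary_open//; set C := (closure D `\` D).
have Ccl x : ~ C x -> ~ D x -> ~ closure D x by move=> nC nD clx; apply: nC.
have [x0 Dx0] := is_component_ne cD.
have nDa : ~ D a.
  apply: (cnbhd_notin cD); exists a => //.
  by rewrite /sqd !subrr expr0n /= addr0 exprn_ge0// ltW.
have cC : compact C by have := compact_boundary e0 cK cD; rewrite boundary_open.
have C0 : C !=set0.
  by have [t _ Ct] := segment_meets_frontier oD Dx0 nDa; exists (seg x0 a t).
have conC : connected C.
  apply: frontier_connected => //; first exact: is_component_connected cD.
  exact: (compl_component_connected e0 Kchain cK K0 cD).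
have DC x : D x -> ~ C x by move=> Dx [].
have comp_le x : D x -> connected_component (~` C) x `<=` D.
  by move=> Dx y; exact: (component_trapped e0 cK cD).
split; first exact: (closed_curve_of_charts conC (boundary_chart e0 cK Kchain cD)).
split; first by move=> x /(frontier_sub e0 cK cD); exact: Sbdry_cnbhd.
split=> bD; apply/seteqP; split => x.
- by move=> Dx; split; [exact: DC|exact: bounded_sub (comp_le x Dx) bD].
- move=> [nC bx]; apply: contrapT => nD.
  have xa := exterior_component e0 cK K0 Kchain cD (Ccl x nC nD) Ka.
  have [M1 h1] := bx; have [M2 h2] := closure_bounded bD.
  (* [(M, 0)] lies beyond both [D] and the component of [x], both bounded, yet it is joined to [x]
     through [a]. *)
  pose M := `|M1| + `|M2| + 1.
  have Mz : rho (M, 0) (0, 0) = M.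
    by rewrite rhoE /sqd /= !subr0 expr0n /= addr0 sqrtr_sqr ger0_norm// /M !addr_ge0.
  have [m1 m2] : M1 < M /\ M2 < M.
    have := ler_norm M1; have := ler_norm M2; have := normr_ge0 M1; have := normr_ge0 M2.
    by rewrite /M; split; lra.
  have nM : ~ closure D (M, 0) by move=> /h2; rewrite Mz leNgt m2.
  have Ma := exterior_component e0 cK K0 Kchain cD nM Ka.
  have /h1 : connected_component (~` C) x (M, 0).
    by apply: connected_component_trans xa _; exact: connected_component_sym.
  by rewrite Mz leNgt m1.
- move=> Dx; split; first exact: DC.
  move=> bx; apply: bD; apply: bounded_sub bx => y Dy.
  apply: (connected_component_max Dx) => //; last exact: is_component_connected cD.
- move=> [nC bx]; apply: contrapT => nD; apply: bx.
  apply: bounded_sub (compl_bounded e0 cK cD bD) => y xy Dy; apply: nD.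
  exact: (comp_le y Dy) (connected_component_sym xy).
Qed.
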